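(* Let $d\ge 3$ and let $\pi(t)$ be the empirical occupation measure of the VRRW on $\mathcal G_d$, and $\|\cdot\|$ the maximum norm on $\mathbb R^{|V_d|}$. Then for every $\delta>0$: (a) if $d\in\{3,4\}$, $\mathbb P\big(\limsup_{t\to\infty}\|\pi(t)-\pi_{\mathsf{unif}}\|\,t^{1/3-\delta}<\infty\big)=1$; (b) if $d\ge 5$, $\mathbb P\big(\limsup_{t\to\infty}\|\pi(t)-\pi_{\mathsf{unif}}\|\,t^{1/(d-1)}<\infty\big)=1$; (c) if $\mathcal G_d$ has at least one leaf (i.e. $\sum_i r_i\ge 1$), then $\mathbb P\big(\liminf_{t\to\infty}\|\pi(t)-\pi_{\mathsf{unif}}\|\,t^{\frac{d-2}{d-1}+\delta}=\infty\big)=1$.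
   Context: Let $d\ge 2$ and $r_1,\dots,r_d\ge 0$ be integers. The complete-like graph $\mathcal G_d$ has vertex set $V_d=\{1,\dots,d\}\cup\{\ell^i_r: 1\le i\le d,\ 1\le r\le r_i\}$. The vertices $1,\dots,d$ are called interior, and every pair of distinct interior vertices is joined by an edge; for each $i$, the vertices $\ell^i_1,\dots,\ell^i_{r_i}$ are the leaves attached to $i$, each joined by an edge to $i$ only; there are no other edges. Write $v\sim w$ if $v,w$ are joined by an edge. Vertex-reinforced random walk (VRRW) on $\mathcal G_d$: fix positive integers $z(0,v)$, $v\in V_d$, put $t_0=\sum_{v\in V_d}z(0,v)$, let $X(t_0)\in V_d$ be a given starting vertex, and for $t\ge t_0$ let $Z(t,v)=z(0,v)+\#\{s\in\{t_0+1,\dots,t\}: X(s)=v\}$ (so $\sum_v Z(t,v)=t$). Let $\mathcal F_t=\sigma(X(s),t_0\le s\le t)$. The transitions are $\mathbb P(X(t+1)=w\mid\mathcal F_t)=Z(t,w)/\sum_{y\sim X(t)}Z(t,y)$ for $w\sim X(t)$. Let $\pi(t)=(Z(t,v)/t)_{v\in V_d}\in\mathbb R^{|V_d|}$ be the empirical occupation measure, and let $\pi_{\mathsf{unif}}\in\mathbb R^{|V_d|}$ be the vector with coordinate $1/d$ at each interior vertex and $0$ at each leaf. *)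

(* Defs.v *)
From Stdlib Require Import Reals Lra Lia Arith List.
Open Scope R_scope.

(* Interior vertex i (1 <= i <= d) is [Int i]; leaf l^i_k (1 <= k <= r i) is [Leaf i k]. *)
Inductive vertex : Type :=
| Int : nat -> vertex
| Leaf : nat -> nat -> vertex.

Definition vertex_eq_dec (v w : vertex) : {v = w} + {v <> w}.
Proof. decide equality; apply Nat.eq_dec. Defined.

Definition validb (d : nat) (r : nat -> nat) (v : vertex) : bool :=
  match v with
  | Int i => (1 <=? i)%nat && (i <=? d)%nat
  | Leaf i k => (1 <=? i)%nat && (i <=? d)%nat && (1 <=? k)%nat && (k <=? r i)%nat
  end.

Definition vertices (d : nat) (r : nat -> nat) : list vertex :=
  map Int (seq 1 d) ++ flat_map (fun i => map (Leaf i) (seq 1 (r i))) (seq 1 d).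

Definition adjb (d : nat) (r : nat -> nat) (v w : vertex) : bool :=
  validb d r v && validb d r w &&
  match v, w with
  | Int i, Int j => negb (Nat.eqb i j)
  | Int i, Leaf j _ => Nat.eqb i j
  | Leaf j _, Int i => Nat.eqb i j
  | Leaf _ _, Leaf _ _ => false
  end.

Definition sumR {A : Type} (f : A -> R) (l : list A) : R :=
  fold_right (fun a s => f a + s) 0 l.

Definition t0_of (d : nat) (r : nat -> nat) (z0 : vertex -> nat) : nat :=
  fold_right (fun v s => (z0 v + s)%nat) 0%nat (vertices d r).

Definition Zc (t0 : nat) (z0 : vertex -> nat) (p : nat -> vertex) (t : nat) (v : vertex) : nat :=
  (z0 v + length (filter (fun s => if vertex_eq_dec (p s) v then true else false)
                          (seq (S t0) (t - t0))))%nat.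

Definition trans (d : nat) (r : nat -> nat) (z0 : vertex -> nat) (p : nat -> vertex)
    (t : nat) (w : vertex) : R :=
  let t0 := t0_of d r z0 in
  if adjb d r (p t) w then
    INR (Zc t0 z0 p t w) /
    sumR (fun y => if adjb d r (p t) y then INR (Zc t0 z0 p t y) else 0) (vertices d r)
  else 0.

Definition pi_unif (d : nat) (v : vertex) : R :=
  match v with Int _ => / INR d | Leaf _ _ => 0 end.

Definition dist_unif (d : nat) (r : nat -> nat) (z0 : vertex -> nat) (p : nat -> vertex)
    (t : nat) : R :=
  fold_right (fun v m => Rmax (Rabs (INR (Zc (t0_of d r z0) z0 p t v) / INR t - pi_unif d v)) m)
    0 (vertices d r).

Definition is_prob_space (Omega : Type) (F : (Omega -> Prop) -> Prop)
    (P : (Omega -> Prop) -> R) : Prop :=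
  F (fun _ => True) /\
  (forall A, F A -> F (fun w => ~ A w)) /\
  (forall An : nat -> Omega -> Prop, (forall n, F (An n)) -> F (fun w => exists n, An n w)) /\
  (forall A, F A -> 0 <= P A) /\
  P (fun _ => True) = 1 /\
  (forall An : nat -> Omega -> Prop,
      (forall n, F (An n)) ->
      (forall n m w, n <> m -> An n w -> An m w -> False) ->
      infinite_sum (fun n => P (An n)) (P (fun w => exists n, An n w))).

Definition is_VRRW (d : nat) (r : nat -> nat) (z0 : vertex -> nat) (x0 : vertex)
    (Omega : Type) (F : (Omega -> Prop) -> Prop) (P : (Omega -> Prop) -> R)
    (X : nat -> Omega -> vertex) : Prop :=
  let t0 := t0_of d r z0 in
  (forall t v, F (fun w => X t w = v)) /\
  P (fun w => X t0 w = x0) = 1 /\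
  (forall (t : nat) (h : nat -> vertex) (y : vertex), (t0 <= t)%nat ->
     P (fun w => (forall s, (t0 <= s <= t)%nat -> X s w = h s) /\ X (S t) w = y) =
     P (fun w => forall s, (t0 <= s <= t)%nat -> X s w = h s) * trans d r z0 h t y).

(* Main.v *)
(** For an interior vertex [i] let [Z_i] be its occupation count, [L_i] the total count of its leaves,
    [zeta] the sum of all [Z_j], [B_i = zeta - Z_i], and let [y_i], [u_i] accumulate the inverse
    normalisation of the walk over its visits to [i], resp. to the leaves of [i]; [Y] is the sum of the [y_i].
    Up to martingales which converge at speed [O(Z^(-1/3))], [ln Z_i = Y - y_i + u_i] and
    [ln Z_l = y_i] for a leaf [l] of [i].  This is the only probabilistic input: it follows from Ville's
    inequality, applied to [N^2 + 7 Z_v^(-1/3)] where [N] is the martingale whose increments are those of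
    [ln Z_v] minus compensator, multiplied by [Z_v^(1/3)]; boundedness of [N] and Abel summation give the speed.
    The rest is deterministic.

    Every [y_i] diverges, so that, [d] being at least 3, leaves are negligible: [L_i <= C zeta^(1-a)].
    Since [y_i] is essentially the sum over the visits to [i] of [1/B_i], summing
    [ln Z_i = Y - y_i + u_i] over [i] shows that
    [sum_i ((d-1) ln B_i + ln Z_i) - d^2 ln zeta], a nonpositive quantity, dominates
    the sum over interior steps of [(d-1) sum_i 1/B_i - d^2/zeta >= sum_i (Z_i/zeta - 1/d)^2 / zeta].
    The latter sum is thus finite, which forces [Z_i/zeta -> 1/d].
    It follows that [y_i ~ ln zeta / (d-1)], which gives the growth exponent [1/(d-1)] of the leaves and (c).
    For (a) and (b), put [f_i = ln (Z_i/B_i)]: up to an error [O(zeta^(-1/3))] the increments of [f_i - f_j]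
    are [- (exp f_i - exp f_j)] times those of [ln zeta], a contraction whose rate tends to [1/(d-1)]; a first
    pass shows that this rate converges polynomially fast, and a second one then gives the sharp exponent. *)
Require Import Defs.
From Stdlib Require Import Reals List Lra Lia Psatz Arith Bool Classical FunctionalExtensionality PropExtensionality.
From Stdlib Require FinFun.
Import ListNotations.
Open Scope R_scope.

(** * Sums and elementary inequalities *)

(** The exponent 1/3 is dictated by (a). A weight [Z_v^a] produces variances of order [Z_v^(2a-2)]
    at the visits, summable for every [a < 1/2], and the error it leaves allows every rate below
    [a]; in (b) the rate is at most 1/4.

    The obstacle is a circularity: the size of the leaves depends on the [y_i], these depend on the
    proportions of the interior vertices, and the drift of the proportions is only known up to the
    leaves. It is broken by starting from a fact about every trajectory, the alternation of visits,
    which bounds the normalisation at interior vertices by [zeta + c] before anything is known of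
    the leaves, and by improving the leaf bound in stages: [o(B_i)], then [zeta^(1-a)], then
    [zeta^(2/3)].

    The assumption [d >= 3] enters when a leaf of [i] is compared with an interior [j]: the ratio is
    at most of order [exp] of minus the sum of the [y_m] over the remaining interior [m], a sum
    which is empty for [d = 2].

    On the probabilistic side [P] is only known on [F], which need not be complete. An almost sure
    statement thus requires its event to be in [F], besides containing the complement of a null
    event. *)

Fixpoint bsum (f : nat -> R) (n : nat) : R :=
  match n with O => 0 | S m => bsum f m + f m end.

Lemma bsum_telescope_le f g m n : (m <= n)%nat ->
  (forall k, (m <= k < n)%nat -> f k <= g (S k) - g k) ->
  bsum f n - bsum f m <= g n - g m.
Proof.
  intros Hmn H. induction Hmn as [|n Hmn IH]; [lra|].
  simpl. assert (f n <= g (S n) - g n) by (apply H; lia).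
  assert (bsum f n - bsum f m <= g n - g m) by (apply IH; intros; apply H; lia). lra.
Qed.

Lemma bsum_telescope_ge f g m n : (m <= n)%nat ->
  (forall k, (m <= k < n)%nat -> g (S k) - g k <= f k) ->
  g n - g m <= bsum f n - bsum f m.
Proof.
  intros Hmn H. induction Hmn as [|n Hmn IH]; [lra|].
  simpl. assert (g (S n) - g n <= f n) by (apply H; lia).
  assert (g n - g m <= bsum f n - bsum f m) by (apply IH; intros; apply H; lia). lra.
Qed.

Lemma bsum_le f g m n : (m <= n)%nat ->
  (forall k, (m <= k < n)%nat -> f k <= g k) ->
  bsum f n - bsum f m <= bsum g n - bsum g m.
Proof.
  intros Hmn H. apply bsum_telescope_le; auto. intros k Hk. simpl. specialize (H k Hk). lra.
Qed.

Lemma incr_le (g : nat -> R) m n : (m <= n)%nat ->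
  (forall k, (m <= k < n)%nat -> g k <= g (S k)) -> g m <= g n.
Proof.
  intros Hmn H. induction Hmn as [|n Hmn IH]; [lra|].
  assert (g n <= g (S n)) by (apply H; lia).
  assert (g m <= g n) by (apply IH; intros; apply H; lia). lra.
Qed.

Lemma bsum_incr f m n : (m <= n)%nat -> (forall k, 0 <= f k) -> bsum f m <= bsum f n.
Proof. intros Hmn H. apply incr_le; auto. intros k _. simpl. specialize (H k). lra. Qed.

Lemma bsum_scal c f n : bsum (fun k => c * f k) n = c * bsum f n.
Proof. induction n as [|n IH]; simpl; [ring|rewrite IH; ring]. Qed.

Lemma bsum_plus f g n : bsum (fun k => f k + g k) n = bsum f n + bsum g n.
Proof. induction n as [|n IH]; simpl; [ring|rewrite IH; ring]. Qed.

Lemma bsum_ext f g n : (forall k, (k < n)%nat -> f k = g k) -> bsum f n = bsum g n.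
Proof. induction n as [|n IH]; simpl; intros H; auto. rewrite IH, H; auto. Qed.

Lemma bsum_shift f n : bsum f (S n) = f 0%nat + bsum (fun k => f (S k)) n.
Proof. induction n as [|n IH]; [simpl; ring|]. change (bsum f (S (S n))) with (bsum f (S n) + f (S n)). rewrite IH. simpl. ring. Qed.

Lemma sumR_ext {A} (f g : A -> R) l : (forall a, In a l -> f a = g a) -> sumR f l = sumR g l.
Proof.
  induction l as [|a l IH]; simpl; intros H; auto. rewrite (H a), IH; auto.
Qed.

Lemma sumR_plus {A} (f g : A -> R) l : sumR (fun a => f a + g a) l = sumR f l + sumR g l.
Proof. induction l as [|a l IH]; simpl; [ring|rewrite IH; ring]. Qed.

Lemma sumR_minus {A} (f g : A -> R) l : sumR (fun a => f a - g a) l = sumR f l - sumR g l.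
Proof. induction l as [|a l IH]; simpl; [ring|rewrite IH; ring]. Qed.

Lemma sumR_scal {A} c (f : A -> R) l : sumR (fun a => c * f a) l = c * sumR f l.
Proof. induction l as [|a l IH]; simpl; [ring|rewrite IH; ring]. Qed.

Lemma sumR_const {A} c (l : list A) : sumR (fun _ => c) l = INR (length l) * c.
Proof. induction l as [|a l IH]; [simpl; ring|]. simpl length. rewrite S_INR. simpl. rewrite IH. ring. Qed.

Lemma sumR_le {A} (f g : A -> R) l : (forall a, In a l -> f a <= g a) -> sumR f l <= sumR g l.
Proof.
  induction l as [|a l IH]; simpl; intros H; [lra|].
  assert (f a <= g a) by auto. assert (sumR f l <= sumR g l) by auto. lra.
Qed.

Lemma sumR_nonneg {A} (f : A -> R) l : (forall a, In a l -> 0 <= f a) -> 0 <= sumR f l.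
Proof.
  intros H. replace 0 with (sumR (fun _ : A => 0) l) by (rewrite sumR_const; ring).
  apply sumR_le; auto.
Qed.

Lemma sumR_ge_term {A} (f : A -> R) l a :
  (forall b, In b l -> 0 <= f b) -> In a l -> f a <= sumR f l.
Proof.
  induction l as [|b l IH]; simpl; intros H Hin; [tauto|]. destruct Hin as [->|Hin].
  - assert (0 <= sumR f l) by (apply sumR_nonneg; auto). lra.
  - assert (0 <= f b) by auto. assert (f a <= sumR f l) by auto. lra.
Qed.

Lemma sumR_app {A} (f : A -> R) l l' : sumR f (l ++ l') = sumR f l + sumR f l'.
Proof. induction l as [|a l IH]; simpl; [ring|rewrite IH; ring]. Qed.

Lemma sumR_map {A B} (g : A -> B) (f : B -> R) l : sumR f (map g l) = sumR (fun a => f (g a)) l.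
Proof. induction l as [|a l IH]; simpl; auto. rewrite IH; auto. Qed.

Lemma sumR_flat_map {A B} (g : A -> list B) (f : B -> R) l :
  sumR f (flat_map g l) = sumR (fun a => sumR f (g a)) l.
Proof. induction l as [|a l IH]; simpl; auto. rewrite sumR_app, IH; auto. Qed.

Lemma sumR_zero {A} (f : A -> R) l : (forall a, In a l -> f a = 0) -> sumR f l = 0.
Proof. intros H. rewrite (sumR_ext _ (fun _ => 0)) by auto. rewrite sumR_const; ring. Qed.

Lemma sumR_single {A} (f : A -> R) l a : NoDup l -> In a l ->
  (forall b, In b l -> b <> a -> f b = 0) -> sumR f l = f a.
Proof.
  induction l as [|b l IH]; simpl; intros Hnd Hin H; [tauto|].
  inversion Hnd; subst. destruct Hin as [->|Hin].
  - rewrite sumR_zero; [ring|]. intros c Hc. apply H; auto. intros ->; tauto.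
  - rewrite IH; auto. rewrite (H b); auto; [ring|]. intros ->; tauto.
Qed.

Lemma sumR_bsum {A} (f : A -> nat -> R) l n :
  sumR (fun a => bsum (f a) n) l = bsum (fun k => sumR (fun a => f a k) l) n.
Proof.
  induction n as [|n IH]; simpl; [apply sumR_zero; auto|].
  rewrite <- IH, <- sumR_plus. auto.
Qed.

(** Maxima along the list; this turns the constants found for each vertex separately into a common
    one. *)
Lemma uniform_bound (l : list nat) (Q : nat -> R -> Prop) :
  (forall i K K', K <= K' -> Q i K -> Q i K') ->
  (forall i, In i l -> exists K, Q i K) -> exists K, 0 <= K /\ forall i, In i l -> Q i K.
Proof.
  intros Hm. induction l as [|a l IH]; intros H.
  - exists 0. split; [lra|]. simpl; tauto.
  - destruct IH as [K [HK0 HK]]; [intros; apply H; simpl; auto|].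
    destruct (H a) as [K' HK']; [simpl; auto|].
    exists (Rmax K K'). split; [eapply Rle_trans; [apply HK0|apply Rmax_l]|].
    intros i [<-|Hi].
    + eapply Hm; [apply Rmax_r|auto].
    + eapply Hm; [apply Rmax_l|auto].
Qed.

Lemma uniform_index (l : list nat) (Q : nat -> nat -> Prop) :
  (forall i K K', (K <= K')%nat -> Q i K -> Q i K') ->
  (forall i, In i l -> exists K, Q i K) -> exists K, forall i, In i l -> Q i K.
Proof.
  intros Hm. induction l as [|a l IH]; intros H.
  - exists 0%nat. simpl; tauto.
  - destruct IH as [K HK]; [intros; apply H; simpl; auto|].
    destruct (H a) as [K' HK']; [simpl; auto|].
    exists (Nat.max K K'). intros i [<-|Hi]; (eapply Hm; [|eauto]); lia.
Qed.

(** * Logarithms and powers under unit steps *)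

Lemma ln_le_sub1 z : 0 < z -> ln z <= z - 1.
Proof.
  intros H. assert (1 + ln z <= exp (ln z)) by apply exp_ineq1_le. rewrite exp_ln in H0; lra.
Qed.

Lemma ln_ge_inv z : 0 < z -> 1 - / z <= ln z.
Proof.
  intros H. assert (ln (/ z) <= / z - 1) by (apply ln_le_sub1, Rinv_0_lt_compat; auto).
  rewrite ln_Rinv in H0; lra.
Qed.

Lemma ln_mono a b : 0 < a -> a <= b -> ln a <= ln b.
Proof. intros Ha [H| ->]; [left; apply ln_increasing; auto|right; auto]. Qed.

Lemma ln_div a b : 0 < a -> 0 < b -> ln (a / b) = ln a - ln b.
Proof. intros. unfold Rdiv. rewrite ln_mult, ln_Rinv; auto using Rinv_0_lt_compat. Qed.

Lemma ln_nonneg z : 1 <= z -> 0 <= ln z.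
Proof. intros. rewrite <- ln_1. apply ln_mono; lra. Qed.

Lemma ln_step_le z : 0 < z -> ln (z + 1) - ln z <= / z.
Proof.
  intros H. rewrite <- ln_div by lra.
  eapply Rle_trans; [apply ln_le_sub1; apply Rdiv_lt_0_compat; lra|].
  right; field; lra.
Qed.

Lemma ln_step_ge z : 0 < z -> / (z + 1) <= ln (z + 1) - ln z.
Proof.
  intros H. rewrite <- ln_div by lra.
  eapply Rle_trans; [|apply ln_ge_inv; apply Rdiv_lt_0_compat; lra].
  right; field; lra.
Qed.

Lemma ln_step_ge2 z : 0 < z -> / z - / (z * z) <= ln (z + 1) - ln z.
Proof.
  intros H. eapply Rle_trans; [|apply ln_step_ge; auto].
  assert (0 < / (z * z * (z + 1))) by (apply Rinv_0_lt_compat; repeat apply Rmult_lt_0_compat; lra).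
  replace (/ z - / (z * z)) with (/ (z + 1) - / (z * z * (z + 1))) by (field; lra). lra.
Qed.

Lemma Rpower_pos x a : 0 < Rpower x a.
Proof. apply exp_pos. Qed.

Lemma Rpower_mono_l x y a : 0 < x -> x <= y -> 0 <= a -> Rpower x a <= Rpower y a.
Proof. intros. apply Rle_Rpower_l; lra. Qed.

Lemma Rpower_anti x y a : 0 < x -> x <= y -> 0 <= a -> Rpower y (- a) <= Rpower x (- a).
Proof.
  intros. rewrite !Rpower_Ropp. apply Rinv_le_contravar; [apply Rpower_pos|].
  apply Rpower_mono_l; auto.
Qed.

Lemma Rpower_exp_mono x a b : 1 <= x -> a <= b -> Rpower x a <= Rpower x b.
Proof.
  intros Hx Hab. unfold Rpower. assert (0 <= ln x) by (apply ln_nonneg; auto).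
  destruct (Rle_lt_or_eq_dec (a * ln x) (b * ln x)) as [H1|H1].
  - apply Rmult_le_compat_r; auto.
  - left; apply exp_increasing; auto.
  - right; f_equal; auto.
Qed.

Lemma Rpower_le_1 x a : 1 <= x -> 0 <= a -> Rpower x (- a) <= 1.
Proof.
  intros. rewrite <- (Rpower_O x) by lra. apply Rpower_exp_mono; lra.
Qed.

Lemma exp_mono a b : a <= b -> exp a <= exp b.
Proof. intros [H| ->]; [left; apply exp_increasing; auto|lra]. Qed.

(** With [w = a/(z+1)], [(z+1)^(-a) <= z^(-a) exp(-w) <= z^(-a)/(1+w)]. The constant comes from
    [z+1+a <= (2+a) z], an equality at [z = 1]; at [a = 1/3] it is 1/7, the origin of every 7
    below. *)
Lemma Rpower_step z a : 1 <= z -> 0 < a ->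
  a / (2 + a) * Rpower z (- 1 - a) <= Rpower z (- a) - Rpower (z + 1) (- a).
Proof.
  intros Hz Ha. set (w := a / (z + 1)).
  assert (Hw : 0 < w) by (apply Rdiv_lt_0_compat; lra).
  assert (H1 : Rpower (z + 1) (- a) <= Rpower z (- a) * / (1 + w)).
  { unfold Rpower. assert (Hl := ln_step_ge z ltac:(lra)).
    apply Rle_trans with (exp (- a * ln z) * exp (- w)).
    - rewrite <- exp_plus. apply exp_mono. unfold w.
      assert (a * / (z + 1) <= a * (ln (z + 1) - ln z)) by (apply Rmult_le_compat_l; lra).
      unfold Rdiv. lra.
    - apply Rmult_le_compat_l; [left; apply exp_pos|].
      rewrite exp_Ropp. apply Rinv_le_contravar; [lra|]. apply exp_ineq1_le. }
  replace (- 1 - a) with (- a + - (1)) by ring. rewrite Rpower_plus, (Rpower_Ropp z 1), Rpower_1 by lra.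
  assert (Hp := Rpower_pos z (- a)).
  apply Rle_trans with (Rpower z (- a) * (1 - / (1 + w))); [|lra].
  replace (a / (2 + a) * (Rpower z (- a) * / z)) with (Rpower z (- a) * (a / (2 + a) * / z)) by ring.
  apply Rmult_le_compat_l; [lra|].
  replace (1 - / (1 + w)) with (a / (z + 1 + a)) by (unfold w; field; split; lra).
  replace (a / (2 + a) * / z) with (a * / ((2 + a) * z)) by (field; lra).
  apply Rmult_le_compat_l; [lra|]. apply Rinv_le_contravar; nra.
Qed.

(** The counter [q] leaves each of its values once, so this is a sum of [q^(-1-a)] over distinct
    values, however long the waiting times. [e k] marks the increment from [k] to [k+1], and [q k]
    is the value before it. *)
Lemma bsum_counter (q e : nat -> R) a m n : 0 < a -> (m <= n)%nat ->
  (forall k, (m <= k)%nat -> 1 <= q k) ->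
  (forall k, (m <= k)%nat -> (e k = 0 \/ e k = 1) /\ q (S k) = q k + e k) ->
  bsum (fun k => e k * Rpower (q k) (- 1 - a)) n - bsum (fun k => e k * Rpower (q k) (- 1 - a)) m
    <= (2 + a) / a * Rpower (q m) (- a).
Proof.
  intros Ha Hmn Hq He.
  assert (H : bsum (fun k => e k * Rpower (q k) (- 1 - a)) n - bsum (fun k => e k * Rpower (q k) (- 1 - a)) m
    <= - ((2 + a) / a * Rpower (q n) (- a)) - - ((2 + a) / a * Rpower (q m) (- a))).
  { apply (bsum_telescope_le _ (fun k => - ((2 + a) / a * Rpower (q k) (- a)))); auto.
    intros k Hk. destruct (He k) as [[E|E] Hs]; [lia| |]; rewrite Hs, E.
    - rewrite Rplus_0_r. lra.
    - rewrite Rmult_1_l. assert (H := Rpower_step (q k) a (Hq k ltac:(lia)) Ha).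
      assert (Hc : 0 < (2 + a) / a) by (apply Rdiv_lt_0_compat; lra).
      apply (Rmult_le_compat_l ((2 + a) / a)) in H; [|lra].
      replace ((2 + a) / a * (a / (2 + a) * Rpower (q k) (-1 - a))) with (Rpower (q k) (-1 - a)) in H by (field; lra).
      lra. }
  assert (0 < (2 + a) / a * Rpower (q n) (- a)).
  { apply Rmult_lt_0_compat; [apply Rdiv_lt_0_compat; lra|apply Rpower_pos]. }
  lra.
Qed.

(** * Limits, recursions and summation by parts *)

Lemma Rabs_le_inv a b : Rabs a <= b -> - b <= a <= b.
Proof. unfold Rabs. destruct (Rcase_abs a); lra. Qed.

Lemma mono_bounded_cauchy f C : (forall k, f k <= f (S k)) -> (forall k, f k <= C) ->
  forall eps, 0 < eps -> exists m, forall n, (m <= n)%nat -> f n - f m <= eps.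
Proof.
  intros Hf HC eps He.
  destruct (growing_cv f) as (l & Hl).
  - intros n; apply Hf.
  - exists C. intros y (k & ->). apply HC.
  - destruct (Hl (eps / 2) ltac:(lra)) as (m & Hm). exists m. intros n Hn.
    assert (H1 := Hm m (le_n _)). assert (H2 := Hm n Hn). unfold Rdist in *.
    apply Rabs_def2 in H1, H2. lra.
Qed.

Lemma cauchy_limit f rho : (forall m n, (m <= n)%nat -> Rabs (f n - f m) <= rho m) ->
  (forall eps, 0 < eps -> exists m, rho m < eps) ->
  exists l, forall n, Rabs (f n - l) <= rho n.
Proof.
  intros H Hr.
  destruct (R_complete f) as (l & Hl).
  { intros eps He. destruct (Hr (eps / 2) ltac:(lra)) as (N & HN). exists N. intros n m Hn Hm.
    unfold Rdist. replace (f n - f m) with ((f n - f N) - (f m - f N)) by ring.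
    eapply Rle_lt_trans; [apply Rabs_triang|]. rewrite Rabs_Ropp.
    assert (H1 := H N n Hn). assert (H2 := H N m Hm). lra. }
  exists l. intros n. apply Rnot_lt_le. intros Hlt.
  destruct (Hl (Rabs (f n - l) - rho n) ltac:(lra)) as (N & HN).
  specialize (HN (Nat.max n N) ltac:(lia)). specialize (H n (Nat.max n N) ltac:(lia)).
  unfold Rdist in HN. set (y := f (Nat.max n N)) in *.
  assert (Rabs (f n - l) <= Rabs (y - l) + Rabs (y - f n)); [|lra].
  replace (f n - l) with ((y - l) - (y - f n)) by ring.
  eapply Rle_trans; [apply Rabs_triang|]. rewrite Rabs_Ropp. lra.
Qed.

(** [k] is the logarithmic mean, set to the common value when [a = b]. Quantifying over all [c]
    below or above both numbers avoids ordering them. *)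
Lemma log_mean a b : 0 < a -> 0 < b -> exists k, (forall c, c <= a -> c <= b -> c <= k) /\
  (forall c, a <= c -> b <= c -> k <= c) /\ a - b = k * (ln a - ln b).
Proof.
  assert (H : forall a b, 0 < b -> b < a -> exists k, b <= k <= a /\ a - b = k * (ln a - ln b)).
  { clear. intros a b Hb Hab. assert (Hl : ln b < ln a) by (apply ln_increasing; auto).
    exists ((a - b) / (ln a - ln b)). 
    assert (H1 : ln a - ln b <= a / b - 1).
    { rewrite <- ln_div by lra. apply ln_le_sub1. apply Rdiv_lt_0_compat; lra. }
    assert (H2 : 1 - b / a <= ln a - ln b).
    { rewrite <- ln_div by lra. replace (b / a) with (/ (a / b)) by (field; lra). apply ln_ge_inv. apply Rdiv_lt_0_compat; lra. }
    split; [split|field; lra].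
    - apply (Rmult_le_reg_r (ln a - ln b)); [lra|]. unfold Rdiv. rewrite Rmult_assoc, Rinv_l by lra.
      apply (Rmult_le_compat_l b) in H1; [|lra]. replace (b * (a / b - 1)) with (a - b) in H1 by (field; lra). lra.
    - apply (Rmult_le_reg_r (ln a - ln b)); [lra|]. unfold Rdiv. rewrite Rmult_assoc, Rinv_l by lra.
      apply (Rmult_le_compat_l a) in H2; [|lra]. replace (a * (1 - b / a)) with (a - b) in H2 by (field; lra). lra. }
  intros Ha Hb. destruct (Rtotal_order a b) as [Hlt|[->|Hgt]].
  - destruct (H b a Ha Hlt) as (k & Hk & E). exists k. repeat split; intros; lra.
  - exists b. repeat split; intros; lra.
  - destruct (H a b Hb Hgt) as (k & Hk & E). exists k. repeat split; intros; lra.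
Qed.

(** All factors [exp (b k)] are at least 1, so each [c k] may be charged the whole product, which is
    at most [exp Rb]. *)
Lemma discrete_gronwall (A b c : nat -> R) N Rb : 
  (forall k, 0 <= b k) -> (forall k, 0 <= c k) -> (forall k, 0 <= A k) -> (forall n, bsum b n <= Rb) ->
  (forall n, (N <= n)%nat -> A (S n) <= A n * exp (b n) + c n) ->
  forall n, (N <= n)%nat -> A n <= exp Rb * (A N + bsum c n).
Proof.
  intros Hb Hc HA HR Hs n Hn.
  assert (Hbs : forall k, 0 <= bsum b k) by (intros k; change 0 with (bsum b 0); apply bsum_incr; [lia|auto]).
  assert (Hcs : forall k, 0 <= bsum c k) by (intros k; change 0 with (bsum c 0); apply bsum_incr; [lia|auto]).
  assert (H : A n <= exp (bsum b n) * (A N + bsum c n)).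
  { induction Hn as [|n Hn IH].
    - assert (H1 := exp_ineq1_le (bsum b N)). assert (H2 := HA N). specialize (Hcs N). specialize (Hbs N). nra.
    - simpl bsum. rewrite exp_plus. eapply Rle_trans; [apply Hs; auto|].
      assert (H1 := exp_ineq1_le (bsum b n)). assert (H2 := exp_ineq1_le (b n)).
      assert (H3 := Hb n). assert (H4 := Hc n). assert (H5 := Hbs n).
      assert (H6 : A n * exp (b n) <= exp (bsum b n) * (A N + bsum c n) * exp (b n)).
      { apply Rmult_le_compat_r; [lra|]. apply IH. }
      assert (H7 : 1 <= exp (bsum b n) * exp (b n)) by nra.
      assert (c n * 1 <= c n * (exp (bsum b n) * exp (b n))) by (apply Rmult_le_compat_l; auto). lra. }
  eapply Rle_trans; [apply H|]. apply Rmult_le_compat_r; [|apply exp_mono; auto].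
  assert (H2 := HA N). specialize (Hcs n). lra.
Qed.

Lemma extend_bound (f g : nat -> R) N C : (forall n, 0 < g n) ->
  (forall n, (N <= n)%nat -> f n <= C * g n) -> exists C', 0 <= C' /\ forall n, f n <= C' * g n.
Proof.
  intros Hg. revert C. induction N as [|N IH]; intros C H.
  - exists (Rmax C 0). split; [apply Rmax_r|]. intros n. eapply Rle_trans; [apply H; lia|].
    apply Rmult_le_compat_r; [left; auto|apply Rmax_l].
  - apply (IH (Rmax C (f N / g N))). intros n Hn. assert (Hgn := Hg n).
    destruct (Nat.eq_dec n N) as [->|Hne].
    + apply Rle_trans with (f N / g N * g N); [right; field; lra|].
      apply Rmult_le_compat_r; [lra|apply Rmax_r].
    + eapply Rle_trans; [apply H; lia|]. apply Rmult_le_compat_r; [lra|apply Rmax_l].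
Qed.

Lemma Rpower_inv_small a eps : 0 < a -> 0 < eps -> exists A, forall z, A <= z -> Rpower z (- a) < eps.
Proof.
  intros Ha He. exists (Rpower (2 / eps) (/ a)). intros z Hz.
  assert (Hp := Rpower_pos (2 / eps) (/ a)).
  apply Rle_lt_trans with (Rpower (Rpower (2 / eps) (/ a)) (- a)); [apply Rpower_anti; lra|].
  rewrite Rpower_mult. replace (/ a * - a) with (- (1)) by (field; lra).
  assert (0 < 2 / eps) by (apply Rdiv_lt_0_compat; lra).
  rewrite Rpower_Ropp, Rpower_1 by auto. replace (/ (2 / eps)) with (eps / 2) by (field; lra). lra.
Qed.

(** [M - N/b] has increments [N (k+1)] times [1/b k - 1/b (k+1)], which telescope to at most
    [B (1/b m - 1/b n)]; the boundary terms add [B/b n + B/b m]. *)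
Lemma abel_tail (N M b : nat -> R) B : (forall n, 0 < b n) -> (forall n, b n <= b (S n)) ->
  (forall n, N (S n) - N n = b n * (M (S n) - M n)) -> (forall n, Rabs (N n) <= B) ->
  forall m n, (m <= n)%nat -> Rabs (M n - M m) <= 2 * B * / b m.
Proof.
  intros Hb Hbm HNM HB m n Hmn.
  assert (Hc : forall k, / b (S k) <= / b k) by (intros k; apply Rinv_le_contravar; auto).
  assert (Hcp : forall k, 0 < / b k) by (intros k; apply Rinv_0_lt_compat; auto).
  assert (H : Rabs ((M n - N n * / b n) - (M m - N m * / b m)) <= B * (/ b m - / b n)).
  { induction Hmn as [|n Hmn IH]; [rewrite !Rminus_diag, Rabs_R0; lra|].
    replace (M (S n) - N (S n) * / b (S n) - (M m - N m * / b m)) with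
      ((M n - N n * / b n - (M m - N m * / b m)) + N (S n) * (/ b n - / b (S n))).
    - eapply Rle_trans; [apply Rabs_triang|]. rewrite Rabs_mult, (Rabs_right (/ b n - / b (S n))) by (specialize (Hc n); lra).
      assert (Rabs (N (S n)) * (/ b n - / b (S n)) <= B * (/ b n - / b (S n))).
      { apply Rmult_le_compat_r; auto. specialize (Hc n); lra. } lra.
    - assert (H1 := HNM n). assert (H2 := Hb n).
      assert (E : M (S n) = M n + (N (S n) - N n) * / b n) by (rewrite H1; field; lra). rewrite E. ring. }
  assert (HBn := HB n). assert (HBm := HB m). apply Rabs_le_inv in H, HBn, HBm.
  assert (Hn := Hcp n). assert (Hm := Hcp m).
  assert (H1 : - (B * / b n) <= N n * / b n <= B * / b n) by (split; nra).
  assert (H2 : - (B * / b m) <= N m * / b m <= B * / b m) by (split; nra).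
  apply Rabs_le. lra.
Qed.

(** * Deterministic analysis of one trajectory *)

Definition interior (d i : nat) : Prop := (1 <= i <= d)%nat.

Lemma in_seq_interior d i : In i (seq 1 d) <-> interior d i.
Proof. unfold interior. rewrite in_seq. lia. Qed.

Section Path.
Variables (d : nat) (r : nat -> nat) (x : nat -> vertex) (cnt : nat -> vertex -> R).
Hypothesis d3 : (3 <= d)%nat.
Hypothesis x_adj : forall n, adjb d r (x n) (x (S n)) = true.
Hypothesis cnt_0 : forall v, validb d r v = true -> 1 <= cnt 0%nat v.
Hypothesis cnt_S : forall n v,
  cnt (S n) v = cnt n v + (if vertex_eq_dec (x (S n)) v then 1 else 0).

Definition sI (f : nat -> R) : R := sumR f (seq 1 d).
Definition Zi (i n : nat) : R := cnt n (Int i).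
Definition Li (i n : nat) : R := sumR (fun k => cnt n (Leaf i k)) (seq 1 (r i)).
Definition zeta (n : nat) : R := sI (fun i => Zi i n).
Definition Bi (i n : nat) : R := zeta n - Zi i n.
(** The normalisation of the transition probabilities out of [x n], in terms of the counts of its
    neighbours. *)
Definition Wt (n : nat) : R :=
  match x n with Int i => Bi i n + Li i n | Leaf i _ => Zi i n end.
Definition eI (i n : nat) : R :=
  match x n with Int j => if Nat.eqb j i then 1 else 0 | Leaf _ _ => 0 end.
Definition eT (n : nat) : R := match x n with Int _ => 1 | Leaf _ _ => 0 end.
Definition eL (i n : nat) : R :=
  match x n with Int _ => 0 | Leaf j _ => if Nat.eqb j i then 1 else 0 end.
(* [Yv - yv i + uv i] and [yv i] are the compensators of the logarithms of [Zi i] and of the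
   count of any leaf of [i]. *)
Definition yv (i n : nat) : R := bsum (fun k => eI i k / Wt k) n.
Definition uv (i n : nat) : R := bsum (fun k => eL i k / Wt k) n.
Definition Yv (n : nat) : R := bsum (fun k => eT k / Wt k) n.
Definition tot (n : nat) : R := zeta n + sI (fun i => Li i n).

(** * Indicators and counts along the trajectory *)

Lemma x_valid n : validb d r (x n) = true.
Proof.
  assert (H := x_adj n). unfold adjb in H. rewrite !andb_true_iff in H.
  destruct H as [[H _] _]. exact H.
Qed.

Lemma valid_Int i : validb d r (Int i) = true <-> interior d i.
Proof. unfold validb. rewrite andb_true_iff, !Nat.leb_le. unfold interior. tauto. Qed.

Lemma valid_Leaf i k : validb d r (Leaf i k) = true <-> interior d i /\ (1 <= k <= r i)%nat.
Proof. unfold validb. rewrite !andb_true_iff, !Nat.leb_le. unfold interior. tauto. Qed.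

Lemma x_cases n :
  (exists i, interior d i /\ x n = Int i /\ eT n = 1 /\ eI i n = 1 /\
     (forall j, j <> i -> eI j n = 0) /\ (forall j, eL j n = 0)) \/
  (exists i k, interior d i /\ (1 <= k <= r i)%nat /\ x n = Leaf i k /\ eT n = 0 /\ (forall j, eI j n = 0) /\
     eL i n = 1 /\ (forall j, j <> i -> eL j n = 0)).
Proof.
  assert (H := x_valid n). unfold eT, eI, eL. destruct (x n) as [i|i k].
  - left. exists i. rewrite valid_Int in H. rewrite Nat.eqb_refl.
    repeat split; auto; try apply H. intros j Hj. destruct (Nat.eqb_spec i j); congruence.
  - right. exists i, k. rewrite valid_Leaf in H. rewrite Nat.eqb_refl.
    destruct H as [H1 H2]. repeat split; auto; try apply H1; try apply H2. intros j Hj. destruct (Nat.eqb_spec i j); congruence.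
Qed.

Lemma adj_leaf n i k : x (S n) = Leaf i k -> x n = Int i.
Proof.
  intros E. assert (H := x_adj n). rewrite E in H. unfold adjb in H.
  apply andb_prop in H. destruct H as [_ H]. destruct (x n); [|discriminate].
  apply Nat.eqb_eq in H. congruence.
Qed.

Lemma leaf_adj n i k : x n = Leaf i k -> x (S n) = Int i.
Proof.
  intros E. assert (H := x_adj n). rewrite E in H. unfold adjb in H.
  apply andb_prop in H. destruct H as [_ H]. destruct (x (S n)); [|discriminate].
  apply Nat.eqb_eq in H. congruence.
Qed.

Lemma int_adj n i j : x n = Int i -> x (S n) = Int j -> i <> j.
Proof.
  intros E E'. assert (H := x_adj n). rewrite E, E' in H. unfold adjb in H.
  apply andb_prop in H. destruct H as [_ H]. destruct (Nat.eqb_spec i j); [discriminate|auto].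
Qed.

Lemma eI_01 i n : eI i n = 0 \/ eI i n = 1.
Proof. unfold eI. destruct (x n); auto. destruct (Nat.eqb _ _); auto. Qed.
Lemma eT_01 n : eT n = 0 \/ eT n = 1.
Proof. unfold eT. destruct (x n); auto. Qed.
Lemma eL_01 i n : eL i n = 0 \/ eL i n = 1.
Proof. unfold eL. destruct (x n); auto. destruct (Nat.eqb _ _); auto. Qed.

Lemma Zi_S i n : Zi i (S n) = Zi i n + eI i (S n).
Proof.
  unfold Zi. rewrite cnt_S. f_equal. unfold eI.
  destruct (vertex_eq_dec (x (S n)) (Int i)) as [E|E].
  - rewrite E, Nat.eqb_refl; auto.
  - destruct (x (S n)) as [j|]; auto. destruct (Nat.eqb_spec j i); congruence.
Qed.

Lemma sI_eI n : sI (fun i => eI i n) = eT n.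
Proof.
  unfold sI. destruct (x_cases n) as [(i & Hi & E & ET & E1 & E0 & _)|(i & k & Hi & Hk & E & ET & E0 & _)].
  - rewrite ET. rewrite (sumR_single _ _ i); auto using seq_NoDup. apply in_seq_interior; auto.
  - rewrite ET. apply sumR_zero; auto.
Qed.

Lemma zeta_S n : zeta (S n) = zeta n + eT (S n).
Proof.
  unfold zeta. rewrite <- sI_eI. unfold sI. rewrite <- sumR_plus.
  apply sumR_ext. intros i _. apply Zi_S.
Qed.

Lemma Bi_S i n : Bi i (S n) = Bi i n + (eT (S n) - eI i (S n)).
Proof. unfold Bi. rewrite zeta_S, Zi_S. ring. Qed.

Lemma Li_S i n : Li i (S n) = Li i n + eL i (S n).
Proof.
  unfold Li. transitivity (sumR (fun k => cnt n (Leaf i k) + (if vertex_eq_dec (x (S n)) (Leaf i k) then 1 else 0)) (seq 1 (r i))).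
  { apply sumR_ext. intros; apply cnt_S. }
  rewrite sumR_plus. f_equal. unfold eL.
  assert (Hv := x_valid (S n)). destruct (x (S n)) as [j|j k] eqn:E.
  - apply sumR_zero. intros k _. destruct (vertex_eq_dec _ _); congruence.
  - rewrite valid_Leaf in Hv. destruct (Nat.eqb_spec j i) as [->|Hne].
    + rewrite (sumR_single _ _ k); auto using seq_NoDup.
      * destruct (vertex_eq_dec _ _); congruence.
      * rewrite in_seq; lia.
      * intros k' _ Hk'. destruct (vertex_eq_dec _ _); congruence.
    + apply sumR_zero. intros k' _. destruct (vertex_eq_dec _ _); congruence.
Qed.

Lemma cnt_ge1 v n : validb d r v = true -> 1 <= cnt n v.
Proof.
  intros Hv. induction n as [|n IH]; auto. rewrite cnt_S.
  destruct (vertex_eq_dec _ _); lra.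
Qed.

Lemma Zi_ge1 i n : interior d i -> 1 <= Zi i n.
Proof. intros H. apply cnt_ge1. apply valid_Int; auto. Qed.

Lemma Leaf_ge1 i k n : interior d i -> (1 <= k <= r i)%nat -> 1 <= cnt n (Leaf i k).
Proof. intros. apply cnt_ge1. apply valid_Leaf; auto. Qed.

Lemma Li_nonneg i n : interior d i -> 0 <= Li i n.
Proof.
  intros. apply sumR_nonneg. intros k Hk. apply in_seq in Hk.
  assert (1 <= cnt n (Leaf i k)) by (apply Leaf_ge1; auto; lia). lra.
Qed.

Lemma Leaf_le_Li i k n : interior d i -> (1 <= k <= r i)%nat -> cnt n (Leaf i k) <= Li i n.
Proof.
  intros. apply (sumR_ge_term (fun k => cnt n (Leaf i k))).
  - intros b Hb. apply in_seq in Hb. assert (1 <= cnt n (Leaf i b)) by (apply Leaf_ge1; auto; lia). lra.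
  - apply in_seq; lia.
Qed.

Lemma sI_le f g : (forall i, interior d i -> f i <= g i) -> sI f <= sI g.
Proof. intros H. apply sumR_le. intros i Hi. apply H, in_seq_interior; auto. Qed.

Lemma sI_const c : sI (fun _ => c) = INR d * c.
Proof. unfold sI. rewrite sumR_const, length_seq. auto. Qed.

Lemma sI_ext f g : (forall i, interior d i -> f i = g i) -> sI f = sI g.
Proof. intros H. apply sumR_ext. intros i Hi. apply H, in_seq_interior; auto. Qed.

Lemma sI_term f i : (forall j, interior d j -> 0 <= f j) -> interior d i -> f i <= sI f.
Proof. intros H Hi. apply sumR_ge_term; [|apply in_seq_interior; auto]. intros; apply H, in_seq_interior; auto. Qed.

Lemma sI_split f i : interior d i -> sI f = f i + sI (fun j => if Nat.eqb j i then 0 else f j).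
Proof.
  intros Hi. transitivity (sI (fun j => (if Nat.eqb j i then f j else 0) + (if Nat.eqb j i then 0 else f j))).
  - apply sI_ext. intros j _. destruct (Nat.eqb j i); ring.
  - unfold sI. rewrite sumR_plus. f_equal.
    rewrite (sumR_single _ _ i); auto using seq_NoDup; [rewrite Nat.eqb_refl; auto|apply in_seq_interior; auto|].
    intros b _ Hb. destruct (Nat.eqb_spec b i); congruence.
Qed.

Lemma INR_d_ge3 : 3 <= INR d.
Proof. replace 3 with (INR 3) by (simpl; ring). apply le_INR; auto. Qed.

Lemma Bi_sum i n : interior d i -> Bi i n = sI (fun j => if Nat.eqb j i then 0 else Zi j n).
Proof. intros Hi. unfold Bi, zeta. rewrite (sI_split _ i Hi). ring. Qed.

Lemma Bi_ge_Z i j n : interior d i -> interior d j -> j <> i -> Zi j n <= Bi i n.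
Proof.
  intros Hi Hj Hne. rewrite Bi_sum; auto.
  eapply Rle_trans; [|apply (sI_term (fun j => if Nat.eqb j i then 0 else Zi j n) j); auto].
  - destruct (Nat.eqb_spec j i); [congruence|lra].
  - intros k Hk. destruct (Nat.eqb k i); [lra|]. assert (1 <= Zi k n) by (apply Zi_ge1; auto). lra.
Qed.

Lemma other i : exists j, interior d j /\ j <> i.
Proof.
  destruct (Nat.eq_dec i 1); [exists 2%nat|exists 1%nat]; split; unfold interior; lia.
Qed.

Lemma third i j : exists m, interior d m /\ m <> i /\ m <> j.
Proof.
  destruct (Nat.eq_dec i 1), (Nat.eq_dec j 1), (Nat.eq_dec i 2), (Nat.eq_dec j 2);
  (exists 1%nat; unfold interior; lia) || (exists 2%nat; unfold interior; lia) || (exists 3%nat; unfold interior; lia).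
Qed.

Lemma Bi_ge1 i n : interior d i -> 1 <= Bi i n.
Proof.
  intros Hi. destruct (other i) as (j & Hj & Hne).
  eapply Rle_trans; [apply (Zi_ge1 j n); auto|apply Bi_ge_Z; auto].
Qed.

Lemma Zi_le_zeta i n : interior d i -> Zi i n <= zeta n.
Proof. intros Hi. assert (1 <= Bi i n) by (apply Bi_ge1; auto). unfold Bi in H. lra. Qed.

Lemma Bi_le_zeta i n : interior d i -> Bi i n <= zeta n.
Proof. intros Hi. assert (1 <= Zi i n) by (apply Zi_ge1; auto). unfold Bi. lra. Qed.

Lemma zeta_ge1 n : 1 <= zeta n.
Proof.
  assert (H1 : interior d 1) by (unfold interior; lia).
  eapply Rle_trans; [apply (Zi_ge1 1 n); auto|apply Zi_le_zeta; auto].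
Qed.

Lemma zeta_mono m n : (m <= n)%nat -> zeta m <= zeta n.
Proof. intros H. apply incr_le; auto. intros k _. rewrite zeta_S. destruct (eT_01 (S k)); lra. Qed.

Lemma Wt_ge1 n : 1 <= Wt n.
Proof.
  unfold Wt. destruct (x_cases n) as [(i & Hi & E & _)|(i & k & Hi & Hk & E & _)]; rewrite E.
  - assert (1 <= Bi i n) by (apply Bi_ge1; auto). assert (0 <= Li i n) by (apply Li_nonneg; auto). lra.
  - apply Zi_ge1; auto.
Qed.

Lemma Rdiv_nonneg a b : 0 <= a -> 1 <= b -> 0 <= a / b.
Proof. intros. apply Rmult_le_pos; [auto|]. left; apply Rinv_0_lt_compat; lra. Qed.

Lemma yv_term_nonneg i k : 0 <= eI i k / Wt k.
Proof. apply Rdiv_nonneg; [destruct (eI_01 i k); lra|apply Wt_ge1]. Qed.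
Lemma uv_term_nonneg i k : 0 <= eL i k / Wt k.
Proof. apply Rdiv_nonneg; [destruct (eL_01 i k); lra|apply Wt_ge1]. Qed.
Lemma Yv_term_nonneg k : 0 <= eT k / Wt k.
Proof. apply Rdiv_nonneg; [destruct (eT_01 k); lra|apply Wt_ge1]. Qed.

Lemma uv_nonneg i n : 0 <= uv i n.
Proof. change 0 with (uv i 0). apply bsum_incr; [lia|]. intros; apply uv_term_nonneg. Qed.

Lemma yv_nonneg i n : 0 <= yv i n.
Proof. change 0 with (yv i 0). apply bsum_incr; [lia|]. intros; apply yv_term_nonneg. Qed.

Lemma yv_mono i m n : (m <= n)%nat -> yv i m <= yv i n.
Proof. intros. apply bsum_incr; auto. intros; apply yv_term_nonneg. Qed.

Lemma term_le1 e k : e = 0 \/ e = 1 -> e / Wt k <= 1.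
Proof.
  intros He. assert (1 <= Wt k) by apply Wt_ge1.
  assert (/ Wt k <= 1) by (rewrite <- Rinv_1; apply Rinv_le_contravar; lra).
  assert (0 < / Wt k) by (apply Rinv_0_lt_compat; lra).
  unfold Rdiv. destruct He as [-> | ->]; lra.
Qed.

Lemma Yv_sum n : Yv n = sI (fun i => yv i n).
Proof.
  unfold Yv, yv, sI. rewrite sumR_bsum. 
  assert (H : forall k, eT k / Wt k = sumR (fun i => eI i k / Wt k) (seq 1 d)).
  { intros k. rewrite <- sI_eI. unfold sI, Rdiv. rewrite Rmult_comm, <- sumR_scal.
    apply sumR_ext. intros; ring. }
  clear -H. induction n; simpl; auto. rewrite IHn, H. auto.
Qed.

Lemma Yv_ge3 i j k n : interior d i -> interior d j -> interior d k -> i <> j -> i <> k -> j <> k ->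
  yv i n + yv j n + yv k n <= Yv n.
Proof.
  intros Hi Hj Hk Hij Hik Hjk. rewrite Yv_sum, (sI_split _ i Hi).
  rewrite (sI_split (fun j => if Nat.eqb j i then 0 else yv j n) j Hj).
  destruct (Nat.eqb_spec j i) as [->|_]; [tauto|].
  rewrite Rplus_assoc. apply Rplus_le_compat_l, Rplus_le_compat_l.
  eapply Rle_trans; [|apply (sI_term (fun m => if Nat.eqb m j then 0 else if Nat.eqb m i then 0 else yv m n) k); auto].
  - destruct (Nat.eqb_spec k j), (Nat.eqb_spec k i); try congruence; lra.
  - intros m Hm. destruct (Nat.eqb m j), (Nat.eqb m i); try lra; apply yv_nonneg.
Qed.

(** * Bounds from the alternation of visits *)

(** A visit to a leaf of [i] follows one to [i], and between two visits to [i] a neighbour is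
    visited. The indicator [eI i n] accounts for a walk standing at [i] and makes both inequalities
    hereditary; [c] covers the initial counts. *)
Lemma visit_balance : exists c, 0 <= c /\ forall i, interior d i -> forall n,
  Li i n + eI i n <= Zi i n + c /\ Zi i n <= Bi i n + Li i n + eI i n + c.
Proof.
  destruct (uniform_bound (seq 1 d) (fun i c => Li i 0%nat + 1 <= c /\ Zi i 0%nat <= c)) as (c & Hc & H).
  { intros; lra. }
  { intros i _. exists (Rmax (Li i 0%nat + 1) (Zi i 0%nat)). split; [apply Rmax_l|apply Rmax_r]. }
  exists c. split; auto. intros i Hi n. apply in_seq_interior in Hi. specialize (H i Hi). apply in_seq_interior in Hi.
  induction n as [|n IH].
  - assert (H1 := Zi_ge1 i 0 Hi). assert (H2 := Bi_ge1 i 0 Hi). assert (H3 := Li_nonneg i 0 Hi).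
    destruct (eI_01 i 0); lra.
  - rewrite Zi_S, Li_S, Bi_S.
    destruct (x_cases (S n)) as [(j & Hj & E & ET & E1 & E0 & EL)|(j & k & Hj & Hk & E & ET & E0 & EL & EL0)].
    + rewrite EL, ET. destruct (Nat.eq_dec i j) as [<-|Hne].
      * rewrite E1. 
        assert (HI : eI i n = 0).
        { unfold eI. destruct (x n) eqn:Ex; auto. destruct (Nat.eqb_spec n0 i); auto.
          exfalso. eapply int_adj; eauto. }
        lra.
      * rewrite (E0 i) by auto. destruct (eI_01 i n); lra.
    + rewrite ET, E0. apply adj_leaf in E. destruct (Nat.eq_dec i j) as [<-|Hne].
      * rewrite EL. assert (HI : eI i n = 1) by (unfold eI; rewrite E, Nat.eqb_refl; auto). lra.
      * rewrite EL0 by auto. assert (HI : eI i n = 0).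
        { unfold eI. rewrite E. destruct (Nat.eqb_spec j i); congruence. } lra.
Qed.

(** At [i] the normalisation is [zeta - Zi + Li], and [Li] exceeds [Zi] by at most a constant. *)
Lemma Wt_upper : exists c, 1 <= c /\ forall n, eT n = 1 -> Wt n <= zeta n + c.
Proof.
  destruct visit_balance as (c & Hc & H). exists (c + 1). split; [lra|]. intros n Hn.
  unfold Wt, eT in *. assert (Hv := x_valid n). destruct (x n) as [i|] eqn:E; [|lra].
  rewrite valid_Int in Hv. destruct (H i Hv n) as [H1 _]. unfold Bi.
  destruct (eI_01 i n); lra.
Qed.

(** A leaf is left for its interior vertex, so any two steps contain an interior visit; hence the
    induction on two consecutive indices. *)
Lemma zeta_half n : INR n / 2 <= zeta n.
Proof.
  assert (H : INR n / 2 <= zeta n /\ INR (S n) / 2 <= zeta (S n)).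
  { induction n as [|n [IH1 IH2]].
    - simpl. assert (H1 := zeta_ge1 0). assert (H2 := zeta_ge1 1). lra.
    - split; auto. assert (zeta n + 1 <= zeta (S (S n))).
      { rewrite (zeta_S (S n)), (zeta_S n).
        destruct (x_cases (S n)) as [(j & Hj & E & ET & _)|(j & k & Hj & Hk & E & ET & _)].
        - rewrite ET. destruct (eT_01 (S (S n))); lra.
        - apply leaf_adj in E. unfold eT at 2. rewrite E. lra. }
      rewrite !S_INR. lra. }
  tauto.
Qed.

Lemma zeta_large A : exists n0, forall n, (n0 <= n)%nat -> A <= zeta n.
Proof.
  destruct (INR_unbounded (2 * A)) as [n0 Hn0].
  exists n0. intros n Hn. assert (H := zeta_half n). apply le_INR in Hn. lra.
Qed.

Lemma tot_S n : tot (S n) = tot n + 1.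
Proof.
  unfold tot. rewrite zeta_S.
  assert (sI (fun i => Li i (S n)) = sI (fun i => Li i n) + sI (fun i => eL i (S n))).
  { unfold sI. rewrite <- sumR_plus. apply sumR_ext. intros; apply Li_S. }
  rewrite H.
  assert (eT (S n) + sI (fun i => eL i (S n)) = 1).
  { destruct (x_cases (S n)) as [(j & Hj & E & ET & E1 & E0 & EL)|(j & k & Hj & Hk & E & ET & E0 & EL & EL0)].
    - rewrite ET. unfold sI. rewrite sumR_zero by auto. ring.
    - rewrite ET. unfold sI. rewrite (sumR_single _ _ j); auto using seq_NoDup; [lra|].
      apply in_seq_interior; auto. }
  lra.
Qed.

(** A harmonic sum in the counter [zeta]. The shift [c + 1] inside the logarithms is due to
    [Wt (S k)] being bounded through the value of [zeta] after the visit. *)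
Lemma Y_lower : exists C, forall n, ln (zeta n) - C <= Yv n.
Proof.
  destruct Wt_upper as (c & Hc & HW).
  set (C := ln (zeta 0 + c + 1)). exists (C + 1). intros n.
  assert (H : ln (zeta n + c + 1) - ln (zeta 0 + c + 1) <= bsum (fun k => eT (S k) / Wt (S k)) n - 0).
  { change 0 with (bsum (fun k => eT (S k) / Wt (S k)) 0).
    apply (bsum_telescope_ge _ (fun n => ln (zeta n + c + 1))); [lia|].
    intros k _. rewrite zeta_S. assert (Hz := zeta_ge1 k).
    destruct (eT_01 (S k)) as [E|E]; rewrite E.
    - rewrite Rplus_0_r. unfold Rdiv. lra.
    - assert (HWk := HW (S k) E). rewrite zeta_S, E in HWk. assert (Hw1 := Wt_ge1 (S k)).
      assert (Hl := ln_step_le (zeta k + c + 1) ltac:(lra)).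
      replace (zeta k + 1 + c + 1) with (zeta k + c + 1 + 1) by ring.
      assert (/ (zeta k + c + 1) <= / Wt (S k)) by (apply Rinv_le_contravar; lra).
      unfold Rdiv. lra. }
  assert (HS : Yv (S n) = eT 0%nat / Wt 0 + bsum (fun k => eT (S k) / Wt (S k)) n) by (unfold Yv; apply bsum_shift).
  assert (HS' : Yv (S n) = Yv n + eT n / Wt n) by reflexivity.
  assert (H1 := term_le1 (eT n) n (eT_01 n)). assert (H2 := Yv_term_nonneg 0).
  assert (Hz := zeta_ge1 n).
  assert (ln (zeta n) <= ln (zeta n + c + 1)) by (apply ln_mono; lra).
  unfold C. lra.
Qed.

(** * Growth of the logarithms of the counts *)

(** From a neighbour of [v] the step to [v] has probability [cnt k v / Wt k], so [/ Wt k] is the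
    conditional mean of the visit term [/ cnt k v]. The bound is established outside a null event in
    [good_martingale]. *)
Hypothesis weighted_martingale_bounded : forall v, validb d r v = true -> exists B, forall n,
  Rabs (bsum (fun k => Rpower (cnt k v) (1 / 3) *
     ((if vertex_eq_dec (x (S k)) v then / cnt k v else 0) -
      (if adjb d r (x k) v then / Wt k else 0))) n) <= B.

(** [abel_tail] strips the weight and leaves a tail [2 B cnt^(-1/3)]. Replacing [1/cnt] by the
    increment of [ln cnt] costs at most [cnt^(-2) <= cnt^(-4/3)] per visit, hence [7 cnt^(-1/3)] in
    total. *)
Lemma log_growth v : validb d r v = true -> exists K, 0 <= K /\ forall m n, (m <= n)%nat ->
  Rabs (ln (cnt n v) - ln (cnt m v) -
    (bsum (fun k => if adjb d r (x k) v then / Wt k else 0) n -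
     bsum (fun k => if adjb d r (x k) v then / Wt k else 0) m)) <= K * Rpower (cnt m v) (- (1 / 3)).
Proof.
  intros Hv. destruct (weighted_martingale_bounded v Hv) as (B & HB).
  set (e := fun k => if vertex_eq_dec (x (S k)) v then 1 else 0).
  assert (He : forall k, e k = 0 \/ e k = 1) by (intros k; unfold e; destruct (vertex_eq_dec _ _); auto).
  assert (HS : forall k, cnt (S k) v = cnt k v + e k) by (intros k; apply cnt_S).
  set (A := bsum (fun k => if adjb d r (x k) v then / Wt k else 0)).
  set (H := bsum (fun k => if vertex_eq_dec (x (S k)) v then / cnt k v else 0)).
  assert (Hq : forall k, 1 <= cnt k v) by (intros k; apply cnt_ge1; auto).
  assert (HM : forall m n, (m <= n)%nat -> Rabs ((H n - A n) - (H m - A m)) <= 2 * B * Rpower (cnt m v) (- (1 / 3))).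
  { intros m n Hmn. rewrite Rpower_Ropp.
    apply (abel_tail (bsum (fun k => Rpower (cnt k v) (1 / 3) *
     ((if vertex_eq_dec (x (S k)) v then / cnt k v else 0) -
      (if adjb d r (x k) v then / Wt k else 0)))) (fun n => H n - A n) (fun k => Rpower (cnt k v) (1 / 3))); auto.
    - intros k; apply Rpower_pos.
    - intros k. apply Rpower_mono_l; try lra; [specialize (Hq k); lra|]. rewrite HS. destruct (He k); lra.
    - intros k. unfold H, A. simpl bsum. ring. }
  assert (HL1 : forall m n, (m <= n)%nat -> Rabs (ln (cnt n v) - ln (cnt m v) - (H n - H m)) <= 7 * Rpower (cnt m v) (- (1 / 3))).
  { intros m n Hmn.
    set (f := fun k => e k * Rpower (cnt k v) (- 1 - 1 / 3)).
    assert (Hstep : forall k, 0 <= (H (S k) - ln (cnt (S k) v)) - (H k - ln (cnt k v)) <= f k).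
    { intros k. unfold f, H. simpl bsum. rewrite HS. unfold e. assert (Hk := Hq k).
      destruct (vertex_eq_dec (x (S k)) v).
      - assert (H1 := ln_step_le (cnt k v) ltac:(lra)). assert (H2 := ln_step_ge2 (cnt k v) ltac:(lra)).
        assert (H3 : / (cnt k v * cnt k v) <= Rpower (cnt k v) (- 1 - 1 / 3)).
        { replace (/ (cnt k v * cnt k v)) with (Rpower (cnt k v) (- (1) + - (1))).
          - apply Rpower_exp_mono; lra.
          - rewrite Rpower_plus, !Rpower_Ropp, Rpower_1 by lra. rewrite Rinv_mult. auto. }
        lra.
      - rewrite !Rplus_0_r, Rmult_0_l. lra. }
    assert (H0 : 0 <= (H n - ln (cnt n v)) - (H m - ln (cnt m v)) <= bsum f n - bsum f m).
    { clear -Hstep Hmn. induction Hmn as [|n Hmn IH]; [lra|]. simpl bsum. specialize (Hstep n). lra. }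
    assert (Hc := bsum_counter (fun k => cnt k v) e (1/3) m n ltac:(lra) Hmn (fun k _ => Hq k) (fun k _ => conj (He k) (HS k))).
    change (bsum f n - bsum f m <= (2 + 1 / 3) / (1 / 3) * Rpower (cnt m v) (- (1 / 3))) in Hc.
    replace ((2 + 1 / 3) / (1 / 3)) with 7 in Hc by field. apply Rabs_le. lra. }
  assert (HB0 : 0 <= B) by (eapply Rle_trans; [apply Rabs_pos|apply (HB 0%nat)]).
  exists (2 * B + 7). split; [lra|].
  intros m n Hmn. specialize (HM m n Hmn). specialize (HL1 m n Hmn). apply Rabs_le_inv in HM, HL1.
  fold (A n) (A m). apply Rabs_le. lra.
Qed.

Lemma adj_sum_Int i n : interior d i ->
  bsum (fun k => if adjb d r (x k) (Int i) then / Wt k else 0) n = Yv n - yv i n + uv i n.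
Proof.
  intros Hi. rewrite (bsum_ext _ (fun k => (eT k / Wt k + (-1) * (eI i k / Wt k)) + eL i k / Wt k)).
  - rewrite !bsum_plus, bsum_scal. unfold Yv, yv, uv. ring.
  - intros k _. unfold adjb. rewrite x_valid, (proj2 (valid_Int i) Hi). simpl andb.
    unfold eT, eI, eL. destruct (x k) as [j|j l]; simpl.
    + destruct (Nat.eqb j i); simpl; unfold Rdiv; ring.
    + rewrite Nat.eqb_sym. destruct (Nat.eqb j i); unfold Rdiv; ring.
Qed.

Lemma adj_sum_Leaf i k n : interior d i -> (1 <= k <= r i)%nat ->
  bsum (fun s => if adjb d r (x s) (Leaf i k) then / Wt s else 0) n = yv i n.
Proof.
  intros Hi Hk. apply bsum_ext. intros s _. unfold adjb.
  rewrite x_valid, (proj2 (valid_Leaf i k) (conj Hi Hk)). simpl andb.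
  unfold eI. destruct (x s) as [j|j l]; [|unfold Rdiv; ring].
  destruct (Nat.eqb j i); unfold Rdiv; ring.
Qed.

Lemma ln_Zi_growth : forall i, interior d i -> exists K, forall m n, (m <= n)%nat ->
  Rabs (ln (Zi i n) - ln (Zi i m) - ((Yv n - yv i n + uv i n) - (Yv m - yv i m + uv i m)))
    <= K * Rpower (Zi i m) (- (1 / 3)).
Proof.
  intros i Hi. destruct (log_growth (Int i) (proj2 (valid_Int i) Hi)) as (K & _ & H).
  exists K. intros m n Hmn. specialize (H m n Hmn). rewrite !adj_sum_Int in H by auto. exact H.
Qed.

Lemma ln_leaf_growth : forall i k, interior d i -> (1 <= k <= r i)%nat -> exists K, forall n,
  Rabs (ln (cnt n (Leaf i k)) - yv i n) <= K.
Proof.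
  intros i k Hi Hk. destruct (log_growth (Leaf i k) (proj2 (valid_Leaf i k) (conj Hi Hk))) as (K & HK & H).
  exists (Rabs (ln (cnt 0%nat (Leaf i k))) + K). intros n. specialize (H 0%nat n ltac:(lia)).
  rewrite !adj_sum_Leaf in H by auto. change (yv i 0) with 0 in H.
  assert (H1 := Rpower_le_1 (cnt 0%nat (Leaf i k)) (1/3) (Leaf_ge1 i k 0 Hi Hk) ltac:(lra)).
  assert (H2 : K * Rpower (cnt 0%nat (Leaf i k)) (- (1 / 3)) <= K * 1) by (apply Rmult_le_compat_l; auto).
  replace (ln (cnt n (Leaf i k)) - yv i n) with (ln (cnt 0%nat (Leaf i k)) + (ln (cnt n (Leaf i k)) - ln (cnt 0%nat (Leaf i k)) - (yv i n - 0))) by ring.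
  eapply Rle_trans; [apply Rabs_triang|]. lra.
Qed.

Lemma ln_Zi_bound : exists C, 0 <= C /\ forall i, interior d i -> forall n,
  Rabs (ln (Zi i n) - (Yv n - yv i n + uv i n)) <= C.
Proof.
  destruct (uniform_bound (seq 1 d) (fun i C => forall n, Rabs (ln (Zi i n) - (Yv n - yv i n + uv i n)) <= C))
    as (C & HC & H).
  - intros i K K' HK H n. specialize (H n). lra.
  - intros i Hi. apply in_seq_interior in Hi. destruct (ln_Zi_growth i Hi) as (K & HK).
    exists (Rabs (ln (Zi i 0)) + K * Rpower (Zi i 0) (- (1 / 3))). intros n.
    specialize (HK 0%nat n ltac:(lia)).
    replace (ln (Zi i n) - (Yv n - yv i n + uv i n)) with
      (ln (Zi i 0) + (ln (Zi i n) - ln (Zi i 0) - (Yv n - yv i n + uv i n - (Yv 0 - yv i 0 + uv i 0)))).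
    + eapply Rle_trans; [apply Rabs_triang|]. lra.
    + unfold Yv, yv, uv. simpl. ring.
  - exists C. split; auto. intros i Hi. apply H, in_seq_interior; auto.
Qed.

Lemma ln_leaf_bound : exists C, 0 <= C /\ forall i, interior d i -> forall k, (1 <= k <= r i)%nat -> forall n,
  Rabs (ln (cnt n (Leaf i k)) - yv i n) <= C.
Proof.
  destruct (uniform_bound (seq 1 d) (fun i C => forall k, (1 <= k <= r i)%nat -> forall n,
     Rabs (ln (cnt n (Leaf i k)) - yv i n) <= C)) as (C & HC & H).
  - intros i K K' HK H k Hk n. specialize (H k Hk n). lra.
  - intros i Hi. apply in_seq_interior in Hi.
    destruct (uniform_bound (seq 1 (r i)) (fun k C => forall n, Rabs (ln (cnt n (Leaf i k)) - yv i n) <= C))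
      as (C & HC & H).
    + intros k K K' HK H n. specialize (H n). lra.
    + intros k Hk. apply in_seq in Hk. destruct (ln_leaf_growth i k Hi ltac:(lia)) as (K & HK). exists K; auto.
    + exists C. intros k Hk. apply H. apply in_seq; lia.
  - exists C. split; auto. intros i Hi. apply H, in_seq_interior; auto.
Qed.

(** * Divergence of the [yv] and smallness of the leaves *)

(** A harmonic sum over the visits counted by [q]. As [Wt (S k)] is compared with [q] after the
    visit, the lower bound needs [ln (q + 1)], whereas [visit_upper] works with [ln q]. *)
Lemma visit_lower (q e : nat -> R) al m n : (m <= n)%nat -> 0 < al ->
  (forall k, 1 <= q k) -> (forall k, e k = 0 \/ e k = 1) -> (forall k, q (S k) = q k + e (S k)) ->
  (forall k, (m <= k)%nat -> e (S k) = 1 -> Wt (S k) <= al * q (S k)) ->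
  (ln (q n + 1) - ln (q m + 1)) / al <=
    bsum (fun k => e k / Wt k) (S n) - bsum (fun k => e k / Wt k) (S m).
Proof.
  intros Hmn Hal Hq He HS HW. rewrite !bsum_shift.
  assert (H : (fun k => ln (q k + 1) / al) n - (fun k => ln (q k + 1) / al) m <=
    bsum (fun k => e (S k) / Wt (S k)) n - bsum (fun k => e (S k) / Wt (S k)) m).
  { apply (bsum_telescope_ge _ (fun k => ln (q k + 1) / al)); auto. intros k Hk. rewrite HS.
    destruct (He (S k)) as [E|E]; rewrite E.
    - rewrite Rplus_0_r. unfold Rdiv. lra.
    - specialize (HW k ltac:(lia) E). rewrite HS, E in HW. assert (H1 := Hq k).
      assert (Hl := ln_step_le (q k + 1) ltac:(lra)). assert (Hw := Wt_ge1 (S k)).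
      apply Rle_trans with (/ (q k + 1) / al).
      + unfold Rdiv. rewrite <- Rmult_minus_distr_r. apply Rmult_le_compat_r; auto.
        left; apply Rinv_0_lt_compat; auto.
      + unfold Rdiv. rewrite <- Rinv_mult, Rmult_1_l. apply Rinv_le_contravar; lra. }
  unfold Rdiv in *. lra.
Qed.

Lemma visit_upper (q e : nat -> R) be m n : (m <= n)%nat -> 0 < be ->
  (forall k, 1 <= q k) -> (forall k, e k = 0 \/ e k = 1) -> (forall k, q (S k) = q k + e (S k)) ->
  (forall k, (m <= k)%nat -> e (S k) = 1 -> be * q (S k) <= Wt (S k)) ->
  bsum (fun k => e k / Wt k) (S n) - bsum (fun k => e k / Wt k) (S m) <=
  (ln (q n) - ln (q m)) / be.
Proof.
  intros Hmn Hal Hq He HS HW. rewrite !bsum_shift.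
  assert (H : bsum (fun k => e (S k) / Wt (S k)) n - bsum (fun k => e (S k) / Wt (S k)) m <=
     (fun k => ln (q k) / be) n - (fun k => ln (q k) / be) m).
  { apply (bsum_telescope_le _ (fun k => ln (q k) / be)); auto. intros k Hk. rewrite HS.
    destruct (He (S k)) as [E|E]; rewrite E.
    - rewrite Rplus_0_r. unfold Rdiv. lra.
    - specialize (HW k ltac:(lia) E). rewrite HS, E in HW. assert (H1 := Hq k).
      assert (Hl := ln_step_ge (q k) ltac:(lra)). assert (Hw := Wt_ge1 (S k)).
      apply Rle_trans with (/ (q k + 1) / be).
      + unfold Rdiv. rewrite <- Rinv_mult, Rmult_1_l. apply Rinv_le_contravar; [|lra].
        apply Rmult_lt_0_compat; lra.
      + unfold Rdiv. rewrite <- Rmult_minus_distr_r. apply Rmult_le_compat_r; auto.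
        left; apply Rinv_0_lt_compat; auto. }
  unfold Rdiv in *. lra.
Qed.

(* If [yv i] were bounded, [Zi i] would keep a positive fraction of [zeta], and then [yv i] would diverge. *)
Lemma yv_unbounded i : interior d i -> forall A, exists n0, forall n, (n0 <= n)%nat -> A <= yv i n.
Proof.
  intros Hi A. apply NNPP. intros Hno.
  assert (HA : forall n, yv i n <= A).
  { intros n. apply Rnot_lt_le. intros Hlt. apply Hno. exists n. intros m Hm.
    assert (yv i n <= yv i m) by (apply yv_mono; auto). lra. }
  destruct ln_Zi_bound as (C & HC & H). destruct Y_lower as (C' & HY). destruct Wt_upper as (c & Hc & HW).
  set (D := exp (A + C + C')).
  assert (HD : 0 < D) by apply exp_pos.
  (* [ln Zi] is at least [Yv - yv i - C], where [Yv >= ln zeta - C'] and [yv i] is supposed bounded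
     by [A]. *)
  assert (HZ : forall n, zeta n <= D * Zi i n).
  { intros n. specialize (H i Hi n). apply Rabs_le_inv in H. specialize (HY n). specialize (HA n).
    assert (Hu := uv_nonneg i n). assert (Hz := zeta_ge1 n). assert (HZ1 := Zi_ge1 i n Hi).
    rewrite <- (exp_ln (zeta n)), <- (exp_ln (Zi i n)) by lra. unfold D. rewrite <- exp_plus.
    apply exp_mono. lra. }
  assert (Hv : forall n, (ln (Zi i n + 1) - ln (Zi i 0 + 1)) / (D + c) <= A).
  { intros n. eapply Rle_trans; [apply (visit_lower (Zi i) (eI i) (D + c) 0 n); try lia; try lra|].
    - intros k; apply Zi_ge1; auto.
    - intros k; apply eI_01.
    - intros k; apply Zi_S.
    - intros k _ E.
      assert (ET : eT (S k) = 1).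
      { revert E. unfold eI, eT. destruct (x (S k)); auto; intros; lra. }
      specialize (HW (S k) ET). specialize (HZ (S k)). assert (HZ1 := Zi_ge1 i (S k) Hi). nra.
    - assert (H1 := HA (S n)). unfold yv in H1. assert (0 <= bsum (fun k => eI i k / Wt k) 1) by (apply (yv_nonneg i 1)). lra. }
  destruct (zeta_large (D * exp (A * (D + c) + ln (Zi i 0 + 1)))) as (n0 & Hn0).
  specialize (Hn0 n0 (le_n _)). specialize (HZ n0). specialize (Hv n0).
  assert (HZ1 := Zi_ge1 i n0 Hi).
  assert (H1 : ln (Zi i n0 + 1) <= A * (D + c) + ln (Zi i 0 + 1)).
  { apply (Rmult_le_compat_r (D + c)) in Hv; [|lra]. unfold Rdiv in Hv.
    rewrite Rmult_assoc, Rinv_l, Rmult_1_r in Hv by lra. lra. }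
  apply exp_mono in H1. rewrite exp_ln in H1 by lra.
  assert (D * exp (A * (D + c) + ln (Zi i 0 + 1)) <= D * Zi i n0) by lra.
  apply Rmult_le_reg_l in H0; lra.
Qed.

(** Difference of the two growth formulas, with [uv j >= 0] dropped. The bracket is the sum of the
    [yv m] over the interior [m] other than [i] and [j]; for [d >= 3] it contains a diverging
    term. *)
Lemma Leaf_vs_Z : exists C, 0 <= C /\ forall i j k n, interior d i -> interior d j -> i <> j -> (1 <= k <= r i)%nat ->
  ln (cnt n (Leaf i k)) <= ln (Zi j n) - (Yv n - yv i n - yv j n) + C.
Proof.
  destruct ln_Zi_bound as (C & HC & H). destruct ln_leaf_bound as (C' & HC' & H').
  exists (C + C'). split; [lra|]. intros i j k n Hi Hj Hne Hk.
  specialize (H j Hj n). specialize (H' i Hi k Hk n). apply Rabs_le_inv in H, H'.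
  assert (Hu := uv_nonneg j n). lra.
Qed.

Lemma Li_le_scal i n b : (forall k, (1 <= k <= r i)%nat -> cnt n (Leaf i k) <= b) -> Li i n <= INR (r i) * b.
Proof.
  intros H. rewrite <- (length_seq (r i) 1), <- sumR_const. apply sumR_le.
  intros k Hk. apply H. apply in_seq in Hk. lia.
Qed.

(** The divergence of [yv m] for a third vertex [m] pushes the leaves of [i] below any fraction of
    [Zi j], and [Zi j <= Bi i]. The 1 added to [INR (r i)] keeps the divisor positive when [i] has
    no leaf. *)
Lemma Li_small eps : 0 < eps -> exists n0, forall i, interior d i -> forall n, (n0 <= n)%nat -> Li i n <= eps * Bi i n.
Proof.
  intros He.
  destruct (uniform_index (seq 1 d) (fun i n0 => forall n, (n0 <= n)%nat -> Li i n <= eps * Bi i n)) as (n0 & H).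
  - intros i K K' HK H n Hn. apply H; lia.
  - intros i Hi. apply in_seq_interior in Hi. destruct (other i) as (j & Hj & Hne).
    destruct (third i j) as (m & Hm & Hmi & Hmj).
    destruct Leaf_vs_Z as (C & HC & H). assert (Hr := pos_INR (r i)).
    destruct (yv_unbounded m Hm (C - ln (eps / (INR (r i) + 1)))) as (n0 & Hn0).
    exists n0. intros n Hn. specialize (Hn0 n Hn).
    assert (Hq : 0 < eps / (INR (r i) + 1)) by (apply Rdiv_lt_0_compat; lra).
    assert (HB := Bi_ge1 i n Hi).
    eapply Rle_trans; [apply (Li_le_scal i n (eps / (INR (r i) + 1) * Bi i n))|].
    + intros k Hk. specialize (H i j k n Hi Hj ltac:(auto) Hk).
      assert (H3 := Yv_ge3 i j m n Hi Hj Hm ltac:(auto) ltac:(auto) ltac:(auto)).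
      assert (Hl := Leaf_ge1 i k n Hi Hk). assert (HZ := Zi_ge1 j n Hj).
      assert (HBZ := Bi_ge_Z i j n Hi Hj Hne).
      assert (HlB : ln (Zi j n) <= ln (Bi i n)) by (apply ln_mono; lra).
      rewrite <- (exp_ln (cnt n (Leaf i k))), <- (exp_ln (Bi i n)), <- (exp_ln (eps / (INR (r i) + 1))) by lra.
      rewrite <- exp_plus. apply exp_mono. lra.
    + rewrite <- Rmult_assoc. apply Rmult_le_compat_r; [lra|].
      unfold Rdiv. rewrite (Rmult_comm eps), <- Rmult_assoc.
      assert (INR (r i) * / (INR (r i) + 1) <= 1); [|nra].
      apply (Rmult_le_reg_r (INR (r i) + 1)); [lra|]. rewrite Rmult_assoc, Rinv_l; lra.
  - exists n0. intros i Hi. apply H, in_seq_interior; auto.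
Qed.

(** No interior vertex takes almost all visits: by alternation [Zi] exceeds [Bi + Li] by at most a
    constant, which [zeta >= 8 (1 + c)] absorbs, and [Li] is eventually below [Bi / 4]. The summand
    [zeta n0] covers early times. *)
Lemma zeta_le_B : exists K, 1 <= K /\ forall i, interior d i -> forall n, zeta n <= K * Bi i n.
Proof.
  destruct (Li_small (1/4) ltac:(lra)) as (n1 & H1). destruct visit_balance as (c & Hc & H2).
  destruct (zeta_large (8 * (1 + c))) as (n2 & H3).
  set (n0 := Nat.max n1 n2). assert (Hz0 := zeta_ge1 n0).
  exists (3 + zeta n0). split; [lra|]. intros i Hi n.
  assert (HB := Bi_ge1 i n Hi). assert (Hz := zeta_ge1 n).
  destruct (le_lt_dec n0 n) as [Hn|Hn].
  - specialize (H1 i Hi n ltac:(lia)). specialize (H3 n ltac:(lia)). destruct (H2 i Hi n) as [_ H4].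
    assert (HZ : Zi i n = zeta n - Bi i n) by (unfold Bi; ring).
    destruct (eI_01 i n); nra.
  - assert (zeta n <= zeta n0) by (apply zeta_mono; lia). nra.
Qed.

(* The exponent comes from comparing a leaf of [i] with two interior vertices [j] and [m] other than [i]:
   the two bounds of [Leaf_vs_Z] add up to [2 ln leaf <= 2 ln zeta - (Yv - yv i) + C]. *)
Lemma Li_power : exists a C, 0 < a < 1 /\ 0 <= C /\ forall i, interior d i -> forall n,
  Li i n <= C * Rpower (zeta n) (1 - a).
Proof.
  destruct zeta_le_B as (K & HK & HB). destruct Wt_upper as (c & Hc & HW).
  destruct Leaf_vs_Z as (C & HC & H).
  set (b := / (K + c)). assert (Hb : 0 < b) by (apply Rinv_0_lt_compat; lra).
  assert (Hb1 : b <= 1) by (unfold b; rewrite <- Rinv_1; apply Rinv_le_contravar; lra).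
  (* [Yv - yv i] collects the visits counted by [Bi i], at which
     [Wt <= zeta + c <= (K + c) Bi i]. *)
  destruct (uniform_bound (seq 1 d) (fun i C => forall n, b * ln (zeta n) - C <= Yv n - yv i n)) as (C1 & HC1 & HS).
  { intros i K1 K2 HK12 H1 n. specialize (H1 n). lra. }
  { intros i Hi. apply in_seq_interior in Hi. exists (b * ln K + ln (Bi i 0 + 1) * b + 1). intros n.
    assert (Hv := visit_lower (Bi i) (fun k => eT k - eI i k) (K + c) 0 n ltac:(lia) ltac:(lra)
      (fun k => Bi_ge1 i k Hi)).
    assert (HBn := HB i Hi n). assert (HB1 := Bi_ge1 i n Hi). assert (Hz := zeta_ge1 n).
    assert (Hsum : forall n, bsum (fun k => (eT k - eI i k) / Wt k) n = Yv n - yv i n).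
    { intros m. unfold Yv, yv. induction m as [|m IH]; simpl; [ring|]. rewrite IH. unfold Rdiv; ring. }
    rewrite !Hsum in Hv.
    assert (Hv' : (ln (Bi i n + 1) - ln (Bi i 0 + 1)) / (K + c) <= Yv (S n) - yv i (S n) - (Yv 1 - yv i 1)).
    { apply Hv.
      - intros k. destruct (x_cases k) as [(j & Hj & E & ET & E1 & E0 & EL)|(j & l & Hj & Hk & E & ET & E0 & EL & EL0)].
        + rewrite ET. destruct (Nat.eq_dec i j) as [<-|]; [rewrite E1|rewrite E0 by auto]; lra.
        + rewrite ET, E0; lra.
      - intros k. rewrite Bi_S. ring.
      - intros k _ E. assert (ET : eT (S k) = 1) by (destruct (eT_01 (S k)), (eI_01 i (S k)); lra).
        specialize (HW (S k) ET). assert (HB2 := HB i Hi (S k)). assert (HB3 := Bi_ge1 i (S k) Hi). nra. }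
    assert (H1 : Yv (S n) - yv i (S n) <= Yv n - yv i n + 1).
    { unfold Yv, yv. simpl. assert (Ht := yv_term_nonneg i n). assert (Ht' := term_le1 _ n (eT_01 n)). lra. }
    assert (H2 : 0 <= Yv 1 - yv i 1).
    { rewrite Yv_sum. assert (yv i 1 <= sI (fun i => yv i 1)); [|lra].
      apply (sI_term (fun i => yv i 1)); auto. intros; apply yv_nonneg. }
    assert (H3 : ln (zeta n) <= ln K + ln (Bi i n + 1)).
    { rewrite <- ln_mult by lra. apply ln_mono; nra. }
    fold b in Hv'. unfold Rdiv in Hv'. fold b in Hv'. nra. }
  (* By [Yv_ge3] the two brackets add up to at least [Yv - yv i >= b ln zeta - C1]; halving the sum
     of the comparisons gives the exponent [1 - b/2]. *)
  exists (b / 2), (sI (fun i => INR (r i)) * exp (C + C1 / 2)).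
  assert (Hsr : 0 <= sI (fun i => INR (r i))) by (apply sumR_nonneg; intros; apply pos_INR).
  split; [lra|]. split; [apply Rmult_le_pos; [auto|left; apply exp_pos]|].
  intros i Hi n.
  destruct (other i) as (j & Hj & Hji). destruct (third i j) as (m & Hm & Hmi & Hmj).
  eapply Rle_trans; [apply (Li_le_scal i n (exp (C + C1 / 2) * Rpower (zeta n) (1 - b / 2)))|].
  - intros k Hk. assert (Hz := zeta_ge1 n). assert (Hl := Leaf_ge1 i k n Hi Hk).
    assert (H1 := H i j k n Hi Hj ltac:(auto) Hk). assert (H2 := H i m k n Hi Hm ltac:(auto) Hk).
    assert (H3 := Yv_ge3 i j m n Hi Hj Hm ltac:(auto) ltac:(auto) ltac:(auto)).
    assert (H4 := HS i ltac:(apply in_seq_interior; auto) n).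
    assert (HZj : ln (Zi j n) <= ln (zeta n)) by (apply ln_mono; [assert (HH := Zi_ge1 j n Hj); lra|apply Zi_le_zeta; auto]).
    assert (HZm : ln (Zi m n) <= ln (zeta n)) by (apply ln_mono; [assert (HH := Zi_ge1 m n Hm); lra|apply Zi_le_zeta; auto]).
    rewrite <- (exp_ln (cnt n (Leaf i k))) by lra. unfold Rpower. rewrite <- exp_plus. apply exp_mono.
    nra.
  - rewrite <- Rmult_assoc. apply Rmult_le_compat_r; [left; apply Rpower_pos|].
    apply Rmult_le_compat_r; [left; apply exp_pos|].
    apply (sI_term (fun i => INR (r i))); auto. intros; apply pos_INR.
Qed.

(** * Energy and convergence of the proportions *)

Definition gap (i n : nat) : R := Zi i n / zeta n - / INR d.
Definition energy (n : nat) : R := sI (fun i => gap i n * gap i n) / zeta n.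

Lemma sI_gap n : sI (fun i => gap i n) = 0.
Proof.
  unfold gap, sI, Rdiv. rewrite sumR_minus. rewrite (sumR_ext _ (fun i => / zeta n * Zi i n)) by (intros; ring).
  rewrite sumR_scal. fold (sI (fun i => Zi i n)). fold (zeta n). fold (sI (fun _ => / INR d)).
  rewrite sI_const. assert (H := zeta_ge1 n). assert (H' := INR_d_ge3). field; lra.
Qed.

Lemma Bi_gap i n : Bi i n = zeta n * (1 - / INR d - gap i n).
Proof. unfold Bi, gap. assert (H := zeta_ge1 n). assert (H' := INR_d_ge3). field; lra. Qed.

(** With [m = 1 - 1/D - g], the function [(D-1)/m] of [g] has value [D] and slope [D^2/(D-1)] at 0.
    The remainder of this tangent is at least [g^2] because [D^2/(D-1) >= 1 >= m], and the linear
    terms cancel since the gaps sum to zero. *)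
Lemma energy_le n : energy n <= (INR d - 1) * sI (fun i => / Bi i n) - INR d * INR d / zeta n.
Proof.
  assert (Hz := zeta_ge1 n). assert (HD := INR_d_ge3). set (D := INR d) in *.
  assert (Hiz : 0 < / zeta n) by (apply Rinv_0_lt_compat; lra).
  assert (H : sI (fun i => / zeta n * (D * D / D + D * D / (D - 1) * gap i n + gap i n * gap i n)) <=
              sI (fun i => (D - 1) * / Bi i n)).
  { apply sI_le. intros i Hi. assert (HB := Bi_ge1 i n Hi). rewrite (Bi_gap i n) in *. fold D in HB |- *.
    set (g := gap i n) in *. set (m := 1 - / D - g) in *.
    assert (Hm : 0 < m) by nra. 
    assert (Hm1 : m <= 1).
    { assert (HB2 := Bi_le_zeta i n Hi). rewrite (Bi_gap i n) in HB2. fold D g in HB2. fold m in HB2. nra. }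
    rewrite Rinv_mult, <- Rmult_assoc, (Rmult_comm (D - 1)), Rmult_assoc.
    apply Rmult_le_compat_l; [lra|].
    apply (Rmult_le_reg_r m); auto. rewrite Rmult_assoc, Rinv_l, Rmult_1_r by lra.
    assert (Hg : g = 1 - / D - m) by (unfold m; ring).
    assert (E : (D * D / D + D * D / (D - 1) * g + g * g) * m = D - 1 - (D * D / (D - 1) - m) * (g * g)).
    { rewrite Hg. field. lra. }
    rewrite E. assert (1 <= D * D / (D - 1)).
    { apply (Rmult_le_reg_r (D - 1)); [lra|]. unfold Rdiv. rewrite Rmult_assoc, Rinv_l; nra. }
    assert (0 <= g * g) by nra. nra. }
  unfold sI in H. rewrite !sumR_scal, !sumR_plus, sumR_scal in H. fold (sI (fun i => gap i n)) in H.
  rewrite sI_gap in H. fold (sI (fun _ : nat => D * D / D)) in H. rewrite sI_const in H. fold D in H.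
  fold (sI (fun i => / Bi i n)) in H. fold (sI (fun i => gap i n * gap i n)) in H.
  unfold energy. 
  replace (/ zeta n * (D * (D * D / D) + D * D / (D - 1) * 0 + sI (fun i => gap i n * gap i n))) with
    (D * D / zeta n + sI (fun i => gap i n * gap i n) / zeta n) in H by (field; lra).
  lra.
Qed.

Lemma Binv_le K i n : (forall i, interior d i -> forall n, zeta n <= K * Bi i n) -> interior d i ->
  / Bi i n <= K * / zeta n.
Proof.
  intros HK Hi. specialize (HK i Hi n). assert (HB := Bi_ge1 i n Hi). assert (Hz := zeta_ge1 n).
  apply (Rmult_le_reg_r (Bi i n)); [lra|]. rewrite Rinv_l by lra.
  apply (Rmult_le_reg_r (zeta n)); [lra|]. replace (K * / zeta n * Bi i n * zeta n) with (K * Bi i n) by (field; lra). lra.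
Qed.

Lemma Rpower_zeta_ge a n : a <= 1 -> / zeta n * / zeta n <= Rpower (zeta n) (- 1 - a).
Proof.
  intros Ha. assert (Hz := zeta_ge1 n).
  replace (/ zeta n * / zeta n) with (Rpower (zeta n) (- (1) + - (1))).
  - apply Rpower_exp_mono; lra.
  - rewrite Rpower_plus, !Rpower_Ropp, Rpower_1 by lra. auto.
Qed.

(** The potential contains [(d-1) Yv] instead of the sum of the [ln Zi], so that its increments are
    explicit. A visit to [i] raises [ln (Bi j)] by about [1/Bi j] for [j] other than [i]; the
    missing [1/Bi i] is supplied by [Yv], up to the leaves. [Yv] is taken one index ahead because
    [Yv n] stops before time [n]. *)
Lemma energy_step : exists a C, 0 < a < 1 /\ 0 <= C /\ forall k,
  eT (S k) * energy k <=
   ((INR d - 1) * sI (fun i => ln (Bi i (S k))) - INR d * INR d * ln (zeta (S k)) + (INR d - 1) * Yv (S (S k)))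
   - ((INR d - 1) * sI (fun i => ln (Bi i k)) - INR d * INR d * ln (zeta k) + (INR d - 1) * Yv (S k))
   + C * (eT (S k) * Rpower (zeta k) (- 1 - a)).
Proof.
  destruct zeta_le_B as (K & HK & HB). destruct Li_power as (a & C & Ha & HC & HL').
  set (D := INR d). assert (HD := INR_d_ge3). fold D in HD.
  exists a, ((D - 1) * (D * (K * K) + C * (K * K))). split; [auto|].
  assert (HKK : 0 <= K * K) by nra. assert (HCK : 0 <= C * (K * K)) by nra.
  split; [apply Rmult_le_pos; nra|].
  intros k. assert (HE := energy_le k). fold D in HE.
  replace (Yv (S (S k))) with (Yv (S k) + eT (S k) / Wt (S k)) by reflexivity.
  rewrite zeta_S. assert (Hz := zeta_ge1 k).
  destruct (x_cases (S k)) as [(i & Hi & E & ET & E1 & E0 & EL)|(j & l & Hj & Hk & E & ET & E0 & EL & EL0)].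
  - rewrite ET. assert (HW : Wt (S k) = Bi i k + Li i k).
    { unfold Wt. rewrite E, Bi_S, Li_S, ET, E1, EL. ring. }
    rewrite HW. set (P := Rpower (zeta k) (- 1 - a)).
    assert (HP : / zeta k * / zeta k <= P) by (apply Rpower_zeta_ge; lra).
    assert (Hiz : 0 < / zeta k) by (apply Rinv_0_lt_compat; lra).
    assert (Hlz := ln_step_le (zeta k) ltac:(lra)).
    assert (HsB : sI (fun j => / Bi j k) - / Bi i k - D * (K * K * P) <=
              sI (fun j => ln (Bi j (S k))) - sI (fun j => ln (Bi j k))).
    { unfold sI. rewrite <- sumR_minus.
      assert (Hsg : sumR (fun j => if Nat.eqb j i then / Bi j k else 0) (seq 1 d) = / Bi i k).
      { rewrite (sumR_single _ _ i); [rewrite Nat.eqb_refl; auto|apply seq_NoDup|apply in_seq_interior; auto|].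
        intros b _ Hb. destruct (Nat.eqb_spec b i); congruence. }
      rewrite <- Hsg. unfold D. rewrite <- (length_seq d 1) at 3. rewrite <- sumR_const, <- !sumR_minus.
      apply sumR_le. intros j Hj. apply in_seq_interior in Hj. assert (HBj := Bi_ge1 j k Hj).
      rewrite Bi_S, ET. assert (0 <= K * K * P) by nra.
      destruct (Nat.eqb_spec j i) as [->|Hne].
      - rewrite E1. replace (Bi i k + (1 - 1)) with (Bi i k) by ring. lra.
      - rewrite E0 by auto. replace (Bi j k + (1 - 0)) with (Bi j k + 1) by ring. assert (Hs := ln_step_ge2 (Bi j k) ltac:(lra)).
        assert (Hb := Binv_le K j k HB Hj). assert (0 < / Bi j k) by (apply Rinv_0_lt_compat; lra).
        rewrite Rinv_mult in Hs.
        assert (/ Bi j k * / Bi j k <= (K * / zeta k) * (K * / zeta k)).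
        { apply Rmult_le_compat. 1,2:left; assumption. all: exact Hb. }
        assert (K * K * (/ zeta k * / zeta k) <= K * K * P) by (apply Rmult_le_compat_l; lra). lra. }
    (* [1/(B+L) >= 1/B - L/B^2], where [L/B^2] is of order [zeta^(1-a) / zeta^2]. *)
    assert (HWi : / Bi i k - C * (K * K * P) <= 1 / (Bi i k + Li i k)).
    { assert (HBi := Bi_ge1 i k Hi). assert (HLi := Li_nonneg i k Hi). assert (HLp := HL' i Hi k).
      assert (Hb := Binv_le K i k HB Hi). assert (0 < / Bi i k) by (apply Rinv_0_lt_compat; lra).
      assert (H1 : / Bi i k - Li i k * (/ Bi i k * / Bi i k) <= 1 / (Bi i k + Li i k)).
      { apply (Rmult_le_reg_r (Bi i k + Li i k)); [lra|]. unfold Rdiv. rewrite Rmult_1_l, Rinv_l by lra.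
        replace ((/ Bi i k - Li i k * (/ Bi i k * / Bi i k)) * (Bi i k + Li i k)) with
          (1 - (Li i k * / Bi i k) * (Li i k * / Bi i k)) by (field; lra). nra. }
      assert (H2 : / Bi i k * / Bi i k <= (K * / zeta k) * (K * / zeta k)) by (apply Rmult_le_compat; lra).
      assert (H3 : Li i k * (/ Bi i k * / Bi i k) <= C * Rpower (zeta k) (1 - a) * ((K * / zeta k) * (K * / zeta k))).
      { apply Rmult_le_compat; nra. }
      replace (C * Rpower (zeta k) (1 - a) * (K * / zeta k * (K * / zeta k))) with (C * (K * K * P)) in H3; [lra|].
      unfold P. replace (- 1 - a) with (1 - a + (- (1) + - (1))) by ring.
      rewrite !Rpower_plus, !Rpower_Ropp, !Rpower_1 by lra. ring. }
    assert (H1 : (D - 1) * (sI (fun j => / Bi j k) - / Bi i k - D * (K * K * P)) <= (D - 1) * (sI (fun j => ln (Bi j (S k))) - sI (fun j => ln (Bi j k)))) by (apply Rmult_le_compat_l; lra).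
    assert (H2 : (D - 1) * (/ Bi i k - C * (K * K * P)) <= (D - 1) * (1 / (Bi i k + Li i k))) by (apply Rmult_le_compat_l; lra).
    assert (H3 : D * D * (ln (zeta k + 1) - ln (zeta k)) <= D * D * / zeta k) by (apply Rmult_le_compat_l; nra).
    unfold Rdiv in HE. lra.
  - rewrite ET. unfold sI at 1. rewrite (sumR_ext (fun i => ln (Bi i (S k))) (fun i => ln (Bi i k))).
    + fold (sI (fun i => ln (Bi i k))). rewrite Rplus_0_r. unfold Rdiv. lra.
    + intros b _. rewrite Bi_S, ET, E0. f_equal; ring.
Qed.

(** The potential is bounded above: up to constants [(D-1) Yv] is at most the sum of the [ln Zi],
    hence [D ln zeta], and the [ln Bi] contribute at most [(D-1) D ln zeta]. Together this is the
    [D^2 ln zeta] that is subtracted. *)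
Lemma energy_summable : exists C, forall n, bsum (fun k => eT (S k) * energy k) n <= C.
Proof.
  destruct energy_step as (a & C & Ha & HC & H). destruct ln_Zi_bound as (C0 & HC0 & H0).
  set (D := INR d) in *. assert (HD := INR_d_ge3). fold D in HD.
  set (Th := fun k => (D - 1) * sI (fun i => ln (Bi i k)) - D * D * ln (zeta k) + (D - 1) * Yv (S k)).
  set (f := fun k => eT (S k) * Rpower (zeta k) (- 1 - a)).
  assert (Hup : forall n, Th n <= D * C0 + D).
  { intros n. unfold Th.
    assert (H1 : sI (fun i => Yv n - yv i n + uv i n - C0) <= sI (fun _ => ln (zeta n))).
    { apply sI_le. intros i Hi. specialize (H0 i Hi n). apply Rabs_le_inv in H0.
      assert (ln (Zi i n) <= ln (zeta n)) by (apply ln_mono; [assert (HH := Zi_ge1 i n Hi); lra|apply Zi_le_zeta; auto]). lra. }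
    rewrite sI_const in H1. unfold sI in H1. rewrite sumR_minus, sumR_plus, sumR_minus, !sumR_const in H1.
    fold (sI (fun i => yv i n)) in H1. fold (sI (fun i => uv i n)) in H1. rewrite <- Yv_sum, length_seq in H1.
    assert (H2 : 0 <= sI (fun i => uv i n)) by (apply sumR_nonneg; intros; apply uv_nonneg).
    assert (H3 : sI (fun i => ln (Bi i n)) <= sI (fun _ => ln (zeta n))).
    { apply sI_le. intros i Hi. apply ln_mono; [assert (HH := Bi_ge1 i n Hi); lra|apply Bi_le_zeta; auto]. }
    rewrite sI_const in H3. fold D in H1, H3.
    assert (H4 : Yv (S n) <= Yv n + 1).
    { unfold Yv. simpl. assert (Ht := term_le1 _ n (eT_01 n)). lra. }
    assert (H5 : (D - 1) * sI (fun i => ln (Bi i n)) <= (D - 1) * (D * ln (zeta n))) by (apply Rmult_le_compat_l; lra).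
    assert (H6 : (D - 1) * Yv (S n) <= (D - 1) * (Yv n + 1)) by (apply Rmult_le_compat_l; lra).
    lra. }
  exists (D * C0 + D - Th 0%nat + C * ((2 + a) / a)). intros n.
  assert (H1 : bsum (fun k => eT (S k) * energy k) n - bsum (fun k => eT (S k) * energy k) 0 <=
            (fun n => Th n + C * bsum f n) n - (fun n => Th n + C * bsum f n) 0%nat).
  { apply (bsum_telescope_le _ (fun n => Th n + C * bsum f n)); [lia|]. intros k _. specialize (H k). fold D in H. unfold Th. simpl bsum. unfold f at 2. lra. }
  change (bsum (fun k => eT (S k) * energy k) n - 0 <= Th n + C * bsum f n - (Th 0%nat + C * 0)) in H1.
  assert (H2 := bsum_counter zeta (fun k => eT (S k)) a 0 n ltac:(lra) ltac:(lia) (fun k _ => zeta_ge1 k)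
                  (fun k _ => conj (eT_01 (S k)) (zeta_S k))).
  change (bsum f n - bsum f 0 <= (2 + a) / a * Rpower (zeta 0) (- a)) in H2. simpl bsum in H2.
  assert (H3 := Rpower_le_1 (zeta 0) a (zeta_ge1 0) ltac:(lra)).
  assert (H4 : (2 + a) / a * Rpower (zeta 0) (- a) <= (2 + a) / a * 1).
  { apply Rmult_le_compat_l; auto. left; apply Rdiv_lt_0_compat; lra. }
  assert (H5 : C * bsum f n <= C * ((2 + a) / a)) by (apply Rmult_le_compat_l; lra).
  specialize (Hup n). lra.
Qed.

Lemma gap_abs i n : interior d i -> Rabs (gap i n) <= 1.
Proof.
  intros Hi. assert (HZ := Zi_ge1 i n Hi). assert (HZ' := Zi_le_zeta i n Hi). assert (Hz := zeta_ge1 n).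
  assert (HD := INR_d_ge3). assert (H1 : 0 <= Zi i n / zeta n <= 1).
  { split; [apply Rmult_le_pos; [lra|left; apply Rinv_0_lt_compat; lra]|].
    apply (Rmult_le_reg_r (zeta n)); [lra|]. unfold Rdiv. rewrite Rmult_assoc, Rinv_l; lra. }
  assert (0 < / INR d) by (apply Rinv_0_lt_compat; lra).
  assert (/ INR d <= / 1) by (apply Rinv_le_contravar; lra). rewrite Rinv_1 in *.
  unfold gap. apply Rabs_le. lra.
Qed.

Lemma gap_step i n : interior d i -> Rabs (gap i (S n) - gap i n) <= eT (S n) * / zeta n.
Proof.
  intros Hi. unfold gap. rewrite Zi_S, zeta_S. assert (HZ := Zi_ge1 i n Hi). assert (HZ' := Zi_le_zeta i n Hi).
  assert (Hz := zeta_ge1 n). assert (Hiz : 0 < / zeta n) by (apply Rinv_0_lt_compat; lra).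
  assert (H : forall e, e = 0 \/ e = 1 -> Rabs ((Zi i n + e) / (zeta n + 1) - / INR d - (Zi i n / zeta n - / INR d)) <= / zeta n).
  { intros e He.
    replace ((Zi i n + e) / (zeta n + 1) - / INR d - (Zi i n / zeta n - / INR d)) with
      (/ zeta n * ((e * zeta n - Zi i n) / (zeta n + 1))) by (field; assert (HD := INR_d_ge3); lra).
    rewrite Rabs_mult, (Rabs_right (/ zeta n)) by lra. rewrite <- (Rmult_1_r (/ zeta n)) at 2.
    apply Rmult_le_compat_l; [lra|]. unfold Rdiv. rewrite Rabs_mult, (Rabs_right (/ (zeta n + 1))).
    2:{ left; apply Rinv_0_lt_compat; lra. }
    apply (Rmult_le_reg_r (zeta n + 1)); [lra|]. rewrite Rmult_assoc, Rinv_l by lra.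
    rewrite Rmult_1_r, Rmult_1_l. apply Rabs_le. destruct He as [-> | ->]; lra. }
  destruct (x_cases (S n)) as [(j & Hj & E & ET & E1 & E0 & EL)|(j & l & Hj & Hk & E & ET & E0 & EL & EL0)].
  - rewrite ET, Rmult_1_l. apply H, eI_01.
  - rewrite ET, E0, !Rplus_0_r, Rminus_diag, Rabs_R0. lra.
Qed.

(** For a gap [b] and an increment of order [1/zeta], the main term [e b^2] is a term of the energy.
    This is why cubes are used: the energy does not control the increments of the gaps themselves or
    of their squares. *)
Lemma cube_diff a b e : 0 <= e -> Rabs (a - b) <= e ->
  Rabs (a * a * a - b * b * b) <= e * (5 * (b * b) + 3 * (e * e)).
Proof.
  intros He H. replace (a * a * a - b * b * b) with ((a - b) * (a * a + a * b + b * b)) by ring.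
  rewrite Rabs_mult. apply Rmult_le_compat; auto using Rabs_pos.
  apply Rabs_le_inv in H. assert (Hc : exists c, a = b + c) by (exists (a - b); ring).
  destruct Hc as (c & ->). replace (b + c - b) with c in H by ring.
  assert (c * c <= e * e) by nra. assert (H1 := Rle_0_sqr (b - c)). assert (H2 := Rle_0_sqr (b + c)).
  assert (H3 := Rle_0_sqr b). unfold Rsqr in *. apply Rabs_le. split; lra.
Qed.

(* The cubes of the gaps have summable variation, hence converge; the bound on the energy excludes a nonzero limit. *)
Lemma gap_conv eps : 0 < eps -> exists n0, forall i, interior d i -> forall n, (n0 <= n)%nat -> Rabs (gap i n) <= eps.
Proof.
  intros He.
  destruct (uniform_index (seq 1 d) (fun i n0 => forall n, (n0 <= n)%nat -> Rabs (gap i n) <= eps)) as (n0 & H).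
  { intros i K K' HK H n Hn. apply H; lia. }
  2:{ exists n0. intros i Hi. apply H, in_seq_interior; auto. }
  intros i Hi. apply in_seq_interior in Hi.
  destruct energy_summable as (C & HC).
  set (en := fun k => eT (S k) * (gap i k * gap i k / zeta k)).
  set (f := fun k => eT (S k) * Rpower (zeta k) (- 1 - 1)).
  assert (HT : forall k, 0 <= eT k) by (intros k; destruct (eT_01 k); lra).
  assert (Hen : forall n, bsum en n <= C).
  { intros n. eapply Rle_trans; [|apply (HC n)].
    assert (H := bsum_le en (fun k => eT (S k) * energy k) 0 n ltac:(lia)). simpl in H.
    assert (bsum en n - 0 <= bsum (fun k => eT (S k) * energy k) n - 0); [|lra]. apply H.
    intros k _. apply Rmult_le_compat_l; auto. unfold energy.
    apply Rmult_le_compat_r; [left; apply Rinv_0_lt_compat; assert (HH := zeta_ge1 k); lra|].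
    apply (sI_term (fun i => gap i k * gap i k)); auto. intros; nra. }
  set (tau := fun k => 5 * en k + 3 * f k).
  assert (Hf : forall n, bsum f n <= 3).
  { intros n. assert (H2 := bsum_counter zeta (fun k => eT (S k)) 1 0 n ltac:(lra) ltac:(lia) (fun k _ => zeta_ge1 k)
                  (fun k _ => conj (eT_01 (S k)) (zeta_S k))).
    change (bsum f n - bsum f 0 <= (2 + 1) / 1 * Rpower (zeta 0) (- (1))) in H2. simpl bsum in H2. assert (H3 := Rpower_le_1 (zeta 0) 1 (zeta_ge1 0) ltac:(lra)). lra. }
  assert (Htau : forall n, bsum tau n = 5 * bsum en n + 3 * bsum f n).
  { intros n. unfold tau. rewrite bsum_plus, !bsum_scal. auto. }
  assert (Hpos : forall k, 0 <= en k /\ 0 <= f k).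
  { intros k. unfold en, f. split.
    - apply Rmult_le_pos; auto. apply Rdiv_nonneg; [nra|apply zeta_ge1].
    - apply Rmult_le_pos; auto. left; apply Rpower_pos. }
  assert (Hcube : forall k, Rabs (gap i (S k) * gap i (S k) * gap i (S k) - gap i k * gap i k * gap i k) <= tau k).
  { intros k. assert (Hz := zeta_ge1 k). assert (Hiz : 0 < / zeta k) by (apply Rinv_0_lt_compat; lra).
    assert (Hs := gap_step i k Hi).
    assert (Hz1 : / zeta k <= 1) by (rewrite <- Rinv_1; apply Rinv_le_contravar; lra).
    eapply Rle_trans; [apply cube_diff; [|apply Hs]|].
    - apply Rmult_le_pos; auto; lra.
    - unfold tau, en, f. assert (HP := Rpower_zeta_ge 1 k ltac:(lra)).
      assert (H0 : / zeta k * / zeta k * / zeta k <= Rpower (zeta k) (- 1 - 1)).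
      { assert (/ zeta k * / zeta k * / zeta k <= / zeta k * / zeta k * 1); [|lra]. apply Rmult_le_compat_l; nra. }
      unfold Rdiv. destruct (eT_01 (S k)) as [E|E]; rewrite E; lra. }
  set (e3 := eps * eps * eps). assert (He3 : 0 < e3) by (unfold e3; repeat apply Rmult_lt_0_compat; auto).
  destruct (mono_bounded_cauchy (bsum tau) (5 * C + 9)) with (eps := e3 / 2) as (m & Hm).
  { intros k. simpl. unfold tau. destruct (Hpos k). lra. }
  { intros k. rewrite Htau. specialize (Hen k). specialize (Hf k). lra. }
  { lra. }
  assert (Hclose : forall p q, (m <= p)%nat -> (p <= q)%nat ->
     Rabs (gap i q * gap i q * gap i q - gap i p * gap i p * gap i p) <= e3 / 2).
  { intros p q Hp Hq. apply Rle_trans with (bsum tau q - bsum tau p).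
    - clear -Hcube Hq. induction Hq as [|q Hq IH]; [rewrite !Rminus_diag, Rabs_R0; lra|].
      simpl bsum. specialize (Hcube q).
      replace (gap i (S q) * gap i (S q) * gap i (S q) - gap i p * gap i p * gap i p) with
        ((gap i (S q) * gap i (S q) * gap i (S q) - gap i q * gap i q * gap i q) + (gap i q * gap i q * gap i q - gap i p * gap i p * gap i p)) by ring.
      eapply Rle_trans; [apply Rabs_triang|]. lra.
    - specialize (Hm q ltac:(lia)). 
      assert (bsum tau m <= bsum tau p); [|lra]. apply bsum_incr; auto. intros k. unfold tau. destruct (Hpos k). lra. }
  exists m. intros n Hn. apply Rnot_lt_le. intros Hlt.
  (* One gap above [eps] after [m] keeps all cubes after [m] above [e3 / 2] in absolute value, hence
     also the squares, gaps being at most 1. The energy then grows at least like [e3 / 2] times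
     [ln zeta]. *)
  assert (Hlow : forall k, (m <= k)%nat -> e3 / 2 <= gap i k * gap i k).
  { intros k Hk.
    assert (Hc : Rabs (gap i n * gap i n * gap i n - gap i k * gap i k * gap i k) <= e3 / 2).
    { destruct (le_lt_dec n k); [rewrite Rabs_minus_sym|]; apply Hclose; lia. }
    assert (Hn3 : e3 < Rabs (gap i n * gap i n * gap i n)).
    { rewrite !Rabs_mult. unfold e3. assert (eps * eps < Rabs (gap i n) * Rabs (gap i n)) by (apply Rmult_le_0_lt_compat; lra).
      apply Rmult_le_0_lt_compat; nra. }
    assert (Hk3 : Rabs (gap i k * gap i k * gap i k) <= gap i k * gap i k).
    { rewrite Rabs_mult, (Rabs_right (gap i k * gap i k)) by nra.
      rewrite <- (Rmult_1_r (gap i k * gap i k)) at 2. apply Rmult_le_compat_l; [nra|apply gap_abs; auto]. }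
    assert (Ht := Rabs_triang_inv (gap i n * gap i n * gap i n) (gap i k * gap i k * gap i k)). lra. }
  assert (Hgrow : forall n, (m <= n)%nat -> e3 / 2 * (ln (zeta n) - ln (zeta m)) <= bsum en n - bsum en m).
  { intros q Hq. 
    assert (H1 : (fun k => e3 / 2 * ln (zeta k)) q - (fun k => e3 / 2 * ln (zeta k)) m <= bsum en q - bsum en m).
    { apply (bsum_telescope_ge _ (fun k => e3 / 2 * ln (zeta k))); auto. intros k Hk. rewrite zeta_S. unfold en.
      assert (Hz := zeta_ge1 k). assert (Hl := ln_step_le (zeta k) ltac:(lra)).
      assert (Hiz : 0 < / zeta k) by (apply Rinv_0_lt_compat; lra).
      specialize (Hlow k ltac:(lia)).
      destruct (eT_01 (S k)) as [E|E]; rewrite E.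
      - rewrite Rplus_0_r. lra.
      - unfold Rdiv at 3. nra. }
    lra. }
  destruct (zeta_large (exp ((C + 1) / (e3 / 2) + ln (zeta m)))) as (n1 & Hn1).
  set (q := Nat.max n1 m). specialize (Hn1 q ltac:(lia)). specialize (Hgrow q ltac:(lia)).
  assert (Hl : (C + 1) / (e3 / 2) + ln (zeta m) <= ln (zeta q)).
  { rewrite <- (ln_exp ((C + 1) / (e3 / 2) + ln (zeta m))). apply ln_mono; auto. apply exp_pos. }
  assert (H1 : e3 / 2 * ((C + 1) / (e3 / 2)) <= e3 / 2 * (ln (zeta q) - ln (zeta m))) by (apply Rmult_le_compat_l; lra).
  replace (e3 / 2 * ((C + 1) / (e3 / 2))) with (C + 1) in H1 by (field; lra).
  specialize (Hen q). assert (0 <= bsum en m) by (change 0 with (bsum en 0); apply bsum_incr; [lia|intros; apply Hpos]).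
  lra.
Qed.

(** * Limiting ratios and growth of the leaves *)

Lemma Zi_gap i n : Zi i n = zeta n * (/ INR d + gap i n).
Proof. unfold gap. assert (H := zeta_ge1 n). assert (H' := INR_d_ge3). field; lra. Qed.

Lemma Wt_Int i n : eI i n = 1 -> Wt n = Bi i n + Li i n /\ interior d i.
Proof.
  intros E. unfold Wt, eI in *. assert (Hv := x_valid n). destruct (x n) as [j|]; [|lra].
  rewrite valid_Int in Hv. destruct (Nat.eqb_spec j i); [subst; auto|lra].
Qed.

Lemma ratio_lower c1 : 0 < c1 -> c1 < INR d - 1 -> exists n0, forall i, interior d i -> forall n, (n0 <= n)%nat ->
  c1 * Zi i n <= Bi i n.
Proof.
  intros Hc Hc1. assert (HD := INR_d_ge3). set (D := INR d) in *.
  destruct (gap_conv ((D - 1 - c1) / (D * (1 + c1)))) as (n0 & H).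
  { apply Rdiv_lt_0_compat; nra. }
  exists n0. intros i Hi n Hn. specialize (H i Hi n Hn). apply Rabs_le_inv in H.
  rewrite Zi_gap, Bi_gap. fold D. assert (Hz := zeta_ge1 n).
  assert (H1 : gap i n * (1 + c1) <= (D - 1 - c1) / D).
  { apply Rle_trans with ((D - 1 - c1) / (D * (1 + c1)) * (1 + c1)); [apply Rmult_le_compat_r; lra|].
    right; field; lra. }
  assert ((D - 1 - c1) / D = 1 - / D - c1 * / D) by (field; lra). nra.
Qed.

(** The available margin [s/D] is split in halves, one for the leaves and one for the gap, which
    enters with the factor [D + s]. *)
Lemma ratio_upper s : 0 < s -> exists n0, forall i, interior d i -> forall n, (n0 <= n)%nat ->
  Bi i n + Li i n <= (INR d - 1 + s) * Zi i n.
Proof.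
  intros Hs. assert (HD := INR_d_ge3). set (D := INR d) in *.
  destruct (Li_small (s / (2 * D))) as (n1 & H1); [apply Rdiv_lt_0_compat; lra|].
  destruct (gap_conv (s / (2 * D * (D + s)))) as (n0 & H).
  { apply Rdiv_lt_0_compat; nra. }
  exists (Nat.max n0 n1). intros i Hi n Hn. specialize (H i Hi n ltac:(lia)). apply Rabs_le_inv in H.
  specialize (H1 i Hi n ltac:(lia)). assert (HB := Bi_le_zeta i n Hi).
  assert (Hz := zeta_ge1 n).
  assert (H2 : Li i n <= s / (2 * D) * zeta n).
  { eapply Rle_trans; [apply H1|]. apply Rmult_le_compat_l; auto. left; apply Rdiv_lt_0_compat; lra. }
  rewrite Zi_gap, Bi_gap. fold D.
  assert (H3 : - (s / (2 * D)) <= gap i n * (D + s)).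
  { apply Rle_trans with (- (s / (2 * D * (D + s))) * (D + s)); [right; field; lra|apply Rmult_le_compat_r; lra]. }
  assert (H4 : (D - 1 + s) * / D = 1 - / D + 2 * (s / (2 * D))) by (field; lra). nra.
Qed.

(** As [d - 1 > 3/2], eventually [Wt >= 3/2 Zi] at visits to [i], so [yv i] is at most [2/3 ln zeta]
    up to a constant. The exponent is not sharp, but it makes [Li / zeta] as small as the martingale
    error [zeta^(-1/3)]. *)
Lemma Li_two_thirds : exists C, 0 <= C /\ forall i, interior d i -> forall n, Li i n <= C * Rpower (zeta n) (2 / 3).
Proof.
  destruct (ratio_lower (3/2) ltac:(lra)) as (n1 & H1); [assert (HD := INR_d_ge3); lra|].
  destruct ln_leaf_bound as (C0 & HC0 & H0).
  destruct (uniform_bound (seq 1 d) (fun i C => forall n, yv i n <= 2 / 3 * ln (zeta n) + C)) as (C1 & HC1 & HS).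
  { intros i K1 K2 HK12 H n. specialize (H n). lra. }
  { intros i Hi. apply in_seq_interior in Hi. exists (yv i (S n1)). intros n.
    assert (Hz := zeta_ge1 n). assert (Hl := ln_nonneg (zeta n) Hz).
    destruct (le_lt_dec n1 n) as [Hn|Hn].
    - assert (Hv : yv i (S n) - yv i (S n1) <= (ln (Zi i n) - ln (Zi i n1)) / (3 / 2)).
      { apply visit_upper; auto; try lra.
        - intros k; apply Zi_ge1; auto.
        - intros k; apply eI_01.
        - intros k; apply Zi_S.
        - intros k Hk E. destruct (Wt_Int i (S k) E) as [-> _]. specialize (H1 i Hi (S k) ltac:(lia)).
          assert (HL' := Li_nonneg i (S k) Hi). lra. }
      assert (Hm := yv_mono i n (S n) ltac:(lia)).
      assert (ln (Zi i n) <= ln (zeta n)) by (apply ln_mono; [assert (HH := Zi_ge1 i n Hi); lra|apply Zi_le_zeta; auto]).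
      assert (0 <= ln (Zi i n1)) by (apply ln_nonneg, Zi_ge1; auto). lra.
    - assert (Hm := yv_mono i n (S n1) ltac:(lia)). lra. }
  assert (Hsr : 0 <= sI (fun i => INR (r i))) by (apply sumR_nonneg; intros; apply pos_INR).
  exists (sI (fun i => INR (r i)) * exp (C0 + C1)). split; [apply Rmult_le_pos; [auto|left; apply exp_pos]|].
  intros i Hi n.
  eapply Rle_trans; [apply (Li_le_scal i n (exp (C0 + C1) * Rpower (zeta n) (2 / 3)))|].
  - intros k Hk. assert (Hl := Leaf_ge1 i k n Hi Hk). rewrite <- (exp_ln (cnt n (Leaf i k))) by lra.
    unfold Rpower. rewrite <- exp_plus. apply exp_mono. specialize (HS i ltac:(apply in_seq_interior; auto) n).
    specialize (H0 i Hi k Hk n). apply Rabs_le_inv in H0. lra.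
  - rewrite <- Rmult_assoc. apply Rmult_le_compat_r; [left; apply Rpower_pos|].
    apply Rmult_le_compat_r; [left; apply exp_pos|].
    apply (sI_term (fun i => INR (r i))); auto. intros; apply pos_INR.
Qed.

Lemma zeta_le_Z : exists K, 1 <= K /\ forall i, interior d i -> forall n, zeta n <= K * Zi i n.
Proof.
  assert (HD := INR_d_ge3).
  destruct (ratio_upper 1 ltac:(lra)) as (n0 & H). assert (Hz0 := zeta_ge1 n0).
  exists (INR d + 1 + zeta n0). split; [lra|]. intros i Hi n.
  assert (HZ := Zi_ge1 i n Hi). assert (Hz := zeta_ge1 n).
  destruct (le_lt_dec n0 n) as [Hn|Hn].
  - specialize (H i Hi n Hn). assert (HL' := Li_nonneg i n Hi). unfold Bi in H. nra.
  - assert (zeta n <= zeta n0) by (apply zeta_mono; lia). nra.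
Qed.

(** Eventually [Wt <= (d-1+s) Zi] at visits to [i], so [yv i], which is the logarithm of the leaf
    count up to a constant, grows at least like [ln zeta / (d-1+s)]. *)
Lemma Leaf_lower s i k : 0 < s -> interior d i -> (1 <= k <= r i)%nat -> exists c n0, 0 < c /\
  forall n, (n0 <= n)%nat -> c * Rpower (zeta n) (/ (INR d - 1 + s)) <= cnt n (Leaf i k).
Proof.
  intros Hs Hi Hk. assert (HD := INR_d_ge3).
  destruct (ratio_upper s Hs) as (n0 & H). destruct ln_leaf_bound as (C0 & HC0 & H0). destruct zeta_le_Z as (K & HK & HZ).
  set (b := / (INR d - 1 + s)). assert (Hb : 0 < b) by (apply Rinv_0_lt_compat; lra).
  set (A := b * ln K + b * ln (Zi i n0 + 1) + 1 + C0).
  exists (exp (- A)), n0. split; [apply exp_pos|]. intros n Hn.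
  assert (Hl := Leaf_ge1 i k n Hi Hk). rewrite <- (exp_ln (cnt n (Leaf i k))) by lra.
  unfold Rpower. rewrite <- exp_plus. apply exp_mono.
  specialize (H0 i Hi k Hk n). apply Rabs_le_inv in H0.
  assert (Hv : (ln (Zi i n + 1) - ln (Zi i n0 + 1)) / (INR d - 1 + s) <= yv i (S n) - yv i (S n0)).
  { apply visit_lower; auto; try lra.
    - intros j; apply Zi_ge1; auto.
    - intros j; apply eI_01.
    - intros j; apply Zi_S.
    - intros j Hj E. destruct (Wt_Int i (S j) E) as [-> _]. apply H; auto; lia. }
  assert (Hy : yv i (S n) <= yv i n + 1).
  { unfold yv. simpl. assert (Ht := term_le1 _ n (eI_01 i n)). lra. }
  assert (Hy0 := yv_nonneg i (S n0)). assert (Hz := zeta_ge1 n).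
  assert (HZ1 := Zi_ge1 i n Hi). specialize (HZ i Hi n).
  assert (Hlz : ln (zeta n) <= ln K + ln (Zi i n + 1)) by (rewrite <- ln_mult by lra; apply ln_mono; nra).
  unfold Rdiv in Hv. fold b in Hv. unfold A. nra.
Qed.

Lemma tot_le_zeta : exists K, 1 <= K /\ forall n, tot n <= K * zeta n.
Proof.
  destruct visit_balance as (c & Hc & H). assert (HD := INR_d_ge3).
  exists (2 + INR d * c). split; [nra|]. intros n.
  assert (H1 : sI (fun i => Li i n) <= sI (fun i => Zi i n + c)).
  { apply sI_le. intros i Hi. destruct (H i Hi n) as [H1 _]. destruct (eI_01 i n); lra. }
  unfold sI at 2 in H1. rewrite sumR_plus in H1. fold (sI (fun i => Zi i n)) (sI (fun _ : nat => c)) in H1.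
  rewrite sI_const in H1. fold (zeta n) in H1. unfold tot. assert (Hz := zeta_ge1 n).
  assert (0 <= INR d * c) by nra. nra.
Qed.

Lemma zeta_le_tot n : zeta n <= tot n.
Proof.
  unfold tot. assert (0 <= sI (fun i => Li i n)); [|lra].
  apply sumR_nonneg. intros i Hi. apply Li_nonneg, in_seq_interior; auto.
Qed.

(** [Leaf_lower] with the slack [s = 1/b - (d-1)], for which its exponent is [b]. *)
Theorem path_leaf_lower i k b : 0 < b -> b < / (INR d - 1) -> interior d i -> (1 <= k <= r i)%nat ->
  exists c n0, 0 < c /\ forall n, (n0 <= n)%nat -> c * Rpower (tot n) b <= cnt n (Leaf i k).
Proof.
  intros Hb Hb1 Hi Hk. assert (HD := INR_d_ge3).
  assert (Hs : 0 < / b - (INR d - 1)).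
  { assert (/ / (INR d - 1) < / b); [|rewrite Rinv_inv in H; lra].
    apply Rinv_lt_contravar; auto. apply Rmult_lt_0_compat; auto. apply Rinv_0_lt_compat; lra. }
  destruct (Leaf_lower _ i k Hs Hi Hk) as (c & n0 & Hc & H). destruct tot_le_zeta as (K & HK & HT).
  exists (c * / Rpower K b), n0. split; [apply Rmult_lt_0_compat; auto; apply Rinv_0_lt_compat, Rpower_pos|].
  intros n Hn. specialize (H n Hn). replace (INR d - 1 + (/ b - (INR d - 1))) with (/ b) in H by ring.
  rewrite Rinv_inv in H. eapply Rle_trans; [|apply H]. rewrite Rmult_assoc. apply Rmult_le_compat_l; [lra|].
  apply (Rmult_le_reg_l (Rpower K b)); [apply Rpower_pos|].
  rewrite <- Rmult_assoc, Rinv_r, Rmult_1_l by (apply Rgt_not_eq, Rpower_pos).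
  assert (Hz := zeta_ge1 n). assert (Ht := zeta_le_tot n).
  rewrite Rpower_mult_distr by lra. apply Rpower_mono_l; try lra. apply HT.
Qed.

(** * Errors of order [zeta^(-1/3)] *)

Lemma Rinv_zeta_le n : / zeta n <= Rpower (zeta n) (- (1 / 3)).
Proof.
  assert (Hz := zeta_ge1 n). rewrite <- (Rpower_1 (zeta n)) at 1 by lra. rewrite <- Rpower_Ropp.
  apply Rpower_exp_mono; lra.
Qed.

Lemma zeta_pow_anti m n a : (m <= n)%nat -> 0 <= a -> Rpower (zeta n) (- a) <= Rpower (zeta m) (- a).
Proof.
  intros H Ha. apply Rpower_anti; auto; [|apply zeta_mono; auto]. assert (HH := zeta_ge1 m); lra.
Qed.

Lemma sum_zeta_pow a m n : 0 < a -> (m <= n)%nat ->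
  bsum (fun k => eT (S k) * Rpower (zeta k) (- 1 - a)) n - bsum (fun k => eT (S k) * Rpower (zeta k) (- 1 - a)) m
    <= (2 + a) / a * Rpower (zeta m) (- a).
Proof.
  intros Ha Hmn. apply (bsum_counter zeta (fun k => eT (S k))); auto.
  - intros; apply zeta_ge1.
  - intros; split; [apply eT_01|apply zeta_S].
Qed.

(* Summation by parts with the potential [Li / zeta]. *)
Lemma uv_tail : exists K, 0 <= K /\ forall i, interior d i -> forall m n, (m <= n)%nat ->
  uv i n - uv i m <= K * Rpower (zeta m) (- (1 / 3)).
Proof.
  destruct Li_two_thirds as (C & HC & HL'). destruct zeta_le_Z as (K & HK & HZ).
  exists (K * (C + C * 7) + K). split; [nra|]. intros i Hi m n Hmn.
  set (f := fun k => eT (S k) * Rpower (zeta k) (- 1 - 1 / 3)).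
  assert (Hinv : forall k, / Zi i k <= K * / zeta k).
  { intros k. specialize (HZ i Hi k). assert (H1 := Zi_ge1 i k Hi). assert (Hz := zeta_ge1 k).
    apply (Rmult_le_reg_r (Zi i k)); [lra|]. rewrite Rinv_l by lra.
    apply (Rmult_le_reg_r (zeta k)); [lra|]. replace (K * / zeta k * Zi i k * zeta k) with (K * Zi i k) by (field; lra). lra. }
  assert (HeL : forall k, eL i k = 1 -> Wt k = Zi i k).
  { intros k E. unfold Wt, eL in *. destruct (x k) as [|j l]; [lra|]. destruct (Nat.eqb_spec j i); [subst; auto|lra]. }
  (* At a visit to a leaf of [i] the potential rises by [K / zeta >= 1 / Zi]; at an interior visit
     it falls by at most [K C zeta^(-4/3)]. *)
  assert (Hstep : forall k, eL i (S k) / Wt (S k) <= K * (Li i (S k) / zeta (S k)) - K * (Li i k / zeta k) + K * C * f k).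
  { intros k. unfold f. rewrite Li_S, zeta_S. assert (Hz := zeta_ge1 k). assert (HLk := Li_nonneg i k Hi).
    assert (Hiz : 0 < / zeta k) by (apply Rinv_0_lt_compat; lra).
    destruct (x_cases (S k)) as [(j & Hj & E & ET & E1 & E0 & EL)|(j & l & Hj & Hk & E & ET & E0 & EL & EL0)].
    - rewrite EL, ET, Rplus_0_r. specialize (HL' i Hi k).
      assert (H1 : Li i k / zeta k - Li i k / (zeta k + 1) <= Li i k * (/ zeta k * / zeta k)).
      { apply Rle_trans with (Li i k * (/ zeta k * / (zeta k + 1))); [right; field; lra|].
        apply Rmult_le_compat_l; auto. apply Rmult_le_compat_l; [lra|]. apply Rinv_le_contravar; lra. }
      assert (H2 : Li i k * (/ zeta k * / zeta k) <= C * Rpower (zeta k) (2 / 3) * (/ zeta k * / zeta k)).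
      { apply Rmult_le_compat_r; nra. }
      replace (C * Rpower (zeta k) (2 / 3) * (/ zeta k * / zeta k)) with (C * Rpower (zeta k) (- 1 - 1 / 3)) in H2.
      + unfold Rdiv in *. assert (K * (Li i k * / zeta k - Li i k * / (zeta k + 1)) <= K * (C * Rpower (zeta k) (- 1 - 1 * / 3))) by (apply Rmult_le_compat_l; lra). lra.
      + rewrite Rmult_assoc. f_equal. replace (- 1 - 1 / 3) with (2 / 3 + (- (1) + - (1))) by field.
        rewrite !Rpower_plus, !Rpower_Ropp, !Rpower_1 by lra. ring.
    - rewrite ET, Rplus_0_r. destruct (Nat.eq_dec i j) as [<-|Hne].
      + rewrite (HeL (S k) EL), EL, Zi_S, E0, Rplus_0_r. specialize (Hinv k). unfold Rdiv. lra.
      + rewrite EL0 by auto. unfold Rdiv. lra. }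
  assert (Hs : uv i (S n) - uv i (S m) <=
    (fun k => K * (Li i k / zeta k) + K * C * bsum f k) n - (fun k => K * (Li i k / zeta k) + K * C * bsum f k) m).
  { unfold uv. rewrite !bsum_shift.
    assert (H1 := bsum_telescope_le (fun k => eL i (S k) / Wt (S k)) (fun k => K * (Li i k / zeta k) + K * C * bsum f k) m n Hmn).
    assert (H2 : forall k, (m <= k < n)%nat -> eL i (S k) / Wt (S k) <= K * (Li i (S k) / zeta (S k)) + K * C * bsum f (S k) - (K * (Li i k / zeta k) + K * C * bsum f k)).
    { intros k _. simpl bsum. specialize (Hstep k). lra. }
    specialize (H1 H2). lra. }
  assert (H1 : uv i n <= uv i (S n)) by (apply bsum_incr; [lia|intros; apply uv_term_nonneg]).
  assert (H2 : uv i (S m) - uv i m <= K * Rpower (zeta m) (- (1 / 3))).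
  { unfold uv. simpl. assert (HH := Rinv_zeta_le m). assert (Hp := Rpower_pos (zeta m) (- (1 / 3))).
    destruct (eL_01 i m) as [E|E]; rewrite E.
    - unfold Rdiv. nra.
    - rewrite (HeL m E). specialize (Hinv m). unfold Rdiv in *. nra. }
  assert (H3 := sum_zeta_pow (1/3) m n ltac:(lra) Hmn). fold f in H3.
  assert (HG : forall k, Li i k / zeta k <= C * Rpower (zeta k) (- (1 / 3))).
  { intros k. assert (Hz := zeta_ge1 k). apply Rle_trans with (C * Rpower (zeta k) (2 / 3) * / zeta k).
    - apply Rmult_le_compat_r; auto. left; apply Rinv_0_lt_compat; lra.
    - right. rewrite Rmult_assoc. f_equal. replace (- (1 / 3)) with (2 / 3 + - (1)) by field.
      rewrite Rpower_plus, (Rpower_Ropp _ 1), Rpower_1 by lra. auto. }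
  assert (HGn := HG n). assert (Hanti := zeta_pow_anti m n (1/3) Hmn ltac:(lra)).
  assert (HGm : 0 <= Li i m / zeta m) by (apply Rdiv_nonneg; [apply Li_nonneg; auto|apply zeta_ge1]).
  set (P := Rpower (zeta m) (- (1 / 3))) in *. assert (HP : 0 < P) by apply Rpower_pos.
  replace ((2 + 1 / 3) / (1 / 3)) with 7 in H3 by field.
  assert (H4 : C * Rpower (zeta n) (- (1 / 3)) <= C * P) by (apply Rmult_le_compat_l; auto).
  assert (H5 : K * (Li i n / zeta n) <= K * (C * P)) by (apply Rmult_le_compat_l; lra).
  assert (H6 : K * C * (bsum f n - bsum f m) <= K * C * (7 * P)) by (apply Rmult_le_compat_l; nra).
  assert (0 <= K * (Li i m / zeta m)) by nra.
  lra.
Qed.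

(** What is left of [ln (Zi / Bi)] once its drift is removed: [ln Zi] is about [Yv - yv i], and
    [ln Bi] about the sum of [1/Bi] over interior visits other than those to [i]. [Yv] cancels in
    differences between vertices. *)
Definition drift_error (i n : nat) : R :=
  ln (Zi i n) - ln (Bi i n) + bsum (fun k => eT (S k) / Bi i k) n - Yv n.

(** Up to boundary terms, each step adds a nonnegative amount of order at most [zeta^(-4/3)]: the
    second-order term of [ln Bi] at a visit to another interior vertex, and [1/Bi - 1/(Bi + Li)] at
    a visit to [i]. *)
Lemma yB_tail : exists K, 0 <= K /\ forall i, interior d i -> forall m n, (m <= n)%nat ->
  Rabs ((bsum (fun k => eT (S k) / Bi i k) n - ln (Bi i n) - yv i n) -
        (bsum (fun k => eT (S k) / Bi i k) m - ln (Bi i m) - yv i m)) <= K * Rpower (zeta m) (- (1 / 3)).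
Proof.
  destruct Li_two_thirds as (C & HC & HL'). destruct zeta_le_B as (K & HK & HB).
  exists (K * K * (1 + C) * 7 + K + K). split; [nra|]. intros i Hi m n Hmn.
  set (f := fun k => eT (S k) * Rpower (zeta k) (- 1 - 1 / 3)).
  set (q := fun k => bsum (fun k => eT (S k) / Bi i k) k - ln (Bi i k) - bsum (fun k => eI i (S k) / Wt (S k)) k).
  assert (Hstep : forall k, 0 <= q (S k) - q k <= K * K * (1 + C) * f k).
  { intros k. unfold q, f. simpl bsum. rewrite Bi_S.
    assert (Hz := zeta_ge1 k). assert (HLk := Li_nonneg i k Hi). assert (HBk := Bi_ge1 i k Hi).
    assert (Hiz : 0 < / zeta k) by (apply Rinv_0_lt_compat; lra).
    assert (Hb := Binv_le K i k HB Hi). assert (Hib : 0 < / Bi i k) by (apply Rinv_0_lt_compat; lra).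
    assert (H2 : / Bi i k * / Bi i k <= K * K * (/ zeta k * / zeta k)).
    { apply Rle_trans with ((K * / zeta k) * (K * / zeta k)); [apply Rmult_le_compat; lra|right; ring]. }
    assert (HPz : / zeta k * / zeta k <= Rpower (zeta k) (- 1 - 1 / 3)) by (apply Rpower_zeta_ge; lra).
    set (P := Rpower (zeta k) (- 1 - 1 / 3)) in *. assert (HP : 0 < P) by apply Rpower_pos.
    assert (H3 : / Bi i k * / Bi i k <= K * K * P).
    { eapply Rle_trans; [apply H2|]. apply Rmult_le_compat_l; nra. }
    assert (H4 : Li i k * (/ Bi i k * / Bi i k) <= K * K * C * P).
    { apply Rle_trans with (C * Rpower (zeta k) (2 / 3) * (K * K * (/ zeta k * / zeta k))).
      - apply Rmult_le_compat; nra || apply HL'; auto.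
      - right. unfold P. replace (- 1 - 1 / 3) with (2 / 3 + (- (1) + - (1))) by field.
        rewrite !Rpower_plus, !Rpower_Ropp, !Rpower_1 by lra. ring. }
    assert (Hpos : 0 <= K * K * P /\ 0 <= K * K * C * P) by (split; repeat apply Rmult_le_pos; lra).
    destruct (x_cases (S k)) as [(j & Hj & E & ET & E1 & E0 & EL)|(j & l & Hj & Hk & E & ET & E0 & EL & EL0)].
    - rewrite ET. destruct (Nat.eq_dec i j) as [<-|Hne].
      + destruct (Wt_Int i (S k) E1) as [-> _]. rewrite Bi_S, Li_S, ET, E1, EL.
        replace (Bi i k + (1 - 1)) with (Bi i k) by ring. rewrite Rplus_0_r.
        assert (HH : 1 / Bi i k - 1 / (Bi i k + Li i k) = Li i k * (/ Bi i k * / (Bi i k + Li i k))) by (field; lra).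
        assert (0 < / (Bi i k + Li i k) <= / Bi i k) by (split; [apply Rinv_0_lt_compat|apply Rinv_le_contravar]; lra).
        assert (0 <= Li i k * (/ Bi i k * / (Bi i k + Li i k)) <= Li i k * (/ Bi i k * / Bi i k)).
        { split; [repeat apply Rmult_le_pos; lra|]. apply Rmult_le_compat_l; auto. apply Rmult_le_compat_l; lra. }
        lra.
      + rewrite E0 by auto. replace (Bi i k + (1 - 0)) with (Bi i k + 1) by ring.
        assert (Hl := ln_step_le (Bi i k) ltac:(lra)). assert (Hl2 := ln_step_ge2 (Bi i k) ltac:(lra)).
        rewrite Rinv_mult in Hl2. unfold Rdiv. rewrite !Rmult_1_l. lra.
    - rewrite ET, E0. replace (Bi i k + (0 - 0)) with (Bi i k) by ring. unfold Rdiv. lra. }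
  assert (Hq : 0 <= q n - q m <= K * K * (1 + C) * (7 * Rpower (zeta m) (- (1 / 3)))).
  { split.
    - assert (q m <= q n); [|lra]. apply incr_le; auto. intros k _. specialize (Hstep k). lra.
    - assert (H3 := sum_zeta_pow (1/3) m n ltac:(lra) Hmn). fold f in H3.
      replace ((2 + 1 / 3) / (1 / 3)) with 7 in H3 by field.
      apply Rle_trans with (K * K * (1 + C) * (bsum f n - bsum f m)); [|apply Rmult_le_compat_l; nra].
      clear H3. induction Hmn as [|n Hmn IH]; [rewrite !Rminus_diag; lra|]. simpl bsum. specialize (Hstep n). lra. }
  (* [yv i k] stops before time [k] while the other sums include it; the shift leaves one boundary
     term at [m] and one at [n], the two [K] in the constant. *)
  assert (Hy : forall k, yv i k = eI i 0 / Wt 0 + bsum (fun k => eI i (S k) / Wt (S k)) k - eI i k / Wt k).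
  { intros k. assert (H1 : yv i (S k) = yv i k + eI i k / Wt k) by reflexivity.
    unfold yv in H1 at 1. rewrite bsum_shift in H1. lra. }
  assert (He : forall k, 0 <= eI i k / Wt k <= K * Rpower (zeta k) (- (1 / 3))).
  { intros k. split; [apply yv_term_nonneg|]. assert (Hp := Rpower_pos (zeta k) (- (1 / 3))).
    destruct (eI_01 i k) as [E|E]; rewrite E; [unfold Rdiv; nra|].
    destruct (Wt_Int i k E) as [-> _]. assert (Hb := Binv_le K i k HB Hi). assert (HBk := Bi_ge1 i k Hi).
    assert (HLk := Li_nonneg i k Hi). assert (Hz := Rinv_zeta_le k).
    unfold Rdiv. rewrite Rmult_1_l. assert (/ (Bi i k + Li i k) <= / Bi i k) by (apply Rinv_le_contravar; lra). nra. }
  assert (Hen := He n). assert (Hem := He m). assert (Hanti := zeta_pow_anti m n (1/3) Hmn ltac:(lra)).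
  rewrite !Hy. unfold q in Hq. set (P := Rpower (zeta m) (- (1 / 3))) in *.
  assert (K * Rpower (zeta n) (- (1 / 3)) <= K * P) by (apply Rmult_le_compat_l; lra).
  apply Rabs_le. lra.
Qed.

(** Sum of three tails: the martingale, the leaf visits [uv], and the exchange of [1/Wt] for [1/Bi].
    [zeta_le_Z] converts powers of [Zi] into powers of [zeta]. *)
Lemma drift_error_tail : exists K, 0 <= K /\ forall i, interior d i -> forall m n, (m <= n)%nat ->
  Rabs (drift_error i n - drift_error i m) <= K * Rpower (zeta m) (- (1 / 3)).
Proof.
  destruct uv_tail as (K1 & HK1 & Hu). destruct yB_tail as (K2 & HK2 & Hy). destruct zeta_le_Z as (K & HK & HZ).
  destruct (uniform_bound (seq 1 d) (fun i C => forall m n, (m <= n)%nat ->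
    Rabs (ln (Zi i n) - ln (Zi i m) - ((Yv n - yv i n + uv i n) - (Yv m - yv i m + uv i m))) <= C * Rpower (zeta m) (- (1 / 3))))
    as (C & HC & H).
  { intros i C C' HCC H m n Hmn. eapply Rle_trans; [apply H; auto|]. apply Rmult_le_compat_r; auto. left; apply Rpower_pos. }
  { intros i Hi. apply in_seq_interior in Hi. destruct (ln_Zi_growth i Hi) as (C & HC). exists (Rmax C 0 * Rpower K (1 / 3)).
    intros m n Hmn. eapply Rle_trans; [apply HC; auto|].
    assert (Hp := Rpower_pos (Zi i m) (- (1 / 3))). rewrite Rmult_assoc.
    apply Rle_trans with (Rmax C 0 * Rpower (Zi i m) (- (1 / 3))).
    - apply Rmult_le_compat_r; [lra|apply Rmax_l].
    - apply Rmult_le_compat_l; [apply Rmax_r|].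
      assert (Hz := zeta_ge1 m). assert (HZ1 := Zi_ge1 i m Hi). specialize (HZ i Hi m).
      rewrite !Rpower_Ropp. apply (Rmult_le_reg_r (Rpower (Zi i m) (1/3))); [apply Rpower_pos|].
      rewrite Rinv_l by (apply Rgt_not_eq, Rpower_pos).
      apply (Rmult_le_reg_r (Rpower (zeta m) (1/3))); [apply Rpower_pos|].
      replace (Rpower K (1 / 3) * / Rpower (zeta m) (1 / 3) * Rpower (Zi i m) (1 / 3) * Rpower (zeta m) (1 / 3))
        with (Rpower K (1 / 3) * Rpower (Zi i m) (1 / 3)) by (field; apply Rgt_not_eq, Rpower_pos).
      rewrite Rpower_mult_distr, Rmult_1_l by lra. apply Rpower_mono_l; lra. }
  exists (C + K1 + K2). split; [lra|]. intros i Hi m n Hmn.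
  specialize (H i ltac:(apply in_seq_interior; auto) m n Hmn). specialize (Hu i Hi m n Hmn). specialize (Hy i Hi m n Hmn).
  assert (Hum : uv i m <= uv i n) by (apply bsum_incr; auto; intros; apply uv_term_nonneg).
  apply Rabs_le_inv in H, Hy. unfold drift_error. apply Rabs_le. lra.
Qed.

(** * Contraction of the log-ratios and rates of convergence *)

(** The [exp f_i] of the overview. Since [1/Bi = (1 + ai)/zeta], differences of the [1/Bi] are
    differences of the [ai] over [zeta]. *)
Definition ai (i n : nat) : R := Zi i n / Bi i n.

Lemma ai_pos i n : interior d i -> 0 < ai i n.
Proof.
  intros Hi. assert (H1 := Zi_ge1 i n Hi). assert (H2 := Bi_ge1 i n Hi). apply Rdiv_lt_0_compat; lra.
Qed.

Lemma Binv_ai i n : interior d i -> / Bi i n = (1 + ai i n) * / zeta n.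
Proof.
  intros Hi. assert (H2 := Bi_ge1 i n Hi). assert (Hz := zeta_ge1 n). unfold ai.
  replace (Zi i n) with (zeta n - Bi i n) by (unfold Bi; ring). field; lra.
Qed.

Lemma ln_ai i n : interior d i -> ln (ai i n) = ln (Zi i n) - ln (Bi i n).
Proof.
  intros Hi. assert (H1 := Zi_ge1 i n Hi). assert (H2 := Bi_ge1 i n Hi). apply ln_div; lra.
Qed.

(* [rho] is the deficit of the contraction rate with respect to [theta]; it only has to be summable. *)
Lemma log_ratio_rate theta rho Rb n0 : 0 < theta -> theta < 1 / 3 -> (forall k, 0 <= rho k) ->
  (forall n, bsum (fun k => eT (S k) * (rho k / zeta k)) n <= Rb) ->
  (forall i, interior d i -> forall n, (n0 <= n)%nat -> theta - rho n <= ai i n) ->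
  forall i j, interior d i -> interior d j -> exists C, 0 <= C /\ forall n,
    Rabs (ln (ai i n) - ln (ai j n)) <= C * Rpower (zeta n) (- theta).
Proof.
  intros Ht0 Ht Hrho HR Hai i j Hi Hj.
  destruct drift_error_tail as (M0 & HM0 & HF). destruct zeta_le_B as (K & HK & HB).
  set (M := 2 * M0).
  destruct (cauchy_limit (fun n => drift_error i n - drift_error j n) (fun n => M * Rpower (zeta n) (- (1 / 3)))) as (l & Hl).
  { intros m n Hmn. assert (H1 := HF i Hi m n Hmn). assert (H2 := HF j Hj m n Hmn).
    replace (drift_error i n - drift_error j n - (drift_error i m - drift_error j m)) with ((drift_error i n - drift_error i m) - (drift_error j n - drift_error j m)) by ring.
    eapply Rle_trans; [apply Rabs_triang|]. rewrite Rabs_Ropp. unfold M. lra. }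
  { intros eps He. destruct (Rpower_inv_small (1/3) (eps / (M + 1))) as (A & HA); [lra|apply Rdiv_lt_0_compat; unfold M; lra|].
    destruct (zeta_large A) as (m & Hm). exists m. specialize (HA (zeta m) (Hm m (le_n _))).
    assert (Hp := Rpower_pos (zeta m) (- (1 / 3))).
    apply Rlt_le_trans with ((M + 1) * (eps / (M + 1))); [|right; field; unfold M; lra].
    apply Rle_lt_trans with ((M + 1) * Rpower (zeta m) (- (1 / 3))); [nra|].
    apply Rmult_lt_compat_l; auto. unfold M; lra. }
  (* [e] is at most [M zeta^(-1/3)] in absolute value; subtracting it makes the recursion for [w]
     exact. *)
  set (e := fun n => drift_error i n - drift_error j n - l).
  set (w := fun n => ln (ai i n) - ln (ai j n) - e n).
  assert (Hw : forall n, w (S n) = w n - eT (S n) * (/ Bi i n - / Bi j n)).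
  { intros n. unfold w, e, drift_error. simpl bsum. rewrite !ln_ai by auto. unfold Rdiv. ring. }
  (* The logarithmic mean linearises [ai i - ai j] into [kap (w + e)]. *)
  assert (Hk : forall n, exists kap, 0 <= kap <= K /\ ((n0 <= n)%nat -> theta - rho n <= kap) /\
     / Bi i n - / Bi j n = kap / zeta n * (w n + e n)).
  { intros n. destruct (log_mean (ai i n) (ai j n) (ai_pos i n Hi) (ai_pos j n Hj)) as (kap & H1 & H2 & H3).
    exists kap. assert (Hpi := ai_pos i n Hi). assert (Hpj := ai_pos j n Hj).
    assert (HaK : forall m, interior d m -> ai m n <= K).
    { intros m Hm. specialize (HB m Hm n). assert (H5 := Bi_ge1 m n Hm). unfold ai.
      apply (Rmult_le_reg_r (Bi m n)); [lra|]. unfold Rdiv. rewrite Rmult_assoc, Rinv_l by lra.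
      assert (H6 := Zi_le_zeta m n Hm). lra. }
    split; [split; [apply H1; lra|apply H2; auto]|]. split.
    - intros Hn. apply H1; apply Hai; auto.
    - rewrite !Binv_ai by auto. unfold w, e. replace (ln (ai i n) - ln (ai j n) - (drift_error i n - drift_error j n - l) + (drift_error i n - drift_error j n - l)) with (ln (ai i n) - ln (ai j n)) by ring.
      unfold Rdiv. replace (kap * / zeta n * (ln (ai i n) - ln (ai j n))) with (kap * (ln (ai i n) - ln (ai j n)) * / zeta n) by ring.
      rewrite <- H3. ring. }
  (* From [n1] on, [kap / zeta <= 1], so the contraction factor [1 - kap / zeta] is nonnegative. *)
  destruct (zeta_large K) as (n1 & Hn1).
  set (N := Nat.max n0 n1).
  (* The factor [zeta^theta] grows by at most [exp (theta / zeta)] per interior visit and the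
     contraction is at most [exp (-(theta - rho) / zeta)], so only [rho / zeta] remains, in [b]. The
     error [e] goes into [c], summable because [theta < 1/3]; its 2 bounds
     [((zeta + 1)/zeta)^theta]. *)
  set (A := fun n => Rpower (zeta n) theta * Rabs (w n)).
  set (b := fun n => eT (S n) * (rho n / zeta n)).
  set (c := fun n => 2 * K * M * (eT (S n) * Rpower (zeta n) (- 1 - (1 / 3 - theta)))).
  assert (HT : forall k, 0 <= eT k) by (intros k; destruct (eT_01 k); lra).
  assert (HM : 0 <= M) by (unfold M; lra).
  assert (HKM : 0 <= 2 * K * M) by nra.
  assert (Hstep : forall n, (N <= n)%nat -> A (S n) <= A n * exp (b n) + c n).
  { intros n Hn. unfold A, b, c. rewrite Hw, zeta_S. destruct (Hk n) as (kap & [Hk0 HkK] & Hkt & HE).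
    specialize (Hkt ltac:(lia)). specialize (Hn1 n ltac:(lia)).
    assert (Hz := zeta_ge1 n). assert (Hiz : 0 < / zeta n) by (apply Rinv_0_lt_compat; lra).
    destruct (eT_01 (S n)) as [E|E]; rewrite E.
    - rewrite Rplus_0_r, !Rmult_0_l, Rminus_0_r, exp_0. lra.
    - rewrite HE, !Rmult_1_l. specialize (Hl n). fold (e n) in Hl.
      assert (Hq : 0 <= kap / zeta n <= 1).
      { split; [apply Rmult_le_pos; lra|]. apply (Rmult_le_reg_r (zeta n)); [lra|].
        unfold Rdiv. rewrite Rmult_assoc, Rinv_l; lra. }
      assert (H1 : Rabs (w n - kap / zeta n * (w n + e n)) <= Rabs (w n) * (1 - kap / zeta n) + kap / zeta n * Rabs (e n)).
      { replace (w n - kap / zeta n * (w n + e n)) with (w n * (1 - kap / zeta n) + - (kap / zeta n * e n)) by ring.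
        eapply Rle_trans; [apply Rabs_triang|]. rewrite Rabs_Ropp, !Rabs_mult.
        rewrite (Rabs_right (1 - kap / zeta n)), (Rabs_right (kap / zeta n)) by lra. lra. }
      assert (Hp1 := Rpower_pos (zeta n + 1) theta). assert (Hp := Rpower_pos (zeta n) theta).
      apply Rle_trans with (Rpower (zeta n + 1) theta * (Rabs (w n) * (1 - kap / zeta n) + kap / zeta n * Rabs (e n))).
      { apply Rmult_le_compat_l; lra. }
      rewrite Rmult_plus_distr_l. apply Rplus_le_compat.
      + assert (H2 : Rpower (zeta n + 1) theta * (1 - kap / zeta n) <= Rpower (zeta n) theta * exp (rho n / zeta n)).
        { apply Rle_trans with (Rpower (zeta n + 1) theta * exp (- (kap / zeta n))).
          - apply Rmult_le_compat_l; [lra|]. eapply Rle_trans; [|apply exp_ineq1_le]. lra.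
          - unfold Rpower. rewrite <- !exp_plus. apply exp_mono.
            assert (Hl1 := ln_step_le (zeta n) ltac:(lra)).
            assert (theta * (ln (zeta n + 1) - ln (zeta n)) <= theta * / zeta n) by (apply Rmult_le_compat_l; lra).
            assert ((theta - rho n) * / zeta n <= kap * / zeta n) by (apply Rmult_le_compat_r; lra).
            unfold Rdiv. lra. }
        assert (H3 := Rmult_le_compat_r (Rabs (w n)) _ _ (Rabs_pos (w n)) H2). lra.
      + assert (H2 : Rpower (zeta n + 1) theta <= 2 * Rpower (zeta n) theta).
        { apply Rle_trans with (Rpower (2 * zeta n) theta); [apply Rpower_mono_l; lra|].
          rewrite <- Rpower_mult_distr by lra. apply Rmult_le_compat_r; [lra|].
          rewrite <- (Rpower_1 2) at 2 by lra. apply Rpower_exp_mono; lra. }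
        assert (H3 : kap / zeta n * Rabs (e n) <= K * / zeta n * (M * Rpower (zeta n) (- (1 / 3)))).
        { apply Rmult_le_compat; auto using Rabs_pos; try lra. apply Rmult_le_compat_r; lra. }
        apply Rle_trans with (2 * Rpower (zeta n) theta * (K * / zeta n * (M * Rpower (zeta n) (- (1 / 3))))).
        { apply Rmult_le_compat; auto; try lra. apply Rmult_le_pos; [lra|apply Rabs_pos]. }
        right. replace (- 1 - (1 / 3 - theta)) with (theta + (- (1) + - (1 / 3))) by field.
        rewrite !Rpower_plus, (Rpower_Ropp _ 1), Rpower_1 by lra. ring. }
  assert (HG := discrete_gronwall A b c N Rb).
  assert (HA : forall n, (N <= n)%nat -> A n <= exp Rb * (A N + bsum c n)).
  { apply HG; auto.
    - intros k. apply Rmult_le_pos; auto. apply Rdiv_nonneg; auto. apply zeta_ge1.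
    - intros k. unfold c. apply Rmult_le_pos; auto. apply Rmult_le_pos; auto. left; apply Rpower_pos.
    - intros k. unfold A. apply Rmult_le_pos; [left; apply Rpower_pos|apply Rabs_pos]. }
  set (a := 1 / 3 - theta) in *.
  assert (Hc : forall n, bsum c n <= 2 * K * M * ((2 + a) / a)).
  { intros n. unfold c. rewrite bsum_scal. apply Rmult_le_compat_l; auto.
    assert (H1 := sum_zeta_pow a 0 n ltac:(unfold a; lra) ltac:(lia)). simpl bsum in H1.
    assert (H3 := Rpower_le_1 (zeta 0) a (zeta_ge1 0) ltac:(unfold a; lra)).
    assert (H4 : (2 + a) / a * Rpower (zeta 0) (- a) <= (2 + a) / a * 1).
    { apply Rmult_le_compat_l; auto. left; apply Rdiv_lt_0_compat; unfold a; lra. } lra. }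
  apply (extend_bound _ (fun n => Rpower (zeta n) (- theta)) N (exp Rb * (A N + 2 * K * M * ((2 + a) / a)) + M)).
  { intros; apply Rpower_pos. }
  intros n Hn. specialize (HA n Hn). specialize (Hc n). specialize (Hl n). fold (e n) in Hl.
  assert (Hx : ln (ai i n) - ln (ai j n) = w n + e n) by (unfold w; ring). rewrite Hx.
  eapply Rle_trans; [apply Rabs_triang|]. rewrite Rmult_plus_distr_r. apply Rplus_le_compat.
  - assert (Hp := Rpower_pos (zeta n) (- theta)). 
    apply Rle_trans with (A n * Rpower (zeta n) (- theta)).
    + right. unfold A. rewrite Rpower_Ropp. field. apply Rgt_not_eq, Rpower_pos.
    + apply Rmult_le_compat_r; [lra|]. eapply Rle_trans; [apply HA|]. apply Rmult_le_compat_l; [left; apply exp_pos|lra].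
  - eapply Rle_trans; [apply Hl|]. apply Rmult_le_compat_l; auto. apply Rpower_exp_mono; [apply zeta_ge1|lra].
Qed.

(** If [Zi a > Zi b] then [Bi a < Bi b], so the log-ratios differ by at least
    [ln (Zi a / Zi b) >= 1 - Zi b / Zi a], which is at least the difference of the gaps. As the gaps
    sum to zero, each is the mean of its differences with all of them. *)
Lemma gap_rate theta : 
  (forall i j, interior d i -> interior d j -> exists C, 0 <= C /\ forall n,
    Rabs (ln (ai i n) - ln (ai j n)) <= C * Rpower (zeta n) (- theta)) ->
  exists C, 0 <= C /\ forall i, interior d i -> forall n, Rabs (gap i n) <= C * Rpower (zeta n) (- theta).
Proof.
  intros H.
  destruct (uniform_bound (seq 1 d) (fun i C => forall j, interior d j -> forall n,
    Rabs (ln (ai i n) - ln (ai j n)) <= C * Rpower (zeta n) (- theta))) as (C & HC & HU).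
  { intros i C C' HCC HH j Hj n. eapply Rle_trans; [apply HH; auto|]. apply Rmult_le_compat_r; auto. left; apply Rpower_pos. }
  { intros i Hi. apply in_seq_interior in Hi.
    destruct (uniform_bound (seq 1 d) (fun j C => forall n,
      Rabs (ln (ai i n) - ln (ai j n)) <= C * Rpower (zeta n) (- theta))) as (C & HC & HU).
    - intros j C C' HCC HH n. eapply Rle_trans; [apply HH; auto|]. apply Rmult_le_compat_r; auto. left; apply Rpower_pos.
    - intros j Hj. apply in_seq_interior in Hj. destruct (H i j Hi Hj) as (C & _ & HC). eauto.
    - exists C. intros j Hj. apply HU, in_seq_interior; auto. }
  exists C. split; auto. intros i Hi n.
  assert (HD := INR_d_ge3). assert (Hz := zeta_ge1 n).
  assert (Hone : forall a b, interior d a -> interior d b -> gap a n - gap b n <= Rabs (ln (ai a n) - ln (ai b n))).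
  { intros a b Ha Hb.
    destruct (Rle_lt_dec (gap a n) (gap b n)) as [Hle|Hlt]; [assert (Hp := Rabs_pos (ln (ai a n) - ln (ai b n))); lra|].
    eapply Rle_trans; [|apply Rle_abs]. rewrite !ln_ai by auto.
    assert (HZa := Zi_ge1 a n Ha). assert (HZb := Zi_ge1 b n Hb). assert (HBa := Bi_ge1 a n Ha).
    assert (HZb' := Zi_le_zeta b n Hb). assert (HZa' := Zi_le_zeta a n Ha).
    assert (Hg : gap a n - gap b n = (Zi a n - Zi b n) / zeta n) by (unfold gap; field; lra).
    assert (HZ : Zi b n < Zi a n).
    { apply Rnot_le_lt. intros Hle. assert ((Zi a n - Zi b n) / zeta n <= 0); [|lra].
      assert (0 < / zeta n) by (apply Rinv_0_lt_compat; lra). unfold Rdiv. nra. }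
    assert (HlB : ln (Bi a n) <= ln (Bi b n)) by (apply ln_mono; unfold Bi in *; lra).
    assert (HlZ : 1 - Zi b n / Zi a n <= ln (Zi a n) - ln (Zi b n)).
    { rewrite <- ln_div by lra. replace (Zi b n / Zi a n) with (/ (Zi a n / Zi b n)) by (field; lra).
      apply ln_ge_inv. apply Rdiv_lt_0_compat; lra. }
    assert ((Zi a n - Zi b n) / zeta n <= (Zi a n - Zi b n) / Zi a n).
    { apply Rmult_le_compat_l; [lra|]. apply Rinv_le_contravar; lra. }
    replace ((Zi a n - Zi b n) / Zi a n) with (1 - Zi b n / Zi a n) in H0 by (field; lra). lra. }
  set (P := Rpower (zeta n) (- theta)) in *.
  assert (Hsum : sI (fun j => gap i n - gap j n) = INR d * gap i n).
  { unfold sI. rewrite sumR_minus. fold (sI (fun j => gap j n)). fold (sI (fun _ => gap i n)).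
    rewrite sI_gap, sI_const. ring. }
  assert (Hu : sI (fun j => gap i n - gap j n) <= sI (fun _ => C * P)).
  { apply sI_le. intros j Hj. eapply Rle_trans; [apply Hone; auto|]. apply HU; auto. apply in_seq_interior; auto. }
  assert (Hlo : sI (fun _ => - (C * P)) <= sI (fun j => gap i n - gap j n)).
  { apply sI_le. intros j Hj. assert (H1 := Hone j i Hj Hi).
    assert (H2 : Rabs (ln (ai j n) - ln (ai i n)) <= C * P) by (apply HU; auto; apply in_seq_interior; auto). lra. }
  rewrite sI_const, Hsum in Hu, Hlo. apply Rabs_le.
  split; apply (Rmult_le_reg_l (INR d)); lra.
Qed.

Lemma ai_gap : exists K, 0 < K /\ forall i, interior d i -> forall n,
  Rabs (ai i n - / (INR d - 1)) <= K * Rabs (gap i n).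
Proof.
  destruct zeta_le_B as (K & HK & HB). exists (2 * K). split; [lra|]. intros i Hi n.
  specialize (HB i Hi n). assert (HBn := Bi_ge1 i n Hi). assert (Hz := zeta_ge1 n). assert (HD := INR_d_ge3).
  assert (E : ai i n - / (INR d - 1) = gap i n * (INR d / (INR d - 1) * (zeta n / Bi i n))).
  { unfold ai. assert (HZ := Zi_gap i n). assert (HBg := Bi_gap i n).
    assert (HZB : Zi i n = zeta n - Bi i n) by (unfold Bi; ring). rewrite HZB.
    assert (Hg : gap i n = 1 - / INR d - Bi i n / zeta n) by (rewrite HBg; field; lra).
    rewrite Hg. field. lra. }
  rewrite E, Rabs_mult, Rmult_comm. apply Rmult_le_compat_r; [apply Rabs_pos|].
  assert (H1 : 0 <= INR d / (INR d - 1) <= 2).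
  { split; [apply Rmult_le_pos; [lra|left; apply Rinv_0_lt_compat; lra]|].
    apply (Rmult_le_reg_r (INR d - 1)); [lra|]. unfold Rdiv. rewrite Rmult_assoc, Rinv_l; lra. }
  assert (H2 : 0 <= zeta n / Bi i n <= K).
  { split; [apply Rmult_le_pos; [lra|left; apply Rinv_0_lt_compat; lra]|].
    apply (Rmult_le_reg_r (Bi i n)); [lra|]. unfold Rdiv. rewrite Rmult_assoc, Rinv_l; lra. }
  rewrite Rabs_right by (apply Rle_ge, Rmult_le_pos; lra). apply Rmult_le_compat; lra.
Qed.

(** The [ai] tend to [1/(d-1) > theta], so the contraction rate is eventually at least [theta] and
    the deficit [rho = 0] serves. *)
Lemma gap_rate_lt theta : 0 < theta -> theta < 1 / 3 -> theta < / (INR d - 1) ->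
  exists C, 0 <= C /\ forall i, interior d i -> forall n, Rabs (gap i n) <= C * Rpower (zeta n) (- theta).
Proof.
  intros H0 H1 H2. apply gap_rate. destruct ai_gap as (K & HK & HA).
  destruct (gap_conv ((/ (INR d - 1) - theta) / K)) as (n0 & Hn0); [apply Rdiv_lt_0_compat; lra|].
  apply (log_ratio_rate theta (fun _ => 0) 0 n0); auto; try lra.
  - intros; lra.
  - intros n. induction n as [|n IH]; simpl; [lra|].
    assert (Hz : 0 / zeta n = 0) by (unfold Rdiv; ring). rewrite Hz. lra.
  - intros i Hi n Hn. specialize (HA i Hi n). specialize (Hn0 i Hi n Hn).
    assert (K * Rabs (gap i n) <= / (INR d - 1) - theta).
    { apply Rle_trans with (K * ((/ (INR d - 1) - theta) / K)); [apply Rmult_le_compat_l; lra|right; field].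
      assert (HD := INR_d_ge3). lra. }
    apply Rabs_le_inv in HA. lra.
Qed.

(** In the critical case [theta = 1/(d-1)] the contraction rate merely tends to [theta]. The rate
    already known for [theta / 2] bounds the deficit by a multiple of [zeta^(-theta/2)], summable
    against [1/zeta]; hence (b) loses no [delta]. *)
Lemma gap_rate_le theta : 0 < theta -> theta < 1 / 3 -> theta <= / (INR d - 1) ->
  exists C, 0 <= C /\ forall i, interior d i -> forall n, Rabs (gap i n) <= C * Rpower (zeta n) (- theta).
Proof.
  intros H0 H1 [H2|H2]; [apply gap_rate_lt; auto|].
  apply gap_rate. destruct ai_gap as (K & HK & HA).
  destruct (gap_rate_lt (theta / 2)) as (C & HC & HG); try lra.
  set (b := theta / 2) in *.
  apply (log_ratio_rate theta (fun n => K * (C * Rpower (zeta n) (- b))) (K * C * ((2 + b) / b)) 0); auto; try lra.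
  - intros k. apply Rmult_le_pos; [lra|]. apply Rmult_le_pos; [lra|left; apply Rpower_pos].
  - intros n. assert (H3 := sum_zeta_pow b 0 n ltac:(unfold b; lra) ltac:(lia)). simpl bsum in H3.
    assert (H4 := Rpower_le_1 (zeta 0) b (zeta_ge1 0) ltac:(unfold b; lra)).
    assert (H5 : (2 + b) / b * Rpower (zeta 0) (- b) <= (2 + b) / b * 1).
    { apply Rmult_le_compat_l; auto. left; apply Rdiv_lt_0_compat; unfold b; lra. }
    assert (H6 : forall n, bsum (fun k => eT (S k) * (K * (C * Rpower (zeta k) (- b)) / zeta k)) n =
       K * C * bsum (fun k => eT (S k) * Rpower (zeta k) (- 1 - b)) n).
    { intros m. rewrite <- bsum_scal. induction m as [|m IH]; simpl; auto. rewrite IH. f_equal.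
      replace (- 1 - b) with (- b + - (1)) by ring. assert (Hz := zeta_ge1 m).
      rewrite Rpower_plus, (Rpower_Ropp _ 1), Rpower_1 by lra. unfold Rdiv. ring. }
    rewrite H6. apply Rmult_le_compat_l; [apply Rmult_le_pos; lra|lra].
  - intros i Hi n _. specialize (HA i Hi n). specialize (HG i Hi n).
    assert (K * Rabs (gap i n) <= K * (C * Rpower (zeta n) (- b))) by (apply Rmult_le_compat_l; lra).
    apply Rabs_le_inv in HA. lra.
Qed.

(** Dividing by the time [tot] instead of [zeta] adds an error of the order of the fraction of leaf
    visits, at most [zeta^(-1/3)]. *)
Theorem path_upper theta : 0 < theta -> theta < 1 / 3 -> theta <= / (INR d - 1) ->
  exists C, 0 <= C /\ forall n,
    (forall i, interior d i -> Rabs (cnt n (Int i) / tot n - / INR d) <= C * Rpower (tot n) (- theta)) /\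
    (forall i k, interior d i -> (1 <= k <= r i)%nat -> cnt n (Leaf i k) / tot n <= C * Rpower (tot n) (- theta)).
Proof.
  intros H0 H1 H2. destruct (gap_rate_le theta H0 H1 H2) as (C & HC & HG).
  destruct Li_two_thirds as (C2 & HC2 & HL2). destruct tot_le_zeta as (K & HK & HT).
  assert (HD := INR_d_ge3).
  set (Kt := Rpower K theta). assert (HKt : 0 < Kt) by apply Rpower_pos.
  exists ((C + INR d * C2) * Kt). split; [apply Rmult_le_pos; [nra|lra]|]. intros n.
  assert (Hz := zeta_ge1 n). assert (Hzt := zeta_le_tot n). specialize (HT n).
  assert (HP : Rpower (zeta n) (- theta) <= Kt * Rpower (tot n) (- theta)).
  { rewrite !Rpower_Ropp. assert (Hp1 := Rpower_pos (zeta n) theta). assert (Hp2 := Rpower_pos (tot n) theta).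
    apply (Rmult_le_reg_r (Rpower (zeta n) theta)); auto. rewrite Rinv_l by lra.
    apply (Rmult_le_reg_r (Rpower (tot n) theta)); auto.
    replace (Kt * / Rpower (tot n) theta * Rpower (zeta n) theta * Rpower (tot n) theta) with (Kt * Rpower (zeta n) theta) by (field; lra).
    unfold Kt. rewrite Rpower_mult_distr, Rmult_1_l by lra. apply Rpower_mono_l; lra. }
  set (P := Rpower (zeta n) (- theta)) in *.
  assert (HL3 : forall i, interior d i -> Li i n / zeta n <= C2 * P).
  { intros i Hi. apply Rle_trans with (C2 * Rpower (zeta n) (2 / 3) * / zeta n).
    - apply Rmult_le_compat_r; [left; apply Rinv_0_lt_compat; lra|]. apply HL2; auto.
    - rewrite Rmult_assoc. apply Rmult_le_compat_l; auto.
      rewrite <- (Rpower_1 (zeta n)) at 2 by lra. rewrite <- Rpower_Ropp, <- Rpower_plus. apply Rpower_exp_mono; lra. }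
  assert (Hit : 0 < / tot n) by (apply Rinv_0_lt_compat; lra).
  assert (Hitz : / tot n <= / zeta n) by (apply Rinv_le_contravar; lra).
  assert (HCP : 0 <= C * P /\ 0 <= C2 * P) by (split; apply Rmult_le_pos; auto; left; apply Rpower_pos).
  assert (Hfin : (C + INR d * C2) * P <= (C + INR d * C2) * Kt * Rpower (tot n) (- theta)).
  { rewrite Rmult_assoc. apply Rmult_le_compat_l; auto. nra. }
  split.
  - intros i Hi. fold (Zi i n).
    apply Rle_trans with ((C + INR d * C2) * P); auto.
    replace (Zi i n / tot n - / INR d) with (gap i n - Zi i n / zeta n * ((tot n - zeta n) * / tot n)) by (unfold gap; field; lra).
    assert (H3 : (tot n - zeta n) * / tot n <= INR d * (C2 * P)).
    { apply Rle_trans with ((tot n - zeta n) * / zeta n); [apply Rmult_le_compat_l; lra|].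
      unfold tot. replace (zeta n + sI (fun i => Li i n) - zeta n) with (sI (fun i => Li i n)) by ring.
      rewrite <- sI_const, Rmult_comm. unfold sI at 1. rewrite <- sumR_scal. apply sI_le.
      intros j Hj. rewrite Rmult_comm. apply HL3; auto. }
    assert (H4 : 0 <= (tot n - zeta n) * / tot n) by (apply Rmult_le_pos; lra).
    assert (H5 : 0 <= Zi i n / zeta n <= 1).
    { assert (HZ1 := Zi_ge1 i n Hi). assert (HZ2 := Zi_le_zeta i n Hi).
      split; [apply Rdiv_nonneg; lra|]. apply (Rmult_le_reg_r (zeta n)); [lra|]. unfold Rdiv. rewrite Rmult_assoc, Rinv_l; lra. }
    specialize (HG i Hi n). fold P in HG. apply Rabs_le_inv in HG. apply Rabs_le.
    set (s := (tot n - zeta n) * / tot n) in *. set (p := Zi i n / zeta n) in *.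
    assert (0 <= p * s <= s) by nra. lra.
  - intros i k Hi Hk. apply Rle_trans with ((C + INR d * C2) * P); auto.
    apply Rle_trans with (Li i n / zeta n).
    + assert (Hl := Leaf_ge1 i k n Hi Hk). assert (Hl2 := Leaf_le_Li i k n Hi Hk).
      apply Rmult_le_compat; lra.
    + specialize (HL3 i Hi). assert (1 * (C2 * P) <= INR d * (C2 * P)) by (apply Rmult_le_compat_r; lra). lra.
Qed.

End Path.

(** * Probability *)

Section Prob.
Variables (Omega : Type) (F : (Omega -> Prop) -> Prop) (P : (Omega -> Prop) -> R).
Hypothesis HP : is_prob_space Omega F P.

(** * Elementary measure theory *)

(** [P] and [F] act on predicates, so equivalent descriptions of an event have to be made equal
    before they can be exchanged. *)
Lemma event_ext (A B : Omega -> Prop) : (forall w, A w <-> B w) -> A = B.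
Proof. intros H. apply functional_extensionality. intros w. apply propositional_extensionality, H. Qed.

Lemma F_true : F (fun _ => True).
Proof. apply HP. Qed.
Lemma F_not A : F A -> F (fun w => ~ A w).
Proof. apply HP. Qed.
Lemma F_ex (An : nat -> Omega -> Prop) : (forall n, F (An n)) -> F (fun w => exists n, An n w).
Proof. apply HP. Qed.
Lemma F_iff A B : F A -> (forall w, A w <-> B w) -> F B.
Proof. intros HA H. rewrite <- (event_ext A B); auto. Qed.
Lemma F_false : F (fun _ => False).
Proof. apply (F_iff _ _ (F_not _ F_true)). tauto. Qed.
Lemma F_all (An : nat -> Omega -> Prop) : (forall n, F (An n)) -> F (fun w => forall n, An n w).
Proof.
  intros H. apply (F_iff (fun w => ~ exists n, ~ An n w)).
  - apply F_not, (F_ex (fun n w => ~ An n w)). intros n. apply F_not, H.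
  - intros w. split.
    + intros H1 n. apply NNPP. intros H2. apply H1; eauto.
    + intros H1 (n & Hn). auto.
Qed.
Lemma F_or A B : F A -> F B -> F (fun w => A w \/ B w).
Proof.
  intros HA HB. apply (F_iff (fun w => exists n : nat, (match n with O => A | _ => B end) w)).
  - apply F_ex. intros [|n]; auto.
  - intros w. split; [intros ([|n] & Hn); auto|intros [H|H]; [exists 0%nat|exists 1%nat]; auto].
Qed.
Lemma F_and A B : F A -> F B -> F (fun w => A w /\ B w).
Proof.
  intros HA HB. apply (F_iff (fun w => ~ (~ A w \/ ~ B w))).
  - apply F_not, F_or; apply F_not; auto.
  - intros w. split; [intros H; split; apply NNPP; tauto|tauto].
Qed.
Lemma F_const (Q : Prop) : F (fun _ => Q).
Proof.
  destruct (classic Q) as [H|H].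
  - apply (F_iff _ _ F_true). tauto.
  - apply (F_iff _ _ F_false). tauto.
Qed.

Lemma P_nonneg A : F A -> 0 <= P A.
Proof. apply HP. Qed.
Lemma P_true : P (fun _ => True) = 1.
Proof. apply HP. Qed.
Lemma P_sigma (An : nat -> Omega -> Prop) : (forall n, F (An n)) ->
  (forall n m w, n <> m -> An n w -> An m w -> False) ->
  infinite_sum (fun n => P (An n)) (P (fun w => exists n, An n w)).
Proof. apply HP. Qed.
Lemma P_iff A B : (forall w, A w <-> B w) -> P A = P B.
Proof. intros H. rewrite (event_ext A B); auto. Qed.

(** Countable additivity for empty events gives a convergent series of constant terms [c]: two
    consecutive partial sums close to the limit differ by [c]. Finite additivity then follows by
    padding with empty events. *)
Lemma P_false : P (fun _ => False) = 0.
Proof.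
  assert (H := P_sigma (fun _ _ => False) (fun _ => F_false) (fun _ _ _ _ H _ => H)).
  set (c := P (fun _ => False)) in *. apply NNPP. intros Hc.
  destruct (H (Rabs c / 2)) as (N & HN).
  { assert (0 < Rabs c) by (apply Rabs_pos_lt; auto). lra. }
  assert (H1 := HN N (le_n _)). assert (H2 := HN (S N) (le_S _ _ (le_n _))). simpl in H2.
  fold c in H2. unfold Rdist in *. set (s := sum_f_R0 _ _) in *.
  assert (Rabs c <= Rabs (s + c - P (fun _ => exists _ : nat, False)) + Rabs (s - P (fun _ => exists _ : nat, False))).
  { replace c with ((s + c - P (fun _ => exists _ : nat, False)) - (s - P (fun _ => exists _ : nat, False))) at 1 by ring.
    eapply Rle_trans; [apply Rabs_triang|]. rewrite Rabs_Ropp. lra. }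
  lra.
Qed.

Lemma infinite_sum_finite f l N : (forall n, (N < n)%nat -> f n = 0) -> infinite_sum f l -> l = sum_f_R0 f N.
Proof.
  intros Hf Hl. apply (uniqueness_sum f); auto. intros eps He. exists N. intros n Hn.
  assert (E : sum_f_R0 f n = sum_f_R0 f N).
  { induction Hn as [|n Hn IH]; auto. simpl. rewrite IH, Hf by lia. ring. }
  rewrite E. unfold Rdist. rewrite Rminus_diag, Rabs_R0. auto.
Qed.

Lemma P_or A B : F A -> F B -> (forall w, A w -> B w -> False) -> P (fun w => A w \/ B w) = P A + P B.
Proof.
  intros HA HB Hd.
  set (An := fun n : nat => match n with O => A | S O => B | _ => fun _ => False end).
  assert (H : infinite_sum (fun n => P (An n)) (P (fun w => exists n, An n w))).
  { apply P_sigma.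
    - intros [|[|n]]; simpl; auto. apply F_false.
    - intros [|[|n]] [|[|m]] w Hne; simpl; auto; try tauto; intros; eapply Hd; eauto. }
  apply (infinite_sum_finite _ _ 1) in H.
  - simpl in H. rewrite <- H. apply P_iff. intros w. split.
    + intros [H1|H1]; [exists 0%nat|exists 1%nat]; auto.
    + intros ([|[|n]] & Hn); simpl in Hn; tauto.
  - intros [|[|n]] Hn; try lia. simpl. apply P_false.
Qed.

Lemma P_split A B : F A -> F B -> P A = P (fun w => A w /\ B w) + P (fun w => A w /\ ~ B w).
Proof.
  intros HA HB. rewrite <- P_or.
  - apply P_iff. intros w. destruct (classic (B w)); tauto.
  - apply F_and; auto.
  - apply F_and; auto using F_not.
  - tauto.
Qed.

Lemma P_mono A B : F A -> F B -> (forall w, A w -> B w) -> P A <= P B.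
Proof.
  intros HA HB H. rewrite (P_split B A); auto.
  assert (0 <= P (fun w => B w /\ ~ A w)) by (apply P_nonneg, F_and; auto using F_not).
  rewrite (P_iff A (fun w => B w /\ A w)); [lra|]. intros w; split; auto. tauto.
Qed.

Lemma P_le1 A : F A -> P A <= 1.
Proof. intros HA. rewrite <- P_true. apply P_mono; auto using F_true. Qed.

Lemma P_not A : F A -> P (fun w => ~ A w) = 1 - P A.
Proof.
  intros HA. rewrite <- P_true, (P_split (fun _ => True) A) by auto using F_true.
  rewrite (P_iff (fun w => True /\ A w) A), (P_iff (fun w => True /\ ~ A w) (fun w => ~ A w)) by tauto. ring.
Qed.

Lemma P_or_le A B : F A -> F B -> P (fun w => A w \/ B w) <= P A + P B.
Proof.
  intros HA HB. rewrite (P_iff _ (fun w => A w \/ (B w /\ ~ A w))).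
  - rewrite P_or; auto using F_and, F_not; [|tauto].
    apply Rplus_le_compat_l, P_mono; auto using F_and, F_not. tauto.
  - intros w. destruct (classic (A w)); tauto.
Qed.

Lemma F_exl {T} (A : T -> Omega -> Prop) l : (forall y, In y l -> F (A y)) -> F (fun w => exists y, In y l /\ A y w).
Proof.
  induction l as [|y l IH]; intros H.
  - apply (F_iff _ _ F_false). intros w; split; [tauto|]. intros (y & [] & _).
  - apply (F_iff (fun w => A y w \/ exists z, In z l /\ A z w)).
    + apply F_or; [apply H; simpl; auto|]. apply IH. intros; apply H; simpl; auto.
    + intros w. split.
      * intros [H1|(z & Hz & H1)]; [exists y|exists z]; simpl; auto.
      * intros (z & [<-|Hz] & H1); eauto.
Qed.

Lemma P_exl_le {T} (A : T -> Omega -> Prop) l : (forall y, In y l -> F (A y)) ->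
  P (fun w => exists y, In y l /\ A y w) <= sumR (fun y => P (A y)) l.
Proof.
  induction l as [|y l IH]; intros H; simpl.
  - rewrite (P_iff _ (fun _ => False)); [rewrite P_false; lra|]. intros w; split; [|tauto]. intros (y & [] & _).
  - rewrite (P_iff _ (fun w => A y w \/ exists z, In z l /\ A z w)).
    + eapply Rle_trans; [apply P_or_le|].
      * apply H; simpl; auto.
      * apply F_exl. intros; apply H; simpl; auto.
      * apply Rplus_le_compat_l, IH. intros; apply H; simpl; auto.
    + intros w. split.
      * intros (z & [<-|Hz] & H1); eauto.
      * intros [H1|(z & Hz & H1)]; [exists y|exists z]; simpl; auto.
Qed.

Lemma P_exl_eq {T} (A : T -> Omega -> Prop) l : NoDup l -> (forall y, In y l -> F (A y)) ->
  (forall y z w, A y w -> A z w -> y = z) ->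
  P (fun w => exists y, In y l /\ A y w) = sumR (fun y => P (A y)) l.
Proof.
  intros Hnd H Hd. induction l as [|y l IH]; simpl.
  - rewrite (P_iff _ (fun _ => False)); [apply P_false|]. intros w; split; [|tauto]. intros (y & [] & _).
  - inversion Hnd; subst. rewrite <- IH by (auto; intros; apply H; simpl; auto).
    rewrite <- P_or.
    + apply P_iff. intros w. split.
      * intros (z & [<-|Hz] & H1); eauto.
      * intros [H1|(z & Hz & H1)]; [exists y|exists z]; simpl; auto.
    + apply H; simpl; auto.
    + apply F_exl. intros; apply H; simpl; auto.
    + intros w H1 (z & Hz & H4). apply H2. rewrite (Hd y z w); auto.
Qed.

(** Continuity from below: the first index at which the event occurs cuts the union into disjoint
    pieces, whose partial sums are at most [P (An n)]. *)
Lemma P_ex_le (An : nat -> Omega -> Prop) c : (forall n, F (An n)) ->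
  (forall n w, An n w -> An (S n) w) -> (forall n, P (An n) <= c) -> P (fun w => exists n, An n w) <= c.
Proof.
  intros HF Hinc Hc.
  set (D := fun n w => An n w /\ forall m, (m < n)%nat -> ~ An m w).
  assert (HD : forall n, F (D n)).
  { intros n. apply F_and; auto. apply (F_all (fun m w => (m < n)%nat -> ~ An m w)). intros m.
    destruct (lt_dec m n); [apply (F_iff _ _ (F_not _ (HF m)))|apply (F_iff _ _ F_true)]; tauto. }
  assert (HDA : forall n w, An n w -> exists m, (m <= n)%nat /\ D m w).
  { intros n. induction n as [n IH] using lt_wf_ind. intros w Hw.
    destruct (classic (exists m, (m < n)%nat /\ An m w)) as [(m & Hm & H1)|Hno].
    - destruct (IH m Hm w H1) as (k & Hk & H2). exists k; split; auto. lia.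
    - exists n. split; auto. split; auto. intros m Hm H1. apply Hno; eauto. }
  assert (HsD : forall n m w, n <> m -> D n w -> D m w -> False).
  { intros n m w Hne [H1 H2] [H3 H4]. destruct (Nat.lt_total n m) as [H|[H|H]]; [|auto|].
    - apply (H4 n); auto.
    - apply (H2 m); auto. }
  assert (Hsum := P_sigma D HD HsD).
  rewrite (P_iff _ (fun w => exists n, D n w)).
  2:{ intros w. split; [intros (n & Hn); destruct (HDA n w Hn) as (m & _ & Hm); eauto|].
      intros (n & Hn & _); eauto. }
  assert (Hmono : forall m n w, (m <= n)%nat -> An m w -> An n w).
  { intros m n w Hmn Hw. induction Hmn; auto. }
  assert (Hpart : forall n, sum_f_R0 (fun n => P (D n)) n <= P (An n)).
  { intros n. assert (E : sum_f_R0 (fun n => P (D n)) n = P (fun w => exists m, (m <= n)%nat /\ D m w)).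
    { induction n as [|n IH]; simpl.
      - apply P_iff. intros w. split; [eauto|]. intros (m & Hm & H). replace m with 0%nat in H by lia. auto.
      - rewrite IH, <- P_or; auto.
        + apply P_iff. intros w. split.
          * intros [(m & Hm & H)|H]; [exists m|exists (S n)]; split; auto.
          * intros (m & Hm & H). destruct (Nat.eq_dec m (S n)) as [->|]; [auto|].
            left; exists m; split; auto. lia.
        + apply (F_ex (fun m w => (m <= n)%nat /\ D m w)). intros m. apply F_and; auto using F_const.
        + intros w (m & Hm & H) H'. apply (HsD m (S n) w); auto. lia. }
    rewrite E. apply P_mono; auto.
    - apply (F_ex (fun m w => (m <= n)%nat /\ D m w)). intros m. apply F_and; auto using F_const.
    - intros w (m & Hm & H & _). eapply Hmono; eauto. }
  apply Rnot_lt_le. intros Hlt.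
  destruct (Hsum (P (fun w => exists n, D n w) - c) ltac:(lra)) as (N & HN).
  specialize (HN N (le_n _)). unfold Rdist in HN. apply Rabs_def2 in HN.
  specialize (Hpart N). specialize (Hc N). lra.
Qed.

Definition null (A : Omega -> Prop) : Prop := F A /\ P A = 0.

Lemma null_or A B : null A -> null B -> null (fun w => A w \/ B w).
Proof.
  intros [HA HA0] [HB HB0]. split; [apply F_or; auto|].
  apply Rle_antisym; [|apply P_nonneg, F_or; auto]. assert (H := P_or_le A B HA HB). lra.
Qed.

Lemma null_exl {T} (A : T -> Omega -> Prop) l : (forall y, In y l -> null (A y)) ->
  null (fun w => exists y, In y l /\ A y w).
Proof.
  intros H. assert (HF : F (fun w => exists y, In y l /\ A y w)) by (apply F_exl; intros; apply H; auto).
  split; auto. apply Rle_antisym; [|apply P_nonneg; auto].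
  eapply Rle_trans; [apply P_exl_le; intros; apply H; auto|].
  rewrite sumR_zero; [lra|]. intros y Hy. apply H; auto.
Qed.

Lemma full_of_null A N : F A -> null N -> (forall w, ~ N w -> A w) -> P A = 1.
Proof.
  intros HA [HN HN0] H.
  assert (H1 : P (fun w => ~ A w) <= P N).
  { apply P_mono; auto using F_not. intros w Hw. apply NNPP. auto. }
  rewrite P_not in H1 by auto. assert (H2 := P_le1 A HA). lra.
Qed.

(** * Measurability and one-step law of the walk *)

Variables (d : nat) (r : nat -> nat) (z0 : vertex -> nat) (x0 : vertex) (X : nat -> Omega -> vertex).
Hypothesis d3 : (3 <= d)%nat.
Hypothesis z0_pos : forall v, In v (vertices d r) -> (1 <= z0 v)%nat.
Hypothesis x0_in : In x0 (vertices d r).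
Hypothesis HX : is_VRRW d r z0 x0 Omega F P X.

Definition path (w : Omega) : nat -> vertex := fun s => X s w.

Lemma F_X t v : F (fun w => X t w = v).
Proof. apply HX. Qed.

Lemma F_ex_vertex (A : vertex -> Omega -> Prop) : (forall v, F (A v)) -> F (fun w => exists v, A v w).
Proof.
  intros H. apply (F_iff (fun w => (exists i, A (Int i) w) \/ exists i, exists k, A (Leaf i k) w)).
  - apply F_or; [apply (F_ex (fun i => A (Int i))); auto|].
    apply (F_ex (fun i w => exists k, A (Leaf i k) w)). intros i. apply (F_ex (fun k => A (Leaf i k))); auto.
  - intros w. split.
    + intros [(i & Hi)|(i & k & Hi)]; eauto.
    + intros ([i|i k] & Hv); eauto.
Qed.

(** As [vertex] is countable, any predicate on finitely many positions is a countable union of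
    cylinders. Positions outside the graph are included: they are excluded only almost surely. *)
Lemma F_path_list (phi : list vertex -> Prop) l : F (fun w => phi (map (path w) l)).
Proof.
  revert phi. induction l as [|s l IH]; intros phi; simpl; [apply F_const|].
  apply (F_iff (fun w => exists v, X s w = v /\ phi (v :: map (path w) l))).
  - apply F_ex_vertex. intros v. apply F_and; [apply F_X|]. apply (IH (fun m => phi (v :: m))).
  - intros w. split; [intros (v & <- & H); exact H|eauto].
Qed.

Definition upd (h : nat -> vertex) (t : nat) (y : vertex) : nat -> vertex :=
  fun s => if Nat.eqb s t then y else h s.

Local Notation t0 := (t0_of d r z0).

Lemma F_path_event (Q : (nat -> vertex) -> Prop) t :
  (forall h h', (forall s, (t0 <= s <= t)%nat -> h s = h' s) -> Q h -> Q h') ->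
  F (fun w => Q (path w)).
Proof.
  intros HQ. set (l := seq t0 (S t - t0)).
  apply (F_iff (fun w => (fun m => exists h, Q h /\ map h l = m) (map (path w) l))).
  - apply (F_path_list (fun m => exists h, Q h /\ map h l = m)).
  - intros w. split; [|intros H; exists (path w); auto].
    intros (h & Hh & E). apply (HQ h); auto. intros s Hs.
    assert (Hin : In s l) by (unfold l; apply in_seq; lia).
    revert E Hin. generalize l. clear. intros l. induction l as [|a l IH]; simpl; intros E [].
    + subst. injection E; auto.
    + injection E; auto.
Qed.

Definition Wsum (h : nat -> vertex) (t : nat) : R :=
  sumR (fun y => if adjb d r (h t) y then INR (Zc t0 z0 h t y) else 0) (vertices d r).

Lemma Zc_local h h' t v : (forall s, (t0 <= s <= t)%nat -> h s = h' s) -> Zc t0 z0 h t v = Zc t0 z0 h' t v.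
Proof.
  intros H. unfold Zc. f_equal. f_equal. apply filter_ext_in. intros s Hs. apply in_seq in Hs.
  rewrite H by lia. auto.
Qed.

Lemma Wsum_local h h' t : (t0 <= t)%nat -> (forall s, (t0 <= s <= t)%nat -> h s = h' s) -> Wsum h t = Wsum h' t.
Proof.
  intros Ht H. unfold Wsum. apply sumR_ext. intros y _. rewrite (H t) by lia. rewrite (Zc_local h h' t y H). auto.
Qed.

Lemma Zc_S h t v : (t0 <= t)%nat -> Zc t0 z0 h (S t) v = (Zc t0 z0 h t v + (if vertex_eq_dec (h (S t)) v then 1 else 0))%nat.
Proof.
  intros Ht. unfold Zc. replace (S t - t0)%nat with (S (t - t0)) by lia. rewrite seq_S, filter_app, length_app.
  replace (S t0 + (t - t0))%nat with (S t) by lia. simpl. destruct (vertex_eq_dec (h (S t)) v); simpl; lia.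
Qed.

Lemma trans_eq h t y : trans d r z0 h t y = if adjb d r (h t) y then INR (Zc t0 z0 h t y) / Wsum h t else 0.
Proof. reflexivity. Qed.

Lemma Wsum_nonneg h t : 0 <= Wsum h t.
Proof. apply sumR_nonneg. intros y _. destruct (adjb _ _ _ _); [apply pos_INR|lra]. Qed.

Lemma trans_nonneg h t y : 0 <= trans d r z0 h t y.
Proof.
  rewrite trans_eq. destruct (adjb _ _ _ _); [|lra].
  destruct (Req_dec (Wsum h t) 0) as [E|E].
  - rewrite E. unfold Rdiv. rewrite Rinv_0. lra.
  - assert (H := Wsum_nonneg h t). apply Rmult_le_pos; [apply pos_INR|]. left; apply Rinv_0_lt_compat; lra.
Qed.

Lemma sum_trans h t : sumR (trans d r z0 h t) (vertices d r) = Wsum h t * / Wsum h t.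
Proof.
  unfold Wsum at 1. rewrite Rmult_comm, <- sumR_scal. apply sumR_ext. intros y _.
  rewrite trans_eq. destruct (adjb _ _ _ _); unfold Rdiv; ring.
Qed.

(** The value 0 occurs when the normalisation vanishes, as for a position outside the graph.
    Supermartingales are tested on all histories, so it cannot be discarded. *)
Lemma sum_trans_01 h t : sumR (trans d r z0 h t) (vertices d r) = 0 \/ sumR (trans d r z0 h t) (vertices d r) = 1.
Proof.
  rewrite sum_trans. destruct (Req_dec (Wsum h t) 0) as [E|E]; [left; rewrite E; ring|right; field; auto].
Qed.

Lemma in_vertices v : In v (vertices d r) <-> validb d r v = true.
Proof.
  unfold vertices. rewrite in_app_iff, in_map_iff, in_flat_map. destruct v as [i|i k].
  - rewrite valid_Int. split.
    + intros [(j & E & Hj)|(j & Hj & H)].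
      * injection E as ->. apply in_seq_interior; auto.
      * apply in_map_iff in H. destruct H as (k & E & _). discriminate.
    + intros Hi. left. exists i. split; auto. apply in_seq_interior; auto.
  - rewrite valid_Leaf. split.
    + intros [(j & E & Hj)|(j & Hj & H)]; [discriminate|].
      apply in_map_iff in H. destruct H as (l & E & Hl). injection E as -> ->.
      apply in_seq in Hl. split; [apply in_seq_interior; auto|lia].
    + intros [Hi Hk]. right. exists i. split; [apply in_seq_interior; auto|]. apply in_map_iff.
      exists k. split; auto. apply in_seq; lia.
Qed.

Lemma NoDup_vertices : NoDup (vertices d r).
Proof.
  unfold vertices. apply NoDup_app.
  - apply FinFun.Injective_map_NoDup; [intros a b H; injection H; auto|apply seq_NoDup].
  - assert (H := seq_NoDup d 1). induction (seq 1 d) as [|i l IH]; simpl; [constructor|].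
    inversion H; subst. apply NoDup_app; auto.
    + apply FinFun.Injective_map_NoDup; [intros a b E; injection E; auto|apply seq_NoDup].
    + intros v Hv Hv'. apply in_map_iff in Hv. destruct Hv as (k & <- & _).
      apply in_flat_map in Hv'. destruct Hv' as (j & Hj & Hv'). apply in_map_iff in Hv'.
      destruct Hv' as (k' & E & _). injection E as -> _. auto.
  - intros v Hv Hv'. apply in_map_iff in Hv. destruct Hv as (i & <- & _).
    apply in_flat_map in Hv'. destruct Hv' as (j & _ & Hv'). apply in_map_iff in Hv'. destruct Hv' as (k & E & _). discriminate.
Qed.

Lemma Zc_pos h t v : In v (vertices d r) -> 1 <= INR (Zc t0 z0 h t v).
Proof.
  intros Hv. apply z0_pos in Hv. change 1 with (INR 1). apply le_INR. unfold Zc. lia.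
Qed.

Lemma has_neighbor v : validb d r v = true -> exists y, In y (vertices d r) /\ adjb d r v y = true.
Proof.
  intros Hv. assert (Hy : exists y, validb d r y = true /\ adjb d r v y = true).
  { destruct v as [i|i k].
    - destruct (other d d3 i) as (j & Hj & Hne). exists (Int j).
      assert (validb d r (Int j) = true) by (apply valid_Int; auto). split; auto.
      unfold adjb. rewrite Hv, H. simpl. destruct (Nat.eqb_spec i j); [congruence|reflexivity].
    - exists (Int i). assert (H : validb d r (Int i) = true).
      { apply valid_Int. apply valid_Leaf in Hv. tauto. }
      split; auto. unfold adjb. rewrite Hv, H. simpl. apply Nat.eqb_refl. }
  destruct Hy as (y & H1 & H2). exists y. split; auto. apply in_vertices; auto.
Qed.

Lemma sum_trans_1 h t : In (h t) (vertices d r) -> sumR (trans d r z0 h t) (vertices d r) = 1.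
Proof.
  intros Hv. rewrite sum_trans. apply in_vertices in Hv. destruct (has_neighbor _ Hv) as (y & Hy & Ha).
  assert (1 <= Wsum h t); [|field; lra].
  apply Rle_trans with (INR (Zc t0 z0 h t y)); [apply Zc_pos; auto|].
  apply Rle_trans with ((fun y => if adjb d r (h t) y then INR (Zc t0 z0 h t y) else 0) y); [simpl; rewrite Ha; lra|].
  apply (sumR_ge_term (fun y => if adjb d r (h t) y then INR (Zc t0 z0 h t y) else 0)); auto. intros z _. destruct (adjb d r (h t) z); [apply pos_INR|lra].
Qed.

Definition hist (t : nat) (h : nat -> vertex) (w : Omega) : Prop :=
  forall s, (t0 <= s <= t)%nat -> X s w = h s.

Lemma F_hist t h : F (hist t h).
Proof.
  apply (F_path_event (fun p => forall s, (t0 <= s <= t)%nat -> p s = h s) t).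
  intros p p' Hp H s Hs. rewrite <- Hp; auto.
Qed.

Lemma hist_upd t h y w : (t0 <= t)%nat -> hist (S t) (upd h (S t) y) w <-> hist t h w /\ X (S t) w = y.
Proof.
  intros Ht. unfold hist, upd. split.
  - intros H. split.
    + intros s Hs. rewrite H by lia. destruct (Nat.eqb_spec s (S t)); [lia|auto].
    + rewrite H by lia. rewrite Nat.eqb_refl. auto.
  - intros [H1 H2] s Hs. destruct (Nat.eqb_spec s (S t)) as [->|]; auto. apply H1; lia.
Qed.

Lemma P_hist_upd t h y : (t0 <= t)%nat -> P (hist (S t) (upd h (S t) y)) = P (hist t h) * trans d r z0 h t y.
Proof.
  intros Ht. destruct HX as (_ & _ & H). rewrite (P_iff (hist (S t) (upd h (S t) y)) _ (fun w => hist_upd t h y w Ht)). exact (H t h y Ht).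
Qed.

(** The continuations inside the graph are disjoint and their transition probabilities add up to 1,
    so they exhaust [hist t h]. *)
Lemma hist_leaves_null t h : (t0 <= t)%nat -> In (h t) (vertices d r) ->
  P (fun w => hist t h w /\ ~ In (X (S t) w) (vertices d r)) = 0.
Proof.
  intros Ht Hin.
  assert (HFin : F (fun w => In (X (S t) w) (vertices d r))).
  { apply (F_iff (fun w => exists y, In y (vertices d r) /\ X (S t) w = y)).
    - apply F_exl. intros; apply F_X.
    - intros w; split; [intros (y & Hy & ->); auto|eauto]. }
  assert (H := P_split _ _ (F_hist t h) HFin).
  assert (E : P (fun w => hist t h w /\ In (X (S t) w) (vertices d r)) = P (hist t h)).
  { rewrite (P_iff _ (fun w => exists y, In y (vertices d r) /\ hist (S t) (upd h (S t) y) w)).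
    - rewrite P_exl_eq.
      + rewrite (sumR_ext _ (fun y => P (hist t h) * trans d r z0 h t y)) by (intros; apply P_hist_upd; auto).
        rewrite sumR_scal, (sum_trans_1 h t Hin). ring.
      + apply NoDup_vertices.
      + intros; apply F_hist.
      + intros y z w Hy Hz. apply hist_upd in Hy, Hz; auto. destruct Hy, Hz; congruence.
    - intros w. split.
      + intros [H1 H2]. exists (X (S t) w). split; auto. apply hist_upd; auto.
      + intros (y & Hy & H1). apply hist_upd in H1; auto. destruct H1 as [H1 <-]. auto. }
  lra.
Qed.

(** * Supermartingales on histories and Ville's inequality *)

Definition adapted (S : nat -> (nat -> vertex) -> R) : Prop :=
  forall t h h', (t0 <= t)%nat -> (forall s, (t0 <= s <= t)%nat -> h s = h' s) -> S t h = S t h'.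

(** The conditional expectation is a finite sum over the next vertex, and the inequality is imposed
    on every history, which keeps integration and null events out of the definition. *)
Definition supermartingale (M : nat -> (nat -> vertex) -> R) : Prop :=
  adapted M /\ (forall t h, 0 <= M t h) /\
  (forall t h, (t0 <= t)%nat ->
     sumR (fun y => trans d r z0 h t y * M (S t) (upd h (S t) y)) (vertices d r) <= M t h).

Lemma F_reach M a t n : adapted M -> (t0 <= t)%nat ->
  F (fun w => exists s, (t <= s <= t + n)%nat /\ a <= M s (path w)).
Proof.
  intros HM Ht. apply (F_path_event (fun p => exists s, (t <= s <= t + n)%nat /\ a <= M s p) (t + n)).
  intros h h' Hh (s & Hs & H). exists s. split; auto. rewrite <- (HM s h h'); auto; [lia|].
  intros; apply Hh; lia.
Qed.

(** Induction on the horizon, conditionally on the history. If [M] is still below [a], the level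
    must be reached after the next step: split according to the next vertex, apply the induction
    hypothesis to each extended history, and sum with the supermartingale inequality. *)
Lemma ville_hist M a n : supermartingale M -> 0 < a -> forall t h, (t0 <= t)%nat -> In (h t) (vertices d r) ->
  a * P (fun w => hist t h w /\ exists s, (t <= s <= t + n)%nat /\ a <= M s (path w)) <= P (hist t h) * M t h.
Proof.
  intros (HMa & HM0 & HMs) Ha. induction n as [|n IH]; intros t h Ht Hin.
  all: assert (HE : forall w, hist t h w -> M t (path w) = M t h) by (intros w Hw; apply HMa; auto).
  all: assert (HPh := P_nonneg _ (F_hist t h)).
  all: destruct (Rle_lt_dec a (M t h)) as [Hle|Hlt].
  all: try solve [apply Rle_trans with (a * P (hist t h));
    [apply Rmult_le_compat_l; [lra|]; apply P_mono; [apply F_and; [apply F_hist|apply F_reach; auto]|apply F_hist|tauto]|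
     rewrite Rmult_comm; apply Rmult_le_compat_l; auto]].
  - rewrite (P_iff _ (fun _ => False)); [rewrite P_false, Rmult_0_r; apply Rmult_le_pos; auto|].
    intros w. split; [|tauto]. intros [Hw (s & Hs & H)]. replace s with t in H by lia. rewrite HE in H by auto. lra.
  - set (G := fun y w => hist (S t) (upd h (S t) y) w /\ exists s, (S t <= s <= S t + n)%nat /\ a <= M s (path w)).
    assert (HG : forall y, F (G y)) by (intros y; apply F_and; [apply F_hist|apply F_reach; auto]).
    assert (HFout : F (fun w => hist t h w /\ ~ In (X (S t) w) (vertices d r))).
    { apply F_and; [apply F_hist|]. apply F_not.
      apply (F_iff (fun w => exists y, In y (vertices d r) /\ X (S t) w = y)).
      - apply F_exl. intros; apply F_X.
      - intros w; split; [intros (y & Hy & ->); auto|eauto]. }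
    assert (H1 : P (fun w => hist t h w /\ exists s, (t <= s <= t + S n)%nat /\ a <= M s (path w)) <=
        P (fun w => (exists y, In y (vertices d r) /\ G y w) \/ (hist t h w /\ ~ In (X (S t) w) (vertices d r)))).
    { apply P_mono.
      - apply F_and; [apply F_hist|apply F_reach; auto].
      - apply F_or; auto. apply F_exl; auto.
      - intros w [Hw (s & Hs & H)]. destruct (classic (In (X (S t) w) (vertices d r))) as [Hi|Hi]; [left|right; auto].
        exists (X (S t) w). split; auto. split; [apply hist_upd; auto|].
        exists s. split; auto. destruct (Nat.eq_dec s t) as [->|]; [rewrite HE in H by auto; lra|lia]. }
    assert (H2 := P_or_le _ _ (F_exl G (vertices d r) (fun y _ => HG y)) HFout).
    rewrite (hist_leaves_null t h Ht Hin) in H2. assert (H3 := P_exl_le G (vertices d r) (fun y _ => HG y)).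
    apply Rle_trans with (a * sumR (fun y => P (G y)) (vertices d r)); [apply Rmult_le_compat_l; lra|].
    rewrite <- sumR_scal.
    apply Rle_trans with (sumR (fun y => P (hist t h) * (trans d r z0 h t y * M (S t) (upd h (S t) y))) (vertices d r)).
    + apply sumR_le. intros y Hy. rewrite <- Rmult_assoc, <- P_hist_upd by auto. apply IH; [lia|].
      unfold upd. rewrite Nat.eqb_refl. auto.
    + rewrite sumR_scal. apply Rmult_le_compat_l; auto.
Qed.

(** The horizon goes to infinity by [P_ex_le]. The constant history [x0] may stand for the start
    because [M t0] only depends on the position at [t0], which is [x0] with probability 1. *)
Lemma ville M a : supermartingale M -> 0 < a ->
  F (fun w => exists s, (t0 <= s)%nat /\ a <= M s (path w)) /\
  a * P (fun w => exists s, (t0 <= s)%nat /\ a <= M s (path w)) <= M t0 (fun _ => x0).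
Proof.
  intros HM Ha. assert (HMa := proj1 HM).
  assert (HF : forall n, F (fun w => exists s, (t0 <= s <= t0 + n)%nat /\ a <= M s (path w))) by (intros n; apply F_reach; auto).
  assert (E : forall w, (exists s, (t0 <= s)%nat /\ a <= M s (path w)) <-> exists n, exists s, (t0 <= s <= t0 + n)%nat /\ a <= M s (path w)).
  { intros w. split.
    - intros (s & Hs & H). exists (s - t0)%nat, s. split; auto. lia.
    - intros (n & s & Hs & H). exists s. split; auto. lia. }
  split.
  - apply (F_iff (fun w => exists n, exists s, (t0 <= s <= t0 + n)%nat /\ a <= M s (path w))).
    + apply (F_ex (fun n w => exists s, (t0 <= s <= t0 + n)%nat /\ a <= M s (path w))); auto.
    + intros w. rewrite E. tauto.
  - rewrite (P_iff _ _ E).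
    assert (H : P (fun w => exists n, exists s, (t0 <= s <= t0 + n)%nat /\ a <= M s (path w)) <= M t0 (fun _ => x0) / a).
    + apply P_ex_le; auto.
      * intros n w (s & Hs & H). exists s. split; auto. lia.
      * intros n. apply (Rmult_le_reg_l a); auto. replace (a * (M t0 (fun _ => x0) / a)) with (M t0 (fun _ => x0)) by (field; lra).
        assert (H := ville_hist M a n HM Ha t0 (fun _ => x0) (le_n _) x0_in).
        assert (Hs : forall w, hist t0 (fun _ => x0) w <-> X t0 w = x0).
        { intros w. unfold hist. split; [intros Hw; apply Hw; lia|]. intros Hw s Hs. replace s with t0 by lia. auto. }
        destruct HX as (_ & Hx0 & _). rewrite (P_iff _ _ Hs), Hx0, Rmult_1_l in H.
        eapply Rle_trans; [|apply H]. apply Rmult_le_compat_l; [lra|].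
        rewrite (P_split _ (fun w => X t0 w = x0) (HF n) (F_X t0 x0)).
        assert (H0 : P (fun w => (exists s, (t0 <= s <= t0 + n)%nat /\ a <= M s (path w)) /\ X t0 w <> x0) <= P (fun w => X t0 w <> x0)).
        { apply P_mono; [apply F_and; auto; apply F_not, F_X|apply F_not, F_X|tauto]. }
        rewrite (P_not _ (F_X t0 x0)), Hx0 in H0.
        apply Rle_trans with (P (fun w => (exists s, (t0 <= s <= t0 + n)%nat /\ a <= M s (path w)) /\ X t0 w = x0)); [lra|].
        right. apply P_iff. intros w. rewrite Hs. tauto.
    + apply (Rmult_le_compat_l a) in H; [|lra]. replace (a * (M t0 (fun _ => x0) / a)) with (M t0 (fun _ => x0)) in H by (field; lra). auto.
Qed.

Lemma ville_null M : supermartingale M ->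
  null (fun w => forall m : nat, exists s, (t0 <= s)%nat /\ INR m + 1 <= M s (path w)).
Proof.
  intros HM.
  assert (Hm : forall m, 0 < INR m + 1) by (intros m; assert (H := pos_INR m); lra).
  assert (HF : F (fun w => forall m : nat, exists s, (t0 <= s)%nat /\ INR m + 1 <= M s (path w))).
  { apply (F_all (fun m w => exists s, (t0 <= s)%nat /\ INR m + 1 <= M s (path w))).
    intros m. apply (ville M (INR m + 1) HM (Hm m)). }
  split; auto. apply Rle_antisym; [|apply P_nonneg; auto].
  apply Rnot_lt_le. intros Hlt. set (p := P _) in Hlt.
  destruct (INR_unbounded (M t0 (fun _ => x0) / p)) as (m & Hmm).
  destruct (ville M (INR m + 1) HM (Hm m)) as [HFm H].
  assert (H1 : p <= P (fun w => exists s, (t0 <= s)%nat /\ INR m + 1 <= M s (path w))).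
  { apply P_mono; auto. }
  assert (H2 : (INR m + 1) * p <= M t0 (fun _ => x0)).
  { eapply Rle_trans; [|apply H]. apply Rmult_le_compat_l; auto. left; auto. }
  assert (M t0 (fun _ => x0) < INR m * p).
  { apply (Rmult_lt_compat_r p) in Hmm; auto. unfold Rdiv in Hmm. rewrite Rmult_assoc, Rinv_l, Rmult_1_r in Hmm by lra. lra. }
  lra.
Qed.

(** * The null event of bad trajectories *)

(** Time is shifted by [t0], so that index 0 of the deterministic analysis is the start of the
    walk. *)
Definition xp (h : nat -> vertex) (n : nat) : vertex := h (t0 + n)%nat.
Definition cntp (h : nat -> vertex) (n : nat) (v : vertex) : R := INR (Zc t0 z0 h (t0 + n) v).

Lemma sum_vertices f : sumR f (vertices d r) =
  sumR (fun i => f (Int i)) (seq 1 d) + sumR (fun i => sumR (fun k => f (Leaf i k)) (seq 1 (r i))) (seq 1 d).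
Proof.
  unfold vertices. rewrite sumR_app, sumR_map, sumR_flat_map. f_equal.
  apply sumR_ext. intros i _. apply sumR_map.
Qed.

Lemma Wsum_Wt h n : validb d r (xp h n) = true -> Wsum h (t0 + n) = Wt d r (xp h) (cntp h) n.
Proof.
  intros Hv. unfold Wsum, Wt. rewrite sum_vertices. fold (xp h n). destruct (xp h n) as [i|i k] eqn:E.
  - apply valid_Int in Hv. f_equal.
    + unfold Bi, zeta. rewrite (sI_split d _ i Hv). unfold Rminus. rewrite Rplus_comm, <- Rplus_assoc, Rplus_opp_l, Rplus_0_l.
      apply sumR_ext. intros j Hj. apply in_seq_interior in Hj. unfold adjb.
      rewrite (proj2 (valid_Int d r i) Hv), (proj2 (valid_Int d r j) Hj). simpl. rewrite Nat.eqb_sym.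
      destruct (Nat.eqb j i); auto.
    + rewrite (sumR_single _ _ i).
      * apply sumR_ext. intros k Hk. apply in_seq in Hk. unfold adjb.
        rewrite (proj2 (valid_Int d r i) Hv), (proj2 (valid_Leaf d r i k)) by (split; auto; lia).
        simpl. rewrite Nat.eqb_refl. auto.
      * apply seq_NoDup.
      * apply in_seq_interior; auto.
      * intros j _ Hj. apply sumR_zero. intros k _. unfold adjb.
        destruct (Nat.eqb_spec i j); [congruence|]. rewrite andb_false_r. auto.
  - assert (Hv' := Hv). apply valid_Leaf in Hv. destruct Hv as [Hi Hk].
    rewrite (sumR_zero (fun i0 => sumR _ _)).
    + rewrite (sumR_single _ _ i).
      * unfold adjb. rewrite Hv', (proj2 (valid_Int d r i) Hi). simpl. rewrite Nat.eqb_refl. unfold Zi, cntp. ring.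
      * apply seq_NoDup.
      * apply in_seq_interior; auto.
      * intros j _ Hj. unfold adjb. destruct (Nat.eqb_spec j i); [congruence|]. rewrite andb_false_r. auto.
    + intros j _. apply sumR_zero. intros l _. unfold adjb. rewrite andb_false_r. auto.
Qed.

Definition Nv (v : vertex) (h : nat -> vertex) (n : nat) : R :=
  bsum (fun k => Rpower (cntp h k v) (1 / 3) *
     ((if vertex_eq_dec (xp h (S k)) v then / cntp h k v else 0) -
      (if adjb d r (xp h k) v then / Wsum h (t0 + k) else 0))) n.

(* [7 z^(-1/3)] drops by at least [z^(-4/3)] at a visit, which pays for the conditional variance of [Nv]. *)
Definition Mv (v : vertex) (t : nat) (h : nat -> vertex) : R :=
  Nv v h (t - t0) * Nv v h (t - t0) + 7 * Rpower (INR (Zc t0 z0 h t v)) (- (1 / 3)).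

Lemma Nv_local v h h' n : (forall s, (t0 <= s <= t0 + n)%nat -> h s = h' s) -> Nv v h n = Nv v h' n.
Proof.
  intros H. apply bsum_ext. intros k Hk. unfold cntp, xp.
  rewrite (Zc_local h h'), (Wsum_local h h') by (try lia; intros; apply H; lia).
  rewrite !H by lia. auto.
Qed.

Lemma sumR_if_eq (q : vertex -> R) v a b l : NoDup l -> In v l ->
  sumR (fun y => q y * (if vertex_eq_dec y v then a else b)) l = q v * (a - b) + b * sumR q l.
Proof.
  intros Hnd Hin. rewrite (sumR_ext _ (fun y => (if vertex_eq_dec y v then q v * (a - b) else 0) + b * q y)).
  - rewrite sumR_plus, sumR_scal. f_equal. rewrite (sumR_single _ _ v); auto.
    + destruct (vertex_eq_dec v v); congruence.
    + intros y _ Hy. destruct (vertex_eq_dec y v); congruence.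
  - intros y _. destruct (vertex_eq_dec y v); subst; ring.
Qed.

Lemma upd_eq h t y : upd h t y t = y.
Proof. unfold upd. rewrite Nat.eqb_refl. auto. Qed.

Lemma Mv_supermartingale v : In v (vertices d r) -> supermartingale (Mv v).
Proof.
  intros Hv. split; [|split].
  - intros t h h' Ht H. unfold Mv. rewrite (Nv_local v h h'), (Zc_local h h'); auto.
    intros; apply H; lia.
  - intros t h. unfold Mv. assert (H := Rpower_pos (INR (Zc t0 z0 h t v)) (- (1 / 3))).
    assert (H1 := Rle_0_sqr (Nv v h (t - t0))). unfold Rsqr in H1. lra.
  - intros t h Ht. unfold Mv at 2.
    set (n := (t - t0)%nat). set (N := Nv v h n). set (z := INR (Zc t0 z0 h t v)).
    assert (Hz : 1 <= z) by (apply Zc_pos; auto).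
    set (q := trans d r z0 h t v).
    (* As [q] is [z] over the normalisation, the compensator is [q / z], also for a non-neighbour,
       where both are 0. *)
    assert (Hq : (if adjb d r (h t) v then / Wsum h t else 0) = q / z).
    { unfold q. rewrite trans_eq. fold z. destruct (adjb d r (h t) v); unfold Rdiv; [|ring].
      rewrite Rmult_comm, <- Rmult_assoc, Rinv_l by lra. ring. }
    set (b := Rpower z (1 / 3)).
    (* Values of [Mv] after a step to [v], and after any other step. *)
    set (g1 := (N + b * (/ z - q / z)) * (N + b * (/ z - q / z)) + 7 * Rpower (z + 1) (- (1 / 3))).
    set (g0 := (N - b * (q / z)) * (N - b * (q / z)) + 7 * Rpower z (- (1 / 3))).
    assert (Hg : forall y, Mv v (S t) (upd h (S t) y) = if vertex_eq_dec y v then g1 else g0).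
    { intros y.
      assert (Hloc : forall s, (t0 <= s <= t)%nat -> upd h (S t) y s = h s).
      { intros s Hs. unfold upd. destruct (Nat.eqb_spec s (S t)); [lia|auto]. }
      unfold Mv. replace (S t - t0)%nat with (S n) by (unfold n; lia).
      assert (HN : Nv v (upd h (S t) y) (S n) = N + b * ((if vertex_eq_dec y v then / z else 0) - q / z)).
      { unfold Nv. simpl bsum. f_equal.
        - apply (Nv_local v). intros s Hs. apply Hloc. unfold n in Hs. lia.
        - unfold cntp, xp. replace (t0 + S n)%nat with (S t) by (unfold n; lia). replace (t0 + n)%nat with t by (unfold n; lia).
          rewrite (Zc_local _ h t v Hloc), (Wsum_local _ h t Ht Hloc), (Hloc t) by lia. rewrite Hq.
          rewrite upd_eq. auto. }
      rewrite HN, Zc_S, (Zc_local _ h t v Hloc), plus_INR by auto. fold z.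
      rewrite upd_eq.
      destruct (vertex_eq_dec y v); simpl INR; unfold g1, g0; [ring|]. rewrite Rplus_0_r. ring. }
    rewrite (sumR_ext _ (fun y => trans d r z0 h t y * (if vertex_eq_dec y v then g1 else g0))) by (intros; rewrite Hg; auto).
    rewrite sumR_if_eq by (auto using NoDup_vertices). fold q.
    set (T := sumR (trans d r z0 h t) (vertices d r)).
    assert (Hq0 : 0 <= q) by apply trans_nonneg.
    assert (HqT : q <= T) by (apply sumR_ge_term; auto; intros; apply trans_nonneg).
    assert (HP1 := Rpower_pos z (- (1 / 3))). assert (HN2 := Rle_0_sqr N). unfold Rsqr in HN2.
    destruct (sum_trans_01 h t) as [E|E]; fold T in E.
    + rewrite E in *. assert (q = 0) by lra. rewrite H. lra.
    + rewrite E in *.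
      assert (Hstep := Rpower_step z (1 / 3) Hz ltac:(lra)).
      assert (Hb : (b * / z) * (b * / z) = Rpower z (- 1 - 1 / 3)).
      { unfold b. rewrite <- (Rpower_1 z) at 2 4 by lra. rewrite <- !Rpower_Ropp, <- !Rpower_plus. f_equal. field. }
      replace (1 / 3 / (2 + 1 / 3)) with (/ 7) in Hstep by field. rewrite <- Hb in Hstep.
      set (p := b * / z) in *.
      (* The increment of [Nv] is centred, so the cross term vanishes and the variance
         [q (1 - q) p^2] remains, with [p^2 = z^(-4/3)]. By [Rpower_step] the second summand drops
         by at least [p^2] with probability [q]. *)
      assert (Eg : q * (g1 - g0) + g0 * 1 = N * N + q * (1 - q) * (p * p) + 7 * (Rpower z (- (1 / 3)) - q * (Rpower z (- (1 / 3)) - Rpower (z + 1) (- (1 / 3))))).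
      { unfold g1, g0, p, Rdiv. ring. }
      rewrite Eg. assert (Hp := Rle_0_sqr p). unfold Rsqr in Hp.
      assert (H1 : q * (1 - q) * (p * p) <= q * (p * p)) by (apply Rmult_le_compat_r; nra).
      assert (H2 : q * (/ 7 * (p * p)) <= q * (Rpower z (- (1 / 3)) - Rpower (z + 1) (- (1 / 3)))) by (apply Rmult_le_compat_l; lra).
      lra.
Qed.

(** Steps off the edges are excluded by [is_VRRW] only through zero transition probabilities. The
    indicator that one has occurred is a supermartingale started at 0, so Ville's inequality at
    level 1 makes them null. *)
Definition viol (t : nat) (h : nat -> vertex) : R :=
  if existsb (fun s => negb (adjb d r (h s) (h (S s)))) (seq t0 (t - t0)) then 1 else 0.

Lemma existsb_ext_in {A} (f g : A -> bool) l : (forall a, In a l -> f a = g a) -> existsb f l = existsb g l.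
Proof. induction l as [|a l IH]; simpl; intros H; auto. rewrite H, IH; auto. Qed.

Lemma viol_supermartingale : supermartingale viol.
Proof.
  split; [|split].
  - intros t h h' Ht H. unfold viol. erewrite existsb_ext_in; [reflexivity|].
    intros s Hs. apply in_seq in Hs. cbv beta. rewrite !H by lia. auto.
  - intros t h. unfold viol. destruct (existsb _ _); lra.
  - intros t h Ht. assert (Hs : forall y, viol (S t) (upd h (S t) y) =
       if existsb (fun s => negb (adjb d r (h s) (h (S s)))) (seq t0 (t - t0)) then 1
       else if adjb d r (h t) y then 0 else 1).
    { intros y. unfold viol. replace (S t - t0)%nat with (S (t - t0)) by lia. rewrite seq_S, existsb_app.
      rewrite (existsb_ext_in _ (fun s => negb (adjb d r (h s) (h (S s))))).
      - destruct (existsb _ (seq t0 (t - t0))); auto. simpl. replace (t0 + (t - t0))%nat with t by lia.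
        unfold upd. rewrite Nat.eqb_refl. destruct (Nat.eqb_spec t (S t)); [lia|].
        destruct (adjb d r (h t) y); auto.
      - intros s Hs. apply in_seq in Hs. unfold upd.
        destruct (Nat.eqb_spec s (S t)); [lia|]. destruct (Nat.eqb_spec (S s) (S t)); [lia|]. auto. }
    rewrite (sumR_ext _ _ _ (fun y _ => f_equal (Rmult (trans d r z0 h t y)) (Hs y))).
    unfold viol. destruct (existsb _ (seq t0 (t - t0))).
    + rewrite (sumR_ext _ (trans d r z0 h t)) by (intros; ring). destruct (sum_trans_01 h t); lra.
    + rewrite sumR_zero; [lra|]. intros y _. rewrite trans_eq. destruct (adjb d r (h t) y); ring.
Qed.

(** Outside this single null event the trajectory satisfies all hypotheses of the deterministic
    analysis. *)
Definition bad (w : Omega) : Prop :=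
  (exists s, (t0 <= s)%nat /\ 1 <= viol s (path w)) \/
  exists v, In v (vertices d r) /\ forall m : nat, exists s, (t0 <= s)%nat /\ INR m + 1 <= Mv v s (path w).

Lemma bad_null : null bad.
Proof.
  apply null_or.
  - destruct (ville viol 1 viol_supermartingale ltac:(lra)) as [H1 H2].
    split; auto. unfold viol in H2 at 2. rewrite Nat.sub_diag in H2. simpl in H2.
    assert (H3 := P_nonneg _ H1). lra.
  - apply (null_exl (fun v w => forall m : nat, exists s, (t0 <= s)%nat /\ INR m + 1 <= Mv v s (path w))).
    intros v Hv. apply ville_null. apply Mv_supermartingale; auto.
Qed.

Lemma good_adj w : ~ bad w -> forall n, adjb d r (xp (path w) n) (xp (path w) (S n)) = true.
Proof.
  intros Hw n. apply NNPP. intros Hn. apply Hw. left. exists (t0 + S n)%nat. split; [lia|].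
  unfold viol. replace (existsb _ _) with true; [lra|]. symmetry. apply existsb_exists.
  exists (t0 + n)%nat. split; [apply in_seq; lia|]. unfold xp in Hn. rewrite Nat.add_succ_r in Hn.
  destruct (adjb _ _ _ _); [tauto|auto].
Qed.

(** Some level [m + 1] is never reached by [Mv v]; then [Nv^2 < m + 1], and so [|Nv| <= m + 1].
    [Wsum] is [Wt] because the positions are valid. *)
Lemma good_martingale w : ~ bad w -> forall v, validb d r v = true -> exists B, forall n,
  Rabs (bsum (fun k => Rpower (cntp (path w) k v) (1 / 3) *
     ((if vertex_eq_dec (xp (path w) (S k)) v then / cntp (path w) k v else 0) -
      (if adjb d r (xp (path w) k) v then / Wt d r (xp (path w)) (cntp (path w)) k else 0))) n) <= B.
Proof.
  intros Hw v Hv. apply NNPP. intros Hno. apply Hw. right. exists v. split; [apply in_vertices; auto|].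
  intros m. apply NNPP. intros Hs. apply Hno. exists (INR m + 1). intros n.
  assert (E : bsum (fun k => Rpower (cntp (path w) k v) (1 / 3) *
     ((if vertex_eq_dec (xp (path w) (S k)) v then / cntp (path w) k v else 0) -
      (if adjb d r (xp (path w) k) v then / Wt d r (xp (path w)) (cntp (path w)) k else 0))) n = Nv v (path w) n).
  { apply bsum_ext. intros k _. rewrite Wsum_Wt; auto.
    assert (H := good_adj w Hw k). unfold adjb in H. rewrite !andb_true_iff in H. tauto. }
  rewrite E. assert (Hm := pos_INR m).
  apply Rnot_lt_le. intros Hlt. apply Hs. exists (t0 + n)%nat. split; [lia|].
  unfold Mv. replace (t0 + n - t0)%nat with n by lia.
  assert (Hp := Rpower_pos (INR (Zc t0 z0 (path w) (t0 + n) v)) (- (1 / 3))).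
  assert (Hsq : Rabs (Nv v (path w) n) * Rabs (Nv v (path w) n) = Nv v (path w) n * Nv v (path w) n).
  { rewrite <- Rabs_mult. apply Rabs_right. apply Rle_ge, Rle_0_sqr. }
  rewrite <- Hsq. nra.
Qed.

Lemma cntp_0 h v : validb d r v = true -> 1 <= cntp h 0 v.
Proof. intros Hv. apply Zc_pos. apply in_vertices; auto. Qed.

Lemma cntp_S h n v : cntp h (S n) v = cntp h n v + (if vertex_eq_dec (xp h (S n)) v then 1 else 0).
Proof.
  unfold cntp, xp. rewrite Nat.add_succ_r, Zc_S, plus_INR by lia. f_equal.
  destruct (vertex_eq_dec _ _); auto.
Qed.

Lemma tot_eq h n : (forall n, adjb d r (xp h n) (xp h (S n)) = true) -> tot d r (cntp h) n = INR (t0 + n).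
Proof.
  intros Ha. induction n as [|n IH].
  - unfold tot, zeta, sI, Zi, Li. rewrite <- (sum_vertices (fun v => cntp h 0 v)). rewrite Nat.add_0_r.
    rewrite (sumR_ext _ (fun v => INR (z0 v))).
    + unfold t0_of. generalize (vertices d r). clear. intros l. induction l as [|v l IHl]; simpl; auto. rewrite IHl, plus_INR. auto.
    + intros v _. unfold cntp, Zc. rewrite Nat.add_0_r, Nat.sub_diag. simpl. rewrite Nat.add_0_r. auto.
  - rewrite (tot_S d r (xp h) (cntp h)); auto using cntp_S. rewrite IH, Nat.add_succ_r, S_INR. auto.
Qed.

(** * The events of the theorem *)

Lemma dist_le h t c : 0 <= c ->
  (forall v, In v (vertices d r) -> Rabs (INR (Zc t0 z0 h t v) / INR t - pi_unif d v) <= c) ->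
  dist_unif d r z0 h t <= c.
Proof.
  intros Hc H. unfold dist_unif. revert H. generalize (vertices d r). intros l. induction l as [|v l IH]; simpl; intros H; auto.
  apply Rmax_lub; [apply H; simpl; auto|]. apply IH. intros; apply H; simpl; auto.
Qed.

Lemma dist_ge h t v : In v (vertices d r) ->
  Rabs (INR (Zc t0 z0 h t v) / INR t - pi_unif d v) <= dist_unif d r z0 h t.
Proof.
  unfold dist_unif. generalize (vertices d r). intros l. induction l as [|u l IH]; simpl; intros Hin; [tauto|].
  destruct Hin as [->|Hin]; [apply Rmax_l|]. eapply Rle_trans; [apply IH; auto|apply Rmax_r].
Qed.

Lemma F_dist (Q : R -> Prop) t : F (fun w => Q (dist_unif d r z0 (fun s => X s w) t)).
Proof.
  apply (F_path_event (fun p => Q (dist_unif d r z0 p t)) t).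
  intros h h' H. assert (E : dist_unif d r z0 h t = dist_unif d r z0 h' t); [|rewrite E; auto].
  unfold dist_unif. generalize (vertices d r). intros l. induction l as [|v l IH]; simpl; auto.
  rewrite IH, (Zc_local h h' t v H). auto.
Qed.

Lemma upper_event e theta : e <= theta -> 0 < theta -> theta < 1 / 3 -> theta <= / (INR d - 1) ->
  let E := fun w => exists C : R, exists T : nat, forall t : nat, (T <= t)%nat ->
     dist_unif d r z0 (fun s => X s w) t * Rpower (INR t) e <= C in
  F E /\ P E = 1.
Proof.
  intros He H0 H1 H2 E.
  assert (HF : F E).
  (* A natural number in place of the real constant makes the union countable. *)
  { apply (F_iff (fun w => exists m T : nat, forall t : nat, (T <= t)%nat ->
     dist_unif d r z0 (fun s => X s w) t * Rpower (INR t) e <= INR m)).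
    - apply (F_ex (fun m w => exists T : nat, forall t : nat, (T <= t)%nat -> _)). intros m.
      apply (F_ex (fun T w => forall t : nat, (T <= t)%nat -> _)). intros T.
      apply (F_all (fun t w => (T <= t)%nat -> _)). intros t.
      apply (F_dist (fun x => (T <= t)%nat -> x * Rpower (INR t) e <= INR m)).
    - intros w. split.
      + intros (m & T & H). exists (INR m), T. auto.
      + intros (C & T & H). destruct (INR_unbounded C) as (m & Hm). exists m, T. intros t Ht.
        specialize (H t Ht). lra. }
  split; auto. apply (full_of_null E bad HF bad_null). intros w Hw.
  assert (Ha := good_adj w Hw).
  destruct (path_upper d r (xp (path w)) (cntp (path w)) d3 Ha (cntp_0 (path w)) (cntp_S (path w)) (good_martingale w Hw) theta H0 H1 H2)
    as (C & HC & H).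
  exists C, (S t0). intros t Ht. destruct (H (t - t0)%nat) as [H3 H4].
  rewrite (tot_eq _ _ Ha) in H3, H4. unfold cntp in H3, H4. replace (t0 + (t - t0))%nat with t in H3, H4 by lia.
  assert (Ht1 : 1 <= INR t) by (change 1 with (INR 1); apply le_INR; lia).
  assert (Hp := Rpower_pos (INR t) (- theta)). assert (Hp' := Rpower_pos (INR t) e).
  assert (Hd : dist_unif d r z0 (fun s => X s w) t <= C * Rpower (INR t) (- theta)).
  { apply dist_le; [apply Rmult_le_pos; lra|]. intros v Hv. apply in_vertices in Hv. destruct v as [i|i k].
    - apply valid_Int in Hv. simpl pi_unif. apply H3; auto.
    - apply valid_Leaf in Hv. destruct Hv as [Hi Hk]. simpl pi_unif. rewrite Rminus_0_r, Rabs_right; [apply H4; auto|].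
      apply Rle_ge, Rmult_le_pos; [apply pos_INR|left; apply Rinv_0_lt_compat; lra]. }
  apply Rle_trans with (C * Rpower (INR t) (- theta) * Rpower (INR t) e); [apply Rmult_le_compat_r; lra|].
  rewrite Rmult_assoc, <- Rpower_plus. rewrite <- (Rmult_1_r C) at 2. apply Rmult_le_compat_l; auto.
  rewrite <- (Rpower_O (INR t)) by lra. apply Rpower_exp_mono; lra.
Qed.

Lemma lower_event delta : 0 < delta -> (exists i, interior d i /\ (1 <= r i)%nat) ->
  let E := fun w => forall C : R, exists T : nat, forall t : nat, (T <= t)%nat ->
     C <= dist_unif d r z0 (fun s => X s w) t * Rpower (INR t) ((INR d - 2) / (INR d - 1) + delta) in
  F E /\ P E = 1.
Proof.
  intros Hdel (i & Hi & Hri) E. set (e := (INR d - 2) / (INR d - 1) + delta) in *.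
  assert (HF : F E).
  { apply (F_iff (fun w => forall m : nat, exists T : nat, forall t : nat, (T <= t)%nat ->
     INR m <= dist_unif d r z0 (fun s => X s w) t * Rpower (INR t) e)).
    - apply (F_all (fun m w => exists T : nat, forall t : nat, (T <= t)%nat -> _)). intros m.
      apply (F_ex (fun T w => forall t : nat, (T <= t)%nat -> _)). intros T.
      apply (F_all (fun t w => (T <= t)%nat -> _)). intros t.
      apply (F_dist (fun x => (T <= t)%nat -> INR m <= x * Rpower (INR t) e)).
    - intros w. split.
      + intros H C. destruct (INR_unbounded C) as (m & Hm). destruct (H m) as (T & HT). exists T. intros t Ht.
        specialize (HT t Ht). lra.
      + intros H m. apply H. }
  split; auto. apply (full_of_null E bad HF bad_null). intros w Hw C.
  assert (Ha := good_adj w Hw). assert (HD := INR_d_ge3 d d3).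
  assert (Hid : 0 < / (INR d - 1)) by (apply Rinv_0_lt_compat; lra).
  (* The second bound keeps the leaf exponent [1/(d-1) - s] positive, the first leaves a surplus
     [delta - s]. *)
  set (s := Rmin (delta / 2) (/ (INR d - 1) / 2)).
  assert (Hs : 0 < s) by (apply Rmin_pos; lra).
  assert (Hs1 : s <= delta / 2) by apply Rmin_l. assert (Hs2 : s <= / (INR d - 1) / 2) by apply Rmin_r.
  destruct (path_leaf_lower d r (xp (path w)) (cntp (path w)) d3 Ha (cntp_0 (path w)) (cntp_S (path w)) (good_martingale w Hw)
    i 1 (/ (INR d - 1) - s) ltac:(lra) ltac:(lra) Hi ltac:(lia)) as (c & n0 & Hc & H).
  (* The exponent of [t] that remains after division of the leaf count by [t] and multiplication by
     [t^e], since [1/(d-1) + (d-2)/(d-1) = 1]. *)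
  set (sg := delta - s).
  destruct (Rpower_inv_small sg (c / (Rabs C + 1))) as (A & HA).
  { unfold sg; lra. }
  { apply Rdiv_lt_0_compat; auto. assert (H1 := Rabs_pos C). lra. }
  destruct (INR_unbounded A) as (T & HT).
  exists (S t0 + n0 + T)%nat. intros t Ht. specialize (H (t - t0)%nat ltac:(lia)).
  rewrite (tot_eq _ _ Ha) in H. unfold cntp in H. replace (t0 + (t - t0))%nat with t in H by lia.
  assert (Ht1 : 1 <= INR t) by (change 1 with (INR 1); apply le_INR; lia).
  assert (HtA : A <= INR t) by (assert (INR T <= INR t) by (apply le_INR; lia); lra).
  specialize (HA (INR t) HtA).
  assert (Hg : INR (Zc t0 z0 (path w) t (Leaf i 1)) / INR t <= dist_unif d r z0 (fun s => X s w) t).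
  { eapply Rle_trans; [|apply (dist_ge (path w) t (Leaf i 1))].
    - simpl pi_unif. rewrite Rminus_0_r. apply Rle_abs.
    - apply in_vertices, valid_Leaf. split; [auto|lia]. }
  assert (Hp := Rpower_pos (INR t) e).
  apply Rle_trans with (c * Rpower (INR t) (/ (INR d - 1) - s) / INR t * Rpower (INR t) e).
  - replace (c * Rpower (INR t) (/ (INR d - 1) - s) / INR t * Rpower (INR t) e) with (c * Rpower (INR t) sg).
    + assert (Hpg := Rpower_pos (INR t) sg). rewrite Rpower_Ropp in HA. assert (HC := Rabs_pos C).
      assert (H1 : Rabs C + 1 < c * Rpower (INR t) sg).
      { apply (Rmult_lt_compat_r (Rpower (INR t) sg * (Rabs C + 1))) in HA; [|apply Rmult_lt_0_compat; lra].
        replace (/ Rpower (INR t) sg * (Rpower (INR t) sg * (Rabs C + 1))) with (Rabs C + 1) in HA by (field; lra).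
        replace (c / (Rabs C + 1) * (Rpower (INR t) sg * (Rabs C + 1))) with (c * Rpower (INR t) sg) in HA by (field; lra). lra. }
      assert (H2 := Rle_abs C). lra.
    + unfold Rdiv. rewrite !Rmult_assoc. f_equal. rewrite <- (Rpower_1 (INR t)) at 3 by lra.
      rewrite <- Rpower_Ropp, <- !Rpower_plus. f_equal. unfold sg, e. field. lra.
  - apply Rmult_le_compat_r; [lra|]. eapply Rle_trans; [|apply Hg].
    apply Rmult_le_compat_r; auto. left; apply Rinv_0_lt_compat; lra.
Qed.

End Prob.

Theorem theorem2 :
  forall (d : nat) (r : nat -> nat) (z0 : vertex -> nat) (x0 : vertex)
    (Omega : Type) (F : (Omega -> Prop) -> Prop) (P : (Omega -> Prop) -> R)
    (X : nat -> Omega -> vertex),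
  (3 <= d)%nat ->
  (forall v, In v (vertices d r) -> (1 <= z0 v)%nat) ->
  In x0 (vertices d r) ->
  is_prob_space Omega F P ->
  is_VRRW d r z0 x0 Omega F P X ->
  forall delta : R, 0 < delta ->
  (* (a) d in {3,4}: limsup ||pi(t)-pi_unif|| t^(1/3-delta) < oo a.s. *)
  ((d = 3%nat \/ d = 4%nat) ->
     let E := fun w => exists C : R, exists T : nat, forall t : nat, (T <= t)%nat ->
                dist_unif d r z0 (fun s => X s w) t * Rpower (INR t) (1/3 - delta) <= C in
     F E /\ P E = 1) /\
  (* (b) d >= 5: limsup ||pi(t)-pi_unif|| t^(1/(d-1)) < oo a.s. *)
  ((5 <= d)%nat ->
     let E := fun w => exists C : R, exists T : nat, forall t : nat, (T <= t)%nat ->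
                dist_unif d r z0 (fun s => X s w) t * Rpower (INR t) (1 / (INR d - 1)) <= C in
     F E /\ P E = 1) /\
  (* (c) at least one leaf: liminf ||pi(t)-pi_unif|| t^((d-2)/(d-1)+delta) = oo a.s. *)
  ((exists i, (1 <= i <= d)%nat /\ (1 <= r i)%nat) ->
     let E := fun w => forall C : R, exists T : nat, forall t : nat, (T <= t)%nat ->
                C <= dist_unif d r z0 (fun s => X s w) t *
                     Rpower (INR t) ((INR d - 2) / (INR d - 1) + delta) in
     F E /\ P E = 1).
Proof.
  intros d r z0 x0 Omega F P X Hd Hz Hx HP HX delta Hdel. split; [|split].
  (* The cap 1/12 keeps the rate [1/3 - s] positive when [delta] is large; for [d <= 4] it is below
     [1/(d-1)]. *)
  - intros H. set (s := Rmin delta (1 / 12)).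
    assert (Hs : 0 < s) by (apply Rmin_pos; lra).
    assert (Hs1 : s <= delta) by apply Rmin_l. assert (Hs2 : s <= 1 / 12) by apply Rmin_r.
    apply (upper_event Omega F P HP d r z0 x0 X Hd Hz Hx HX _ (1 / 3 - s)); try lra.
    destruct H as [-> | ->]; simpl INR; apply (Rmult_le_reg_r 6); lra.
  (* Now [1/(d-1) <= 1/4 < 1/3], so the critical rate itself is admissible. *)
  - intros H. assert (HD : 5 <= INR d) by (replace 5 with (INR 5) by (simpl; ring); apply le_INR; auto).
    assert (0 < / (INR d - 1)) by (apply Rinv_0_lt_compat; lra).
    assert (/ (INR d - 1) <= / 4) by (apply Rinv_le_contravar; lra).
    apply (upper_event Omega F P HP d r z0 x0 X Hd Hz Hx HX _ (/ (INR d - 1))); lra.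
  - intros H. apply (lower_event Omega F P HP d r z0 x0 X Hd Hz Hx HX delta Hdel H).
Qed.
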